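(* Let $\mu,\nu$ be probability measures on $\Gamma_X$ satisfying Hypothesis (H), with $\mu(\eta(X)=+\infty)=1$, $\mu$ regular, and $\inf_{\gamma\in\Sigma(\mu,\nu)}\int c\,d\gamma<\infty$. Let $\gamma$ be an optimal measure for MKP$(\mu,\nu,c)$ and let $\Lambda\subset X$ be compact. Then there exists a measurable map $T_\Lambda:\Gamma_\Lambda\times\Gamma_{\Lambda^c}\to\Gamma_X$ such that $$\gamma\Big((\eta,\omega):\ r_2^\Lambda(\beta_{\eta,\omega})=T_\Lambda(\pi^\Lambda\eta,\pi^{\Lambda^c}\eta)\Big)=1,$$ for $\beta_{\eta,\omega}$ realizing $c(\eta,\omega)$.
   Context: $X=\mathbb{R}^k$; for $Y\subset X$, $\Gamma_Y$ is the set of locally finite subsets of $Y$ identified with counting measures, vague topology; $\eta(B)$ = number of points in $B$. Cost: $c(\eta_1,\eta_2)=\inf\{\int\frac12\|x-y\|^2d\beta:\beta\in\Gamma_{X\times X}$ with marginals $\eta_1,\eta_2\}$, $\inf\emptyset=+\infty$; a minimizing $\beta$ is denoted $\beta_{\eta_1,\eta_2}$ and said to realize $c(\eta_1,\eta_2)$. MKP$(\mu,\nu,c)$: minimize $\int c\,d\gamma$ over couplings $\gamma\in\Sigma(\mu,\nu)$; minimizers are optimal measures. $\pi^\Lambda(\eta)=\eta\cap\Lambda$. For $\beta\in\Gamma_{X\times X}$, $r^\Lambda\beta=\beta\cap(\Lambda\times X)$ and $r^\Lambda_2\beta=p_2(r^\Lambda\beta)$ is its second-coordinate configuration. Hypothesis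 (H) on a probability $\mu$ on $\Gamma_X$: (i) $\eta(\{x\})\in\{0,1\}$ for all $x$, $\mu$-a.s.; (ii) either $\mu(\eta(X)<\infty)=1$ or $\mu(\eta(X)=\infty)=1$; (iii) for every smooth compactly supported vector field $v$ with flow $\mathcal V^v_t$ and every $t$, $\mu$ is quasi-invariant under $\eta\mapsto\sum_{x\in\eta}\varepsilon_{\mathcal V^v_t(x)}$. The expected number of points $E_\mu[\eta(B)]$ defines a Radon measure (so $\eta(\Lambda)<\infty$ a.s. for compact $\Lambda$). Regularity: for a probability $m$ on $\Gamma_\Lambda$, $\Lambda$ compact, and $n\ge1$, let $\hat m_n$ be the symmetric probability on $\{(x_1,\dots,x_n)\in\Lambda^n:x_i\ne x_j\}$ whose image under $(x_i)\mapsto\sum\varepsilon_{x_i}$ is $m(\cdot\mid\eta(\Lambda)=n)$; $m$ is regular if every $\hat m_n$ is absolutely continuous w.r.t. Lebesgue measure. For $\mu$ on $\Gamma_X$, ''regular'' is taken to mean that $\pi^\Lambda\mu$ is regular for every compact $\Lambda$. *)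

(* Defs.v *)
From HB Require Import structures.
From mathcomp Require Import all_boot all_order all_algebra all_fingroup.
From mathcomp Require Import all_classical all_reals all_analysis.
Import numFieldNormedType.Exports.
Import Order.TTheory GRing.Theory Num.Theory.

Set Implicit Arguments.
Unset Strict Implicit.
Unset Printing Implicit Defensive.

Local Open Scope classical_set_scope.
Local Open Scope ring_scope.

Section ConfigSpaces.
Variables (R : realType) (k : nat).

Definition Xpt := 'rV[R]_k.

Definition halfsqd (x y : Xpt) : R :=
  (\sum_(i < k) (x ord0 i - y ord0 i) ^+ 2) / 2.

(* a (multi)configuration is represented by its multiplicity function;
   eta(B) = number of points (with multiplicity) in B *)
Definition cnt (eta : Xpt -> nat) (B : set Xpt) : \bar R :=
  (\esum_(x in B) (eta x)%:R%:E)%E.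

Definition bounded_pt (B : set Xpt) := exists r : R, forall x, B x -> `|x| <= r.

Definition pborel : set (set Xpt) := <<s [set U : set Xpt | open U] >>.

(* sigma-algebra of Gamma_X (Borel sigma-algebra of the vague topology):
   generated by the counting maps eta |-> eta(B), B bounded Borel *)
Definition config_gen : set (set (Xpt -> nat)) :=
  [set A | exists (B : set Xpt) (n : nat),
     [/\ pborel B, bounded_pt B & A = [set eta | cnt eta B = (n%:R)%:E]]].

Definition config := g_sigma_algebraType config_gen.

Definition locfin (eta : Xpt -> nat) :=
  forall B, bounded_pt B -> (cnt eta B < +oo)%E.

Definition piL (L : set Xpt) (eta : Xpt -> nat) : config :=
  fun x => if `[< L x >] then eta x else 0%N.

Definition pconfig := (Xpt * Xpt)%type -> nat.

Definition locfin2 (beta : pconfig) :=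
  forall B : set (Xpt * Xpt),
    (exists r : R, forall p, B p -> `|(p.1 : 'rV[R]_k)| <= r /\ `|(p.2 : 'rV[R]_k)| <= r) ->
    (\esum_(p in B) ((beta p)%:R : R)%:E < +oo)%E.

Definition plans (eta1 eta2 : Xpt -> nat) : set pconfig :=
  [set beta | [/\ locfin2 beta,
     forall x, (((eta1 x)%:R : R)%:E = \esum_(y in setT) ((beta (x, y))%:R : R)%:E)%E &
     forall y, (((eta2 y)%:R : R)%:E = \esum_(x in setT) ((beta (x, y))%:R : R)%:E)%E]].

Definition tcost (beta : pconfig) : \bar R :=
  (\esum_(p in setT) ((beta p)%:R : R)%:E * (halfsqd p.1 p.2)%:E)%E.

(* c(eta1, eta2), with inf of the empty set = +oo *)
Definition cost (eta1 eta2 : Xpt -> nat) : \bar R :=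
  ereal_inf [set tcost beta | beta in plans eta1 eta2].

Definition realizes (beta : pconfig) (eta1 eta2 : Xpt -> nat) :=
  plans eta1 eta2 beta /\ tcost beta = cost eta1 eta2.

Definition couplings (mu nu : probability config R) :
    set (probability (config * config)%type R) :=
  [set g | forall A : set config, measurable A ->
     g (fst @^-1` A) = mu A /\ g (snd @^-1` A) = nu A].

Definition mk_cost (g : probability (config * config)%type R) : \bar R :=
  (\int[g]_p cost p.1 p.2)%E.

Definition optimal (mu nu : probability config R)
    (g : probability (config * config)%type R) :=
  couplings mu nu g /\ forall g', couplings mu nu g' -> (mk_cost g <= mk_cost g')%E.

Fixpoint iterD (vs : seq Xpt) (f : Xpt -> Xpt) : Xpt -> Xpt :=
  match vs with
  | [::] => f
  | v :: vs' => fun x => 'D_v (iterD vs' f) x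
  end.

Definition smooth (f : Xpt -> Xpt) :=
  forall vs : seq Xpt,
    continuous (iterD vs f) /\ forall v x, derivable (iterD vs f) x v.

Definition compact_support (f : Xpt -> Xpt) :=
  compact (closure [set x | f x != 0]).

Definition is_flow (v : Xpt -> Xpt) (Phi : R -> Xpt -> Xpt) :=
  (forall x, Phi 0 x = x) /\
  forall t x, is_derive t (1 : R) (fun s => Phi s x) (v (Phi t x)).

(* eta |-> sum_{x in eta} eps_{f x}, for an injective f (flows are bijections) *)
Definition img (f : Xpt -> Xpt) (eta : config) : config :=
  fun y => match pselect (exists x, f x = y) with
           | left h => eta (projT1 (cid h))
           | right _ => 0%N
           end.

Definition HypH (mu : probability config R) :=
  [/\ (* mu lives on Gamma_X (locally finite configurations) *)
      {ae mu, forall eta : config, locfin eta},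
      {ae mu, forall eta : config, forall x, (eta x <= 1)%N},
      mu [set eta | (cnt eta setT < +oo)%E] = 1%E \/
      mu [set eta | cnt eta setT = +oo%E] = 1%E,
      (forall v : Xpt -> Xpt, smooth v -> compact_support v ->
       forall Phi, is_flow v Phi -> forall t : R,
       forall A : set config, measurable A ->
         (mu A = 0%E <-> mu [set eta | A (img (Phi t) eta)] = 0%E)) &
      (* the intensity measure E_mu[eta(B)] is Radon (finite on compacts) *)
      (forall B : set Xpt, pborel B -> compact B ->
         (\int[mu]_eta cnt eta B < +oo)%E)].

(* n-tuples of points of X = n x k matrices (row i = i-th Xpt),
   with the Borel sigma-algebra *)
Definition tuples (n : nat) :=
  g_sigma_algebraType [set U : set 'M[R]_(n, k) | open U].

Definition lnull (n : nat) (A : set 'M[R]_(n, k)) :=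
  forall eps : R, 0 < eps ->
  exists a b : nat -> 'M[R]_(n, k),
    [/\ forall j i l, a j i l <= b j i l,
        A `<=` \bigcup_j [set x | forall i l, a j i l <= x i l <= b j i l] &
        (\sum_(j <oo) (\prod_(i < n) \prod_(l < k) (b j i l - a j i l))%:E
           <= eps%:E)%E].

Definition sumdirac (n : nat) (x : 'M[R]_(n, k)) : config :=
  fun y => #|[set i : 'I_n | row i x == y]|.

Definition regular (mu : probability config R) :=
  forall L : set Xpt, compact L ->
  forall n : nat, (0 < n)%N ->
  let p := mu [set eta | cnt eta L = (n%:R)%:E] in
  (0 < p)%E ->
  exists mh : probability (tuples n) R,
    [/\
        mh [set x | (forall i, L (row i x)) /\
                    (forall i j, i != j -> row i x != row j x)] = 1%E,
        (forall (s : 'S_n) (A : set (tuples n)), measurable A ->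
           mh [set x | A (row_perm s x)] = mh A),
        (* image is (pi^L mu)( . | eta(L) = n) *)
        (forall B : set config, measurable B ->
           (mh [set x | B (sumdirac x)] * p)%E =
           mu [set eta | B (piL L eta) /\ cnt eta L = (n%:R)%:E]) &
        (forall A : set (tuples n), measurable A -> lnull A -> mh A = 0%E)].

End ConfigSpaces.

(* Main.v *)
Require Import Defs.
From HB Require Import structures.
From mathcomp Require Import all_boot all_order all_algebra all_fingroup.
From mathcomp Require Import all_classical all_reals all_analysis.
From mathcomp Require Import measurable_realfun giry ring lra.
Import numFieldNormedType.Exports.
Import Order.TTheory GRing.Theory Num.Theory.
Local Open Scope classical_set_scope.
Local Open Scope ring_scope.

(** The only competitors needed exchange the sources of two target points.  Fix a small
    box [U], a coordinate [i] and [q < q'], and restrict [gamma] to the events [E] and [E']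
    that [eta] has a single point in [U] and that some optimal plan sends it to a target [y]
    with [y_i <= q], respectively [y_i >= q'].  Let [Phi_t] be a flow that fixes the
    complement of [U] and moves every point of [U] strictly down along [e_i].  If the law
    of [Phi_t^-1 eta'] on [E'] overlapped the law of [eta] on [E], then moving the point of
    [eta] down on part of [E], and that of [eta'] up on part of [E'], would keep both
    marginals and strictly lower the total cost, by
    [(x_i - Phi_t(x)_i) * (y_i - y'_i) < 0].  So these laws are mutually singular for every
    [t > 0].  Among the uncountably many translates under [Phi] of a set of positive [mu]
    measure two must overlap, so quasi-invariance of [mu] extends the singularity to
    [t = 0]: the first marginals of [gamma] on [E] and [E'] are mutually singular.  Letting
    [U], [i], [q], [q'] range over a countable family, each coordinate of the target of each
    point of [eta] is a measurable function of [eta], almost surely. *)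

(** * A bump vector field on the line and its flow *)

(** Hypothesis (H) gives quasi-invariance under flows only, so displacements have to be flows;
    supporting one in a box with a single point of [eta] confines the change of a plan to one pair.
    At [t = 0] the exchange has equal sources and returns the same coupling, so it gains nothing:
    singularity must be proved for [t > 0] and carried to [t = 0] by another argument. Since the
    laws on [E] and [E'] may overlap only partially, the exchange is weighted by densities and the
    competitor is a randomised displacement of [gamma]. No optimal plan is selected measurably. The
    events compare [cost] with a constrained cost [ccost], and every optimal plan witnesses them, so
    the conclusion holds for each optimal plan. Both costs are infima over uncountable sets; their
    measurability rests on finite matchings and compactness. It is obtained on measurable sets of
    simple locally finite configurations, which is why the integral of the cost is first treated as
    a lower integral. *)

Section Smooth.
Context {R : realType}.

(** Differentiability is asked along every constant vector, which is the form used by [iterD] and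
    [smooth]. Real values keep the product and quotient rules available. *)
Fixpoint Cn {V : normedModType R} (n : nat) (f : V -> R) : Prop :=
  continuous f /\
  (if n is n'.+1 then
     forall v, (forall x, derivable f x v) /\ Cn n' (fun x => 'D_v f x)
   else True).

Section Generic.
Variable V : normedModType R.
Implicit Types f g : V -> R.

Lemma CnS n f : Cn n.+1 f -> Cn n f.
Proof.
elim: n f => [|n IH] f; first by move=> [].
move=> [cf H]; split=> // v; split; first by case: (H v).
by apply: IH; case: (H v).
Qed.

Lemma Cn_cont n f : Cn n f -> continuous f.
Proof. by case: n => [|n] []. Qed.

Lemma Cn_cst n (c : R) : Cn n (fun _ : V => c).
Proof.
elim: n c => [|n IH] c; split=> //; try by [exact: cst_continuous|move=> x; exact: cvg_cst].
move=> v.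
split=> [x|]; first exact: derivable_cst.
have -> : (fun x => 'D_v (fun=> c) x) = (fun _ : V => 0 : R).
  by apply/funext => x; exact: derive_cst.
exact: IH.
Qed.

Lemma Cn_add n f g : Cn n f -> Cn n g -> Cn n (fun x => f x + g x).
Proof.
elim: n f g => [|n IH] f g [cf Hf] [cg Hg]; split=> //;
  try by move=> x; apply: cvgD; [exact: cf|exact: cg].
move=> v.
have [df Hf'] := Hf v; have [dg Hg'] := Hg v.
split=> [x|]; first exact: (derivableD (df x) (dg x)).
have -> : (fun x => 'D_v (fun x => f x + g x) x) =
          (fun x => 'D_v f x + 'D_v g x).
  by apply/funext => x; exact: (deriveD (df x) (dg x)).
exact: IH.
Qed.

Lemma Cn_mul n f g : Cn n f -> Cn n g -> Cn n (fun x => f x * g x).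
Proof.
elim: n f g => [|n IH] f g.
  move=> [cf Hf] [cg Hg]; split=> // x.
  by apply: cvgM; [exact: cf|exact: cg].
(* The product rule leaves undifferentiated factors, to which the induction hypothesis applies only
   after lowering their class by one. *)
move=> F G; have F1 := @CnS _ _ F; have G1 := @CnS _ _ G.
move: F G => [cf Hf] [cg Hg]; split=> [x|v].
  by apply: cvgM; [exact: cf|exact: cg].
have [df Hf'] := Hf v; have [dg Hg'] := Hg v.
split=> [x|]; first exact: (derivableM (df x) (dg x)).
have -> : (fun x => 'D_v (fun x => f x * g x) x) =
          (fun x => f x * 'D_v g x + g x * 'D_v f x).
  by apply/funext => x; exact: (deriveM (df x) (dg x)).
by apply: Cn_add; apply: IH.
Qed.

Lemma Cn_scale n (c : R) f : Cn n f -> Cn n (fun x => c * f x).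
Proof. by apply: Cn_mul; exact: Cn_cst. Qed.

Lemma Cn_inv n f : (forall x, f x != 0) -> Cn n f -> Cn n (fun x => (f x)^-1).
Proof.
move=> f0; elim: n => [|n IH].
  move=> [cf Hf]; split=> // x.
  by apply: cvgV; [exact: f0|exact: cf].
move=> F; have F1 := @CnS _ _ F.
move: F => [cf Hf]; split=> [x|v].
  by apply: cvgV; [exact: f0|exact: cf].
have [df Hf'] := Hf v.
split=> [x|]; first exact: (derivableV (f0 x) (df x)).
have -> : (fun x => 'D_v (fun x => (f x)^-1) x) =
          (fun x => -1 * (((f x)^-1 * (f x)^-1) * 'D_v f x)).
  apply/funext => x; rewrite (deriveV (f0 x) (df x)).
  by rewrite /GRing.scale /= -exprVn expr2; ring.
apply: Cn_scale; apply: Cn_mul => //.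
by apply: Cn_mul; exact: IH.
Qed.

End Generic.

(** The map [l] is affine with linear part [l0], so the difference quotients of the composite along
    [v] are literally those of [g] along [l0 v]. *)
Lemma Cn_comp (V : normedModType R) n (g : R -> R) (l : V -> R) (l0 : V -> R) :
  continuous l ->
  (forall h v x, l (h *: v + x) = h * l0 v + l x) ->
  Cn n g -> Cn n (fun x => g (l x)).
Proof.
move=> cl ll; elim: n g => [|n IH] g [cg Hg]; split=> //;
  try by move=> x; apply: continuous_comp; [exact: cl|exact: cg].
move=> v.
have [dg Hg'] := Hg (l0 v).
have E x : (fun h : R => h^-1 *: (((fun x => g (l x)) \o shift x) (h *: v) - g (l x)))
   = (fun h : R => h^-1 *: ((g \o shift (l x)) (h *: l0 v) - g (l x))).
  by apply/funext => h /=; rewrite ll.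
split=> [x|].
  by rewrite /derivable E; exact: dg.
have -> : (fun x => 'D_v (fun x => g (l x)) x) = (fun x => 'D_(l0 v) g (l x)).
  by apply/funext => x; rewrite /derive E.
exact: (IH (fun y => 'D_(l0 v) g y) Hg').
Qed.

Lemma Cn_prod (V : normedModType R) n (I : Type) (s : seq I) (P : pred I)
   (F : I -> V -> R) :
  (forall i, Cn n (F i)) -> Cn n (fun x => \prod_(i <- s | P i) F i x).
Proof.
move=> H; elim: s => [|i s IH].
  have -> : (fun x => \prod_(i <- [::] | P i) F i x) = (fun _ => 1).
    by apply/funext => x; rewrite big_nil.
  exact: Cn_cst.
have -> : (fun x => \prod_(i <- i :: s | P i) F i x) =
  (fun x => (if P i then F i x else 1) * \prod_(i <- s | P i) F i x).
  by apply/funext => x; rewrite big_cons; case: ifP => //; rewrite mul1r.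
apply: Cn_mul => //; case: (P i) => //; exact: Cn_cst.
Qed.

(** Raise [y / n <= exp (y / n)] to the power [n]. *)
Lemma expR_ge_pow (y : R) n : 0 <= y -> y ^+ n <= n%:R ^+ n * expR y.
Proof.
move=> y0; case: n => [|n]; first by rewrite !expr0 mul1r -expR0 ler_expR.
have n0 : (0 : R) < n.+1%:R by rewrite ltr0n.
have -> : expR y = expR (y / n.+1%:R) ^+ n.+1.
  by rewrite -expRM_natr divfK ?gt_eqF.
rewrite -exprMn; apply: lerXn2r; rewrite ?nnegrE ?mulr_ge0 ?expR_ge0 ?ler0n//.
rewrite mulrC -ler_pdivrMr//; apply: le_trans (expR_ge1Dx _).
by rewrite lerDr.
Qed.

(* The span of the [flat m] is stable under differentiation, which gives smoothness at 0. *)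
Definition flat (m : nat) (x : R) : R :=
  if 0 < x then x^-1 ^+ m * expR (- x^-1) else 0.

(** The exponential bound at [1 / x] with exponent [m + 2] leaves two spare powers of [x]: the
    difference quotient at 0 absorbs one, and the other makes it vanish. *)
Lemma flat_le_sqr m x : `|flat m x| <= (m + 2)%:R ^+ (m + 2) * x ^+ 2.
Proof.
rewrite /flat; case: ifPn => [x0|_]; last first.
  by rewrite normr0 mulr_ge0 ?sqr_ge0// exprn_ge0.
rewrite ger0_norm; last by rewrite mulr_ge0 ?expR_ge0 ?exprn_ge0 ?invr_ge0 ?ltW.
have xi0 : 0 <= x^-1 by rewrite invr_ge0 ltW.
have := expR_ge_pow _ (m + 2)%N xi0.
rewrite exprD expRN; set C := _ ^+ (m + 2) => H.
rewrite ler_pdivrMr ?expR_gt0// mulrAC -ler_pdivrMr ?exprn_gt0//.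
by rewrite -exprVn.
Qed.

Lemma flat_le_sqr' m x : `|flat m x| <= (m + 2)%:R ^+ (m + 2) * `|x| ^+ 2.
Proof. by apply: le_trans (flat_le_sqr _ _) _; rewrite real_normK ?num_real. Qed.

Lemma is_derive_cvg (V : normedModType R) (f : R -> V) (x : R) (l : V) :
  h^-1 *: (f (h + x) - f x) @[h --> 0^'] --> l -> is_derive x (1 : R) f l.
Proof.
move=> H.
have E : (fun h : R => h^-1 *: ((f \o shift x) (h *: (1 : R)) - f x)) =
   (fun h : R => h^-1 *: (f (h + x) - f x)).
  by apply/funext => h /=; rewrite /GRing.scale /= mulr1.
apply: DeriveDef; first by rewrite /derivable E; apply: cvgP H.
by rewrite /derive E; apply: cvg_lim H.
Qed.

Lemma is_derive_flat m x :
  is_derive x (1 : R) (flat m) (flat m.+2 x - m%:R * flat m.+1 x).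
Proof.
have [x0|x0|->] := ltgtP x 0.
- rewrite /flat !ltNge (ltW x0)/= mulr0 subr0.
  apply: (@near_eq_is_derive _ _ _ (cst 0)).
  near=> y; rewrite ltNge ltW//=; near: y; exact: lt_nbhsl.
- rewrite /flat x0.
  have xn0 : x != 0 by rewrite gt_eqF.
  have Hi := is_deriveV xn0 (is_derive_id x (1 : R)).
  have Hp := is_deriveX m Hi.
  have Hn := is_deriveN Hi.
  have He := @is_derive1_comp R expR (- GRing.inv) x _ _ (is_derive_expR (- x^-1)) Hn.
  have HM := is_deriveM Hp He.
  apply: (@near_eq_is_derive _ _ _
    ((GRing.inv ^+ m) * (expR \o - GRing.inv))).
    near=> y; have -> : 0 < y by near: y; exact: lt_nbhsr.
    by rewrite /= /GRing.mul /=; congr (_ * _); rewrite exprfctE.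
  apply: is_derive_eq; rewrite /GRing.scale /= -exprVn.
  have -> : (GRing.inv ^+ m : R -> R) x = x^-1 ^+ m by rewrite exprfctE.
  have -> : (- GRing.inv : R -> R) x = - x^-1 by [].
  by case: m {Hp HM} => [|m] /=; rewrite ?exprS ?expr0; ring.
rewrite [X in is_derive _ _ _ X](_ : _ = 0); last by rewrite /flat ltxx mulr0 subr0.
apply: is_derive_cvg.
have E : forall h, h^-1 *: (flat m (h + 0) - flat m 0) = h^-1 * flat m h.
  by move=> h; rewrite addr0 {2}/flat ltxx subr0.
under eq_fun do rewrite E.
set C := (m + 2)%:R ^+ (m + 2) : R.
have C0 : 0 <= C by rewrite exprn_ge0.
apply/cvgr0Pnorm_le => e e0.
near=> h.
have hn0 : h != 0 by near: h; exact: nbhs_dnbhs_neq.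
rewrite normrM normfV mulrC ler_pdivrMr ?normr_gt0//.
apply: le_trans (flat_le_sqr' m h) _; rewrite -/C expr2 mulrA ler_wpM2r//.
have : `|h| < e / (C + 1).
  by near: h; apply: dnbhs0_lt; rewrite divr_gt0// ltr_wpDl.
rewrite ltr_pdivlMr ?ltr_wpDl// => H.
rewrite mulrC; apply: ltW; apply: le_lt_trans H; rewrite ler_wpM2l// lerDl//.
Unshelve. all: by end_near. 
Qed.

Lemma is_derive_dir (f : R -> R) (x v d : R) :
  is_derive x (1 : R) f d -> is_derive x v f (v * d).
Proof.
move=> H.
have df : differentiable f x by apply/derivable1_diffP.
have E : 'D_v f x = v * d.
  rewrite (deriveE _ df) -[v in 'd f x v]mulr1 -[v * 1]/(v *: (1 : R)) linearZ /=.
  by rewrite -deriveE// derive_val.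
by apply: DeriveDef => //; exact: diff_derivable.
Qed.

Lemma Cn_flat n m : Cn n (flat m).
Proof.
have cf m' : continuous (flat m').
  move=> x; apply: differentiable_continuous; apply/derivable1_diffP.
  exact: (@ex_derive _ _ _ _ _ _ _ (is_derive_flat m' x)).
elim: n m => [|n IH] m; split=> // v; split=> [x|].
  exact: (@ex_derive _ _ _ _ _ _ _ (is_derive_dir _ _ v _ (is_derive_flat m x))).
have -> : (fun x => 'D_v (flat m) x) =
    (fun x => v * (flat m.+2 x + (- m%:R) * flat m.+1 x)).
  apply/funext => x.
  rewrite (@derive_val _ _ _ _ _ _ _ (is_derive_dir _ _ v _ (is_derive_flat m x))).
  by rewrite mulNr.
by apply: Cn_scale; apply: Cn_add => //; exact: Cn_scale.
Qed.

Lemma Cn_id n : Cn n (fun x : R => x).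
Proof.
have ci : continuous (fun x : R => x) by move=> x; exact: cvg_id.
case: n => [|n]; split=> // v; split=> [x|]; first exact: derivable_id.
have -> : (fun x : R => 'D_v (fun x => x) x) = (fun _ => v).
  by apply/funext => x; exact: derive_id.
exact: Cn_cst.
Qed.

(* The factors [x ^+ 2] make [1 / bell] the derivative of the explicit [chart] below. *)
Definition bell (x : R) : R :=
  let a := (1 + x) ^+ 2 * flat 0 (1 + x) in
  let b := (1 - x) ^+ 2 * flat 0 (1 - x) in a * b / (a + b).

Lemma sqrflat_ge0 (x : R) : 0 <= x ^+ 2 * flat 0 x.
Proof. by rewrite mulr_ge0 ?sqr_ge0// /flat; case: ifP => // _; rewrite mulr_ge0 ?expR_ge0. Qed.

Lemma sqrflat_gt0 (x : R) : 0 < x -> 0 < x ^+ 2 * flat 0 x.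
Proof. by move=> x0; rewrite /flat x0 mulr_gt0 ?exprn_gt0// expr0 mul1r expR_gt0. Qed.

Lemma sqrflat_eq0 (x : R) : x <= 0 -> x ^+ 2 * flat 0 x = 0.
Proof. by move=> x0; rewrite /flat ltNge x0 mulr0. Qed.

Lemma bell_den_gt0 (x : R) : 0 < (1 + x) ^+ 2 * flat 0 (1 + x) + (1 - x) ^+ 2 * flat 0 (1 - x).
Proof.
have [x0|x0] := ltP 0 (1 + x).
  by rewrite ltr_pwDl ?sqrflat_gt0 ?sqrflat_ge0.
by rewrite ltr_wpDl ?sqrflat_ge0// sqrflat_gt0//; lra.
Qed.

Lemma Cn_bell n : Cn n bell.
Proof.
have Hp : Cn n (fun x : R => 1 + x) by apply: Cn_add; [exact: Cn_cst|exact: Cn_id].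
have Hm : Cn n (fun x : R => 1 + -1 * x).
  by apply: Cn_add; [exact: Cn_cst|apply: Cn_scale; exact: Cn_id].
have Hn : (fun x : R => 1 - x) = (fun x : R => 1 + -1 * x).
  by apply/funext => x; rewrite mulN1r.
have cA : continuous (fun x : R => 1 + x) := Cn_cont _ _ _ Hp.
have A : Cn n (fun x : R => (1 + x) ^+ 2 * flat 0 (1 + x)).
  apply: Cn_mul; first exact: Cn_mul.
  have := @Cn_comp R n (flat 0) (fun x => 1 + x) id cA.
  apply; last exact: Cn_flat.
  by move=> h v x; rewrite /GRing.scale /=; ring.
have B : Cn n (fun x : R => (1 - x) ^+ 2 * flat 0 (1 - x)).
  rewrite -Hn in Hm; have cB := Cn_cont _ _ _ Hm.
  apply: Cn_mul; first exact: Cn_mul.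
  have := @Cn_comp R n (flat 0) (fun x => 1 - x) (fun x => - x) cB.
  apply; last exact: Cn_flat.
  by move=> h v x; rewrite /GRing.scale /=; ring.
apply: Cn_mul; first exact: Cn_mul.
apply: Cn_inv; last exact: Cn_add.
by move=> x; rewrite gt_eqF// bell_den_gt0.
Qed.

Lemma bell_gt0 (x : R) : -1 < x < 1 -> 0 < bell x.
Proof.
move=> /andP[x1 x2]; rewrite /bell divr_gt0 ?bell_den_gt0// mulr_gt0//; apply: sqrflat_gt0; lra.
Qed.

Lemma bell_eq0 (x : R) : ~~ (-1 < x < 1) -> bell x = 0.
Proof.
rewrite negb_and -!leNgt /bell => /orP[] x1.
  by rewrite (@sqrflat_eq0 (1 + x)) ?mul0r//; lra.
by rewrite (@sqrflat_eq0 (1 - x)) ?mulr0 ?mul0r//; lra.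
Qed.

(* Antiderivative of [1 / bell] on ]-1, 1[; it straightens the flow. *)
Definition chart (x : R) : R := expR (1 - x)^-1 - expR (1 + x)^-1.

(** On the open interval [1 / bell] splits as [exp (1/(1+x)) / (1+x)^2 + exp (1/(1-x)) / (1-x)^2],
    and each term is the derivative of one signed exponential of [chart]. *)
Lemma is_derive_chart (x : R) : -1 < x < 1 -> is_derive x (1 : R) chart (bell x)^-1.
Proof.
move=> /andP[x1 x2].
have p1 : 0 < 1 + x by lra.
have p2 : 0 < 1 - x by lra.
have n1 : 1 + x != 0 by rewrite gt_eqF.
have n2 : 1 - x != 0 by rewrite gt_eqF.
have D1 : is_derive x (1 : R) (fun x => 1 + x) 1.
  have := is_deriveD (is_derive_cst (1 : R) x (1 : R)) (is_derive_id x (1 : R)).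
  by rewrite add0r.
have D2 : is_derive x (1 : R) (fun x => 1 - x) (-1).
  have := is_deriveD (is_derive_cst (1 : R) x (1 : R)) (is_deriveN (is_derive_id x (1 : R))).
  by rewrite add0r.
have I1 := @is_deriveV R (fun x : R => 1 + x) x _ _ n1 D1.
have I2 := @is_deriveV R (fun x : R => 1 - x) x _ _ n2 D2.
have E1 := @is_derive1_comp R expR (fun x : R => (1 + x)^-1) x _ _ (is_derive_expR _) I1.
have E2 := @is_derive1_comp R expR (fun x : R => (1 - x)^-1) x _ _ (is_derive_expR _) I2.
have S := is_deriveB E2 E1.
apply: is_derive_eq.
rewrite /bell /flat p1 p2 !expr0 !mul1r /GRing.scale /= !expRN.
have e1 := expR_gt0 (1 + x)^-1; have e2 := expR_gt0 (1 - x)^-1.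
set u := expR _ in e1 *; set w := expR _ in e2 *.
field.
by rewrite !gt_eqF//= addr_gt0// mulr_gt0// exprn_gt0.
Qed.

Lemma chart_lt (x y : R) : -1 < x -> x < y -> y < 1 -> chart x < chart y.
Proof.
move=> x1 xy y1; rewrite /chart ltrB// ltr_expR ltf_pV2 ?posrE; lra.
Qed.

Lemma chart_inj (x y : R) : -1 < x < 1 -> -1 < y < 1 -> chart x = chart y -> x = y.
Proof.
move=> /andP[x1 x2] /andP[y1 y2] E; have [xy|xy|//] := ltgtP x y.
  by have := chart_lt _ _ x1 xy y2; rewrite E ltxx.
by have := chart_lt _ _ y1 xy x2; rewrite E ltxx.
Qed.

Lemma chartN (x : R) : chart (- x) = - chart x.
Proof. by rewrite /chart opprK opprB. Qed.

Lemma chart_surj (y : R) : exists x : R, -1 < x < 1 /\ chart x = y.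
Proof.
(* At [z = 1 - 1/K] the first exponential of [chart] is [exp K >= 1 + K] and the second is at most
   [e], so [chart z >= |y|]; oddness handles [-z]. *)
pose K : R := `|y| + expR 1 + 1.
have e1 : 1 < expR (1 : R) by rewrite expR_gt1.
have y0 : 0 <= `|y| by [].
have K1 : 1 < K by rewrite /K; lra.
pose z := 1 - K^-1.
have Ki0 : 0 < K^-1 by rewrite invr_gt0; lra.
have Ki1 : K^-1 < 1 by rewrite invf_lt1; lra.
have z0 : 0 <= z by rewrite /z; lra.
have z1 : z < 1 by rewrite /z; lra.
have Gz : `|y| <= chart z.
  rewrite /chart.
  have -> : (1 - z)^-1 = K by rewrite /z opprB addrC subrK invrK.
  have h1 := expR_ge1Dx K.
  have h2 : expR (1 + z)^-1 <= expR 1 by rewrite ler_expR invf_le1; lra.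
  by rewrite /K in h1 *; lra.
have zz : - z <= z by lra.
have cc : {within `[- z, z], continuous chart}.
  apply: derivable_within_continuous => u; rewrite in_itv/= => /andP[u1 u2].
  have u3 : -1 < u < 1 by apply/andP; split; lra.
  exact: (@ex_derive _ _ _ _ _ _ _ (is_derive_chart u u3)).
have mm : Num.min (chart (- z)) (chart z) <= y <= Num.max (chart (- z)) (chart z).
  rewrite chartN; have := ler_norm y; have := ler_norm (- y); rewrite normrN => a b.
  by rewrite ge_min le_max; apply/andP; split; apply/orP; [left|right]; lra.
have [c] := @IVT R chart (- z) z y zz cc mm.
rewrite in_itv/= => /andP[c1 c2] <-; exists c; split=> //; apply/andP; split; lra.
Qed.

Definition unchart (y : R) : R := projT1 (cid (chart_surj y)).

Lemma unchart_itv y : -1 < unchart y < 1.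
Proof. by rewrite /unchart; case: cid => x []. Qed.

Lemma unchartK y : chart (unchart y) = y.
Proof. by rewrite /unchart; case: cid => x []. Qed.

Lemma chartK (x : R) : -1 < x < 1 -> unchart (chart x) = x.
Proof. by move=> x1; apply: chart_inj => //; [exact: unchart_itv|exact: unchartK]. Qed.

(** The inverse function rule turns the derivative [1 / bell] of [chart] into the differential
    equation of the field [bell]. *)
Lemma is_derive_unchart y : is_derive y (1 : R) unchart (bell (unchart y)).
Proof.
have x1 := unchart_itv y; set x := unchart y in x1 *.
have nx : \forall z \near x, -1 < z < 1.
  case/andP: x1 => x1 x2.
  near=> z; apply/andP; split; near: z; [exact: lt_nbhsr|exact: lt_nbhsl].
have b0 := bell_gt0 _ x1.
rewrite -[bell x]invrK -(unchartK y) -/x.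
apply: is_derive_inverse.
- near=> z; apply: chartK; near: z; exact: nx.
- near=> z; apply: differentiable_continuous; apply/derivable1_diffP.
  have z1 : -1 < z < 1 by near: z.
  exact: (@ex_derive _ _ _ _ _ _ _ (is_derive_chart z z1)).
- exact: is_derive_chart.
- by rewrite gt_eqF// invr_gt0.
Unshelve. all: by end_near.
Qed.

Lemma unchart_continuous : continuous unchart.
Proof.
move=> y; apply: differentiable_continuous; apply/derivable1_diffP.
exact: (@ex_derive _ _ _ _ _ _ _ (is_derive_unchart y)).
Qed.

(** The flow of the vector field [bell] on the line: a translation by [t] when read in [chart], and
    at rest where [bell] vanishes. *)
Definition flow1 (t x : R) : R :=
  if -1 < x < 1 then unchart (chart x + t) else x.

Lemma flow1_itv t x : (-1 < flow1 t x < 1) = (-1 < x < 1).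
Proof. by rewrite /flow1; case: ifPn => // [_|/negbTE//]; rewrite unchart_itv. Qed.

Lemma flow1_0 x : flow1 0 x = x.
Proof. by rewrite /flow1; case: ifP => // x1; rewrite addr0 chartK. Qed.

Lemma flow1_add s t x : flow1 s (flow1 t x) = flow1 (s + t) x.
Proof.
have [x1|/negbTE x1] := boolP (-1 < x < 1); last by rewrite /flow1 !x1.
by rewrite /flow1 x1 unchart_itv unchartK addrA addrAC.
Qed.

Lemma flow1_gt t x : 0 < t -> -1 < x < 1 -> x < flow1 t x.
Proof.
move=> t0 x1; rewrite /flow1 x1 ltNge; apply/negP => h.
have /andP[u1 u2] := unchart_itv (chart x + t); case/andP: x1 => x1 x2.
have : chart (unchart (chart x + t)) <= chart x.
  move: h; rewrite le_eqVlt => /orP[/eqP->//|h].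
  by apply: ltW; apply: chart_lt.
by rewrite unchartK => ?; lra.
Qed.

Lemma is_derive_flow1 t x : is_derive t (1 : R) (flow1^~ x) (bell (flow1 t x)).
Proof.
rewrite /flow1; case: ifPn => x1.
  have D : is_derive t (1 : R) (fun s : R => chart x + s) 1.
    have := is_deriveD (is_derive_cst (chart x) t (1 : R)) (is_derive_id t (1 : R)).
    by rewrite add0r.
  have := @is_derive1_comp R unchart (fun s => chart x + s) t _ _ (is_derive_unchart _) D.
  by rewrite mulr1.
by rewrite bell_eq0//; exact: is_derive_cst.
Qed.
End Smooth.

(** * Flows supported in a box *)

Section Rowvec.
Context {R : realType} {k : nat}.
Implicit Types x y c : 'rV[R]_k.

Lemma le_rV_norm x (r : R) : 0 <= r -> (`|x| <= r) = [forall j, `|x ord0 j| <= r].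
Proof.
move=> r0; rewrite {1}/Num.norm/= mx_normrE; apply/idP/forallP => [h j|h].
  by apply: le_trans h; apply: (le_bigmax _ (fun ij => `|x ij.1 ij.2|) (ord0, j)).
by apply/bigmax_leP; split=> // -[i j] _ /=; rewrite (ord1 i).
Qed.

Lemma lt_rV_norm x (r : R) : 0 < r -> (`|x| < r) = [forall j, `|x ord0 j| < r].
Proof.
move=> r0; rewrite {1}/Num.norm/= mx_normrE; apply/idP/forallP => [h j|h].
  by apply: le_lt_trans h; apply: (le_bigmax _ (fun ij => `|x ij.1 ij.2|) (ord0, j)).
by apply/bigmax_ltP; split=> // -[i j] _ /=; rewrite (ord1 i).
Qed.

Lemma coord_le_norm x j : `|x ord0 j| <= `|x|.
Proof. by have := lexx `|x|; rewrite le_rV_norm// => /forallP. Qed.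

Definition box c (r : R) : set 'rV[R]_k := [set x | forall j, `|x ord0 j - c ord0 j| < r].

Lemma boxE c r : 0 < r -> box c r = [set x | `|x - c| < r].
Proof.
move=> r0; apply/seteqP; split=> x /=; rewrite lt_rV_norm//.
  by move=> h; apply/forallP => j; rewrite !mxE.
by move=> /forallP h j; have := h j; rewrite !mxE.
Qed.

Lemma box_open c r : open (box c r).
Proof.
have [r0|r0] := ltP 0 r.
  rewrite boxE//.
  have -> : [set x | `|x - c| < r] = ball c r.
    by apply/seteqP; split=> y /=; rewrite -ball_normE /= distrC.
  exact: ball_open.
(* For [r <= 0] the box is empty as soon as there is a coordinate; in dimension 0 it is the whole
   space. *)
have [[j _]|K] := pselect (exists j : 'I_k, True).
  have -> : box c r = set0; last exact: open0.
  by apply/seteqP; split=> // x /(_ j) /lt_le_trans /(_ r0); rewrite ltNge normr_ge0.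
have -> : box c r = setT; last exact: openT.
by apply/seteqP; split=> // x _ j; case: K; exists j.
Qed.

End Rowvec.

Section BoxFlow.
Context {R : realType} {k : nat}.
Variables (c : 'rV[R]_k) (r : R) (i : 'I_k).
Hypothesis r0 : 0 < r.
Let X := 'rV[R]_k.

Definition relc (j : 'I_k) (x : X) : R := r^-1 * (x ord0 j - c ord0 j).

Definition bellprod (x : X) : R := \prod_(j < k | j != i) bell (relc j x).

(* [bellprod] does not involve coordinate [i], so it is constant along the flow, which is
   therefore [flow1] run at speed [bellprod]. *)
Definition flow_field (x : X) : X :=
  (- r * (bellprod x * bell (relc i x))) *: delta_mx ord0 i.

(** The minus sign makes points of the box go down along coordinate [i] for positive [t]; the factor
    [r] undoes the normalisation in [relc]. *)
Definition box_flow (t : R) (x : X) : X :=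
  x + (r * (flow1 (- (t * bellprod x)) (relc i x) - relc i x)) *: delta_mx ord0 i.

Lemma relc_continuous j : continuous (relc j).
Proof.
move=> x; apply: (@cvgM _ _ (nbhs x) _ (fun _ : X => r^-1)
  (fun y : X => y ord0 j - c ord0 j)); first exact: cvg_cst.
apply: (@cvgB _ _ _ (nbhs x) _ (fun y : X => y ord0 j) (fun _ : X => c ord0 j)).
  exact: (@coord_continuous R 1 k ord0 j x).
exact: cvg_cst.
Qed.

Lemma Cn_bell_relc n j : Cn n (fun x => bell (relc j x)).
Proof.
apply: (@Cn_comp R _ n bell (relc j) (fun v => r^-1 * v ord0 j)).
- exact: relc_continuous.
- by move=> h v x; rewrite /relc !mxE; ring.
- exact: Cn_bell.
Qed.

(** Differentiation acts on the scalar factor alone, which reduces [smooth] for a field of constant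
    direction to the classes [Cn]. *)
Lemma iterD_scaled (w : X) (f : X -> R) (vs : seq X) :
  (forall n : nat, Cn n f) ->
  exists2 g : X -> R, (forall n : nat, Cn n g) &
   Defs.iterD vs (fun x => f x *: w : X) = (fun x => g x *: w).
Proof.
move=> Cf; elim: vs => [|v vs [g Cg IH]]; first by exists f.
exists (fun x => 'D_v g x).
  by move=> n; have [_ /(_ v)[]] := Cg n.+1.
apply/funext => x /=; rewrite IH.
have [_ /(_ v)[dg _]] := Cg 1%N.
rewrite /derive; apply/cvg_lim => //.
have E : (fun h : R => h^-1 *: (((fun x => g x *: w : X) \o shift x) (h *: v) - g x *: w)) =
   (fun h : R => (h^-1 *: ((g \o shift x) (h *: v) - g x)) *: w).
  by apply/funext => h /=; rewrite -scalerBl scalerA.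
rewrite E; apply: cvgZr_tmp.
exact: (dg x).
Qed.

Lemma smooth_flow_field : smooth flow_field.
Proof.
move=> vs; rewrite /flow_field.
have Cf n : Cn n (fun x => - r * (bellprod x * bell (relc i x))).
  apply: Cn_scale; apply: Cn_mul; last exact: Cn_bell_relc.
  by apply: Cn_prod => j; exact: Cn_bell_relc.
have [g Cg ->] := iterD_scaled (delta_mx ord0 i) _ vs Cf.
split=> [x|v x].
  exact: (@cvgZr_tmp _ _ _ (nbhs x) _ g (g x) (delta_mx ord0 i : X)
    (Cn_cont _ _ _ (Cg 0%N) x)).
have [_ /(_ v)[dg _]] := Cg 1%N.
have E : (fun h : R => h^-1 *: (((fun x => g x *: delta_mx ord0 i : X) \o shift x) (h *: v) - g x *: delta_mx ord0 i)) =
   (fun h : R => (h^-1 *: ((g \o shift x) (h *: v) - g x)) *: (delta_mx ord0 i : X)).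
  by apply/funext => h /=; rewrite -scalerBl scalerA.
rewrite /derivable E.
apply/cvg_ex; exists ('D_v g x *: delta_mx ord0 i).
by apply: cvgZr_tmp; exact: (dg x).
Qed.

Lemma relc_box x j : (-1 < relc j x < 1) = (`|x ord0 j - c ord0 j| < r).
Proof.
rewrite /relc -ltr_norml normrM normfV (gtr0_norm r0) mulrC.
by rewrite ltr_pdivrMr// mul1r.
Qed.

Lemma boxP x : reflect (box c r x) [forall j, -1 < relc j x < 1].
Proof.
by apply: (iffP forallP) => h j; have := h j; rewrite relc_box.
Qed.

Lemma flow_field_out x : ~ box c r x -> flow_field x = 0.
Proof.
move=> /boxP/forallPn[j jP]; rewrite /flow_field.
have [ji|ji] := eqVneq j i; first by rewrite -ji bell_eq0// !mulr0 scale0r.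
by rewrite /bellprod (bigD1 j)//= bell_eq0// !mul0r mulr0 scale0r.
Qed.

Lemma compact_support_flow_field : compact_support flow_field.
Proof.
have sub : closure [set x | flow_field x != 0] `<=` [set x | `|c - x| <= r].
  have -> : [set x | `|c - x| <= r] = closed_ball c r.
    by rewrite closed_ballE.
  rewrite closureE; apply: smallest_sub; first exact: closed_ball_closed.
  move=> x /= fx; rewrite closed_ballE//=.
  have : box c r x by apply: contrapT => /flow_field_out h; rewrite h eqxx in fx.
  by rewrite boxE//= => /ltW; rewrite distrC.
apply: bounded_closed_compact; last exact: closed_closure.
exists (`|c| + r); split; first exact: num_real.
move=> M hM x /sub /= h; apply: le_trans (ltW hM).
rewrite -[x](subrK c) addrC; apply: le_trans (ler_normD _ _) _.
by rewrite lerD2l distrC.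
Qed.

Lemma box_flow_coord t x j : j != i -> box_flow t x ord0 j = x ord0 j.
Proof. by move=> ji; rewrite !mxE (negbTE ji) /= mulr0 addr0. Qed.

Lemma relc_flow t x : relc i (box_flow t x) = flow1 (- (t * bellprod x)) (relc i x).
Proof.
have rn0 : r != 0 by rewrite gt_eqF.
rewrite {1}/relc /box_flow !mxE !eqxx /= mulr1.
set f := flow1 _ _; rewrite /relc; by field.
Qed.

Lemma relc_flowN t x j : j != i -> relc j (box_flow t x) = relc j x.
Proof. by move=> ji; rewrite /relc box_flow_coord. Qed.

Lemma bellprod_flow t x : bellprod (box_flow t x) = bellprod x.
Proof. by apply: eq_bigr => j ji; rewrite relc_flowN. Qed.

Lemma relc_inj x y : (forall j, relc j x = relc j y) -> x = y.
Proof.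
move=> h; apply/rowP => j; have /mulfI := h j.
by rewrite invr_eq0 gt_eqF// => /(_ isT) /addIr.
Qed.

Lemma box_flow_box t x : box c r (box_flow t x) <-> box c r x.
Proof.
suff : [forall j, -1 < relc j (box_flow t x) < 1] = [forall j, -1 < relc j x < 1].
  by move=> E; split=> /boxP h; apply/boxP; rewrite ?E// -E.
apply: eq_forallb => j; have [->|ji] := eqVneq j i.
  by rewrite relc_flow flow1_itv.
by rewrite relc_flowN.
Qed.

Lemma box_flow0 x : box_flow 0 x = x.
Proof. by rewrite /box_flow mul0r oppr0 flow1_0 subrr mulr0 scale0r addr0. Qed.

Lemma box_flow_add s t x : box_flow s (box_flow t x) = box_flow (s + t) x.
Proof.
apply: relc_inj => j; have [->|ji] := eqVneq j i; last by rewrite !relc_flowN.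
by rewrite !relc_flow bellprod_flow flow1_add mulrDl opprD.
Qed.

(** If coordinate [i] is outside, [flow1] fixes it; if another one is, the speed [bellprod] is 0. *)
Lemma box_flow_out t x : ~ box c r x -> box_flow t x = x.
Proof.
move=> xU; apply: relc_inj => j; have [->|ji] := eqVneq j i; last by rewrite relc_flowN.
rewrite relc_flow; move: xU => /boxP/forallPn[l lP].
have [li|li] := eqVneq l i; first by rewrite /flow1 -li (negbTE lP).
by rewrite /bellprod (bigD1 l)//= bell_eq0// mul0r mulr0 oppr0 flow1_0.
Qed.

Lemma box_flow_lt t x : 0 < t -> box c r x -> box_flow t x ord0 i < x ord0 i.
Proof.
move=> t0 /boxP/forallP xU.
have W0 : 0 < bellprod x by apply: prodr_gt0 => j _; exact: bell_gt0.
have : relc i (box_flow t x) < relc i x.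
  rewrite relc_flow.
  have U' : -1 < flow1 (- (t * bellprod x)) (relc i x) < 1 by rewrite flow1_itv.
  (* Flowing the image forward for the positive time [t * bellprod x] recovers [relc i x], so
     [flow1_gt] at the image gives the decrease. *)
  have := flow1_gt (t * bellprod x) _ (mulr_gt0 t0 W0) U'.
  by rewrite flow1_add subrr flow1_0.
by rewrite /relc ltr_pM2l ?invr_gt0// ltrD2r.
Qed.

Lemma is_flow_box_flow : is_flow flow_field box_flow.
Proof.
split=> [x|t x]; first exact: box_flow0.
pose g (s : R) := r * (flow1 (- (s * bellprod x)) (relc i x) - relc i x).
have D1 : is_derive t (1 : R) (fun s : R => - (s * bellprod x)) (- bellprod x).
  have E : (fun s : R => - (s * bellprod x)) = (- bellprod x) \*: (id : R -> R).
    by apply/funext => s /=; rewrite /GRing.scale /=; ring.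
  rewrite E; have := is_deriveZ (- bellprod x) (is_derive_id t (1 : R)).
  by rewrite /GRing.scale /= mulr1.
have D2 := @is_derive1_comp R (flow1^~ (relc i x)) (fun s => - (s * bellprod x)) t _ _
   (is_derive_flow1 _ _) D1.
have D3 := is_deriveB D2 (is_derive_cst (relc i x) t (1 : R)).
have D4 := is_deriveZ r D3.
have Dg : is_derive t (1 : R) g (- r * (bellprod x * bell (relc i (box_flow t x)))).
  rewrite relc_flow; apply: is_derive_eq; rewrite /GRing.scale /=; ring.
apply: is_derive_cvg.
have E : (fun h : R => h^-1 *: (box_flow (h + t) x - box_flow t x)) =
   (fun h : R => (h^-1 *: ((g \o shift t) (h *: (1 : R)) - g t)) *: (delta_mx ord0 i : X)).
  apply/funext => h /=; rewrite /box_flow opprD addrACA subrr add0r -scalerBl scalerA.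
  by rewrite /GRing.scale /= mulr1.
rewrite E /flow_field bellprod_flow; apply: cvgZr_tmp.
have [dg <-] := Dg; exact: dg.
Qed.

End BoxFlow.

(** * Measurability of counts and of isolated points *)

Section NatSum.
Context {R : realType} {I : choiceType}.
Implicit Types (f : I -> nat) (S : set I).
Local Notation nsum S f := (\esum_(x in S) ((f x)%:R : R)%:E)%E.

Lemma nterm_ge0 f x : (0 <= ((f x)%:R : R)%:E)%E.
Proof. by rewrite lee_fin. Qed.
Local Hint Resolve nterm_ge0 : core.

Lemma fsum_natE f (F : set I) : finite_set F ->
  exists n : nat, (\sum_(x \in F) ((f x)%:R : R)%:E = (n%:R : R)%:E)%E.
Proof.
move=> fF; rewrite fsbig_finite//=.
exists (\sum_(x <- finmap.enum_fset (fset_set F)) f x)%N.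
by rewrite natr_sum sumEFin.
Qed.

Lemma nsum_ge S f (F : set I) : finite_set F -> F `<=` S ->
  (\sum_(x \in F) ((f x)%:R : R)%:E <= nsum S f)%E.
Proof. by move=> fF FS; apply: ereal_sup_ubound; exists F. Qed.

(** The finite partial sums are natural numbers below the total, so a largest one exists, and a
    nonzero term outside it would enlarge it. *)
Lemma nsum_fin S f : (nsum S f < +oo)%E ->
  exists F, [/\ finite_set F, F `<=` S, (forall x, S x -> ~ F x -> f x = 0%N)
    & nsum S f = (\sum_(x \in F) ((f x)%:R : R)%:E)%E].
Proof.
move=> fin.
have [N NP] : exists N : nat, (nsum S f <= (N%:R : R)%:E)%E.
  have nn : (0 <= nsum S f)%E by apply: esum_ge0.
  case: (nsum S f) fin nn => // s _ s0.
  by exists (Num.trunc s).+1; rewrite lee_fin ltW// truncnS_gt.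
pose P n := `[< exists F, [/\ finite_set F, F `<=` S &
   (\sum_(x \in F) ((f x)%:R : R)%:E = (n%:R : R)%:E)%E] >].
have exP : exists n, P n.
  exists 0%N; apply/asboolP; exists set0; split => //.
  by rewrite fsbig_set0.
have ubP n : P n -> (n <= N)%N.
  move=> /asboolP[F [fF FS E]]; have := le_trans (nsum_ge S f F fF FS) NP.
  by rewrite E lee_fin ler_nat.
have [n /asboolP[F [fF FS E]] maxn] := ex_maxnP exP ubP.
exists F; split=> //.
  move=> x Sx Fx; apply/eqP; rewrite -leqn0 leqNgt; apply/negP => fx.
  have E' : (\sum_(y \in x |` F) ((f y)%:R : R)%:E = ((f x + n)%:R : R)%:E)%E.
    by rewrite fsbigU0 ?E ?fsbig_set1 ?natrD ?EFinD// => y [->].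
  have /maxn : P (f x + n)%N.
    apply/asboolP; exists (x |` F); split=> //.
      by rewrite finite_setU; split.
    by move=> y [->//|/FS].
  by rewrite leqNgt -{1}[n]add0n ltn_add2r fx.
apply/eqP; rewrite eq_le nsum_ge// andbT.
apply: ge_ereal_sup => _ [G [fG GS] <-].
have [m Em] := fsum_natE f G fG; rewrite Em E lee_fin ler_nat; apply: maxn.
by apply/asboolP; exists G.
Qed.

Lemma nsum_nat S f : (nsum S f < +oo)%E -> exists n : nat, nsum S f = (n%:R)%:E.
Proof. by move=> /nsum_fin[F [fF _ _ ->]]; exact: fsum_natE. Qed.

Lemma nsum_eq0 S f : nsum S f = 0%E <-> (forall x, S x -> f x = 0%N).
Proof.
split=> [E x Sx|h]; last by apply: esum1 => x Sx; rewrite h.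
have := nsum_ge S f [set x] (finite_set1 x).
rewrite E fsbig_set1 lee_fin => /(_ _) h.
have : ((f x)%:R : R) <= 0%:R by apply: h => y ->.
by rewrite ler_nat leqn0 => /eqP.
Qed.

Lemma nsum_eq1 S f : nsum S f = 1%E <->
  (exists x, [/\ S x, f x = 1%N & forall y, S y -> y <> x -> f y = 0%N]).
Proof.
split=> [E|[x [Sx fx h]]]; last first.
  have -> : S = x |` (S `\ x) by rewrite setD1K.
  rewrite (esumID [set x])// (_ : _ `&` [set x] = [set x]); last first.
    by apply/seteqP; split=> [y []//|y ->]; split=> //; left.
  rewrite esum_set1// fx esum1 ?adde0// => y [[->|[Sy yx] _]].
    by move=> /(_ erefl).
  by rewrite h.
have [|F [fF FS F0 FE]] := @nsum_fin S f; first by rewrite E ltry.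
have [x Sx fx] : exists2 x, S x & f x <> 0%N.
  apply: contrapT => /forall2NP h; have /nsum_eq0 : forall x, S x -> f x = 0%N.
    by move=> x Sx; apply: contrapT => fx; have [] := h x.
  by rewrite E => /eqP; rewrite onee_eq0.
have ge1 : forall G, finite_set G -> G `<=` S -> (\sum_(y \in G) ((f y)%:R : R)%:E <= 1)%E.
  by move=> G fG GS; rewrite -E; exact: nsum_ge.
have fx1 : f x = 1%N.
  have := ge1 [set x] (finite_set1 x).
  rewrite fsbig_set1 lee_fin -[1]/(1%:R) ler_nat => h.
  apply/eqP; rewrite eqn_leq h; last by move=> y ->.
  by rewrite lt0n; apply/eqP.
exists x; split=> // y Sy yx.
have := ge1 (y |` [set x]).
rewrite fsbigU0// ?fsbig_set1; last by move=> z [-> /yx].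
rewrite /= fx1 -EFinD lee_fin -natrD -[1]/(1%:R) ler_nat addn1 ltnS leqn0 => h.
apply/eqP; apply: h; first by rewrite finite_setU; split.
by move=> z [->|->].
Qed.

End NatSum.

Section Config.
Context {R : realType} {k : nat}.
Let X := Xpt R k.
Implicit Types (eta : X -> nat) (B : set X).

Lemma cnt_fin eta B : (cnt eta B < +oo)%E -> finite_set [set x | B x /\ eta x <> 0%N].
Proof.
move=> /nsum_fin[F [fF _ h _]]; apply: sub_finite_set fF => x [Bx ex].
by apply: contrapT => /(h x Bx).
Qed.

Definition borelX := g_sigma_algebraType [set U : set X | open U].

Lemma open_borel B : open B -> measurable (B : set borelX).
Proof. by move=> oB; apply: sub_sigma_algebra. Qed.

Lemma closed_borel B : closed B -> measurable (B : set borelX).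
Proof.
by move=> cB; rewrite -[B]setCK; apply: measurableC; apply: open_borel; exact: closed_openC.
Qed.

Definition bborel B := measurable (B : set borelX) /\ bounded_pt B.

Lemma bborelI B A : bborel B -> measurable (A : set borelX) -> bborel (B `&` A).
Proof.
move=> [mB [r hr]] mA; split; first exact: measurableI.
by exists r => x [/hr].
Qed.

Lemma measurable_cnt_eq B n : bborel B ->
  measurable ([set eta | cnt eta B = (n%:R)%:E] : set (config R k)).
Proof. by move=> [mB bB]; apply: sub_sigma_algebra; exists B, n. Qed.

(** A count is a natural number or [+oo]: any preimage is a countable union of generators, joined by
    the complement of all of them when [+oo] is included. *)
Lemma measurable_cnt B : bborel B ->
  measurable_fun setT (fun eta : config R k => cnt eta B).
Proof.
move=> bB _ Y _; rewrite setTI.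
pose C n : set (config R k) := [set eta | cnt eta B = (n%:R)%:E].
have mC n : measurable (C n) by exact: measurable_cnt_eq.
have -> : (fun eta : config R k => cnt eta B) @^-1` Y =
  (\bigcup_(n in [set n : nat | Y (n%:R)%:E]) C n) `|`
  (if `[< Y +oo%E >] then ~` (\bigcup_n C n) else set0).
  apply/seteqP; split=> eta /=.
    have [fin|inf] := ltP (cnt eta B) +oo%E.
      by have [n En] := nsum_nat _ _ fin; move=> Yn; left; exists n => //=; rewrite -En.
    move: inf; rewrite leye_eq => /eqP E; rewrite E => Yy; right.
    case: asboolP => // _ -[n _]; rewrite /C/= E; discriminate.
  move=> [[n /= Yn En]|]; first by rewrite En.
  case: asboolP => // Yy /= nC.
  have [fin|inf] := ltP (cnt eta B) +oo%E.
    by have [n En] := nsum_nat _ _ fin; case: nC; exists n.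
  by move: inf; rewrite leye_eq => /eqP ->.
apply: measurableU; first exact: bigcup_measurable.
by case: asboolP => // _; apply: measurableC; exact: bigcup_measurable.
Qed.

End Config.

Section Points.
Context {R : realType} {k : nat}.
Let X := Xpt R k.
Implicit Types (eta : config R k) (B U V : set X).

Lemma cnt_eq0 eta B : cnt eta B = 0%E <-> forall x, B x -> eta x = 0%N.
Proof. exact: nsum_eq0. Qed.

Lemma cnt_eq1 eta B : cnt eta B = 1%E <->
  (exists x, [/\ B x, eta x = 1%N & forall y, B y -> y <> x -> eta y = 0%N]).
Proof. exact: nsum_eq1. Qed.

(** The count is tested inside the body so that [pt U] is the constant 0 off the event of a single
    point, which keeps it measurable and, for bounded [U], bounded. *)
Definition pt U eta : X :=
  match pselect (exists x, U x /\ cnt eta U = 1%E /\ eta x = 1%N) with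
  | left h => projT1 (cid h)
  | right _ => 0
  end.

Lemma ptP U eta : cnt eta U = 1%E ->
  [/\ U (pt U eta), eta (pt U eta) = 1%N & forall y, U y -> y <> pt U eta -> eta y = 0%N].
Proof.
move=> c1; have /cnt_eq1[x [Ux ex xP]] := c1.
rewrite /pt; case: pselect => [h|]; last by case; exists x.
case: cid => z /= [Uz [_ ez]]; have zx : z = x.
  by apply: contrapT => zx; move: ez; rewrite (xP z Uz zx).
by split=> // y Uy yz; apply: xP => // yx; apply: yz; rewrite yx zx.
Qed.

Lemma pt_uniq U eta x : cnt eta U = 1%E -> U x -> eta x <> 0%N -> x = pt U eta.
Proof.
by move=> /ptP[_ _ h] Ux ex; apply: contrapT => nx; exact: ex (h x Ux nx).
Qed.

Lemma pt_out U eta : cnt eta U <> 1%E -> pt U eta = 0.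
Proof. by move=> c1; rewrite /pt; case: pselect => // h; exfalso; case: h => x [_ []]. Qed.

(** Membership of the extracted point becomes a counting event; measurability of [pt] rests on
    this. *)
Lemma pt_inP U V eta : cnt eta U = 1%E ->
  V (pt U eta) <-> cnt eta (U `&` V) = 1%E.
Proof.
move=> c1; have [Up ep h] := ptP _ _ c1; split=> [Vp|].
  by apply/cnt_eq1; exists (pt U eta); split=> // y [Uy _]; exact: h.
move=> /cnt_eq1[x [[Ux Vx] ex _]].
by rewrite -(pt_uniq U eta x) // ex.
Qed.

Lemma measurable_pt U : bborel U ->
  measurable_fun setT (pt U : config R k -> @borelX R k).
Proof.
move=> bU _ V mV; rewrite setTI.
pose D : set (config R k) := [set eta | cnt eta U = (1%:R)%:E].
have mD : measurable D by exact: measurable_cnt_eq.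
have -> : (pt U : config R k -> @borelX R k) @^-1` V =
  (D `&` [set eta | cnt eta (U `&` V) = (1%:R)%:E]) `|`
  (if `[< V 0 >] then ~` D else set0).
  apply/seteqP; split=> eta /=.
    have [c1|c1] := pselect (cnt eta U = 1%E).
      by move=> /(pt_inP _ _ _ c1); left.
    by rewrite (pt_out _ _ c1) => V0; right; case: asboolP.
  move=> [[c1 c2]|]; first by apply/(pt_inP _ _ _ c1).
  by case: asboolP => // V0 /= c1; rewrite (pt_out _ _ c1).
apply: measurableU.
  by apply: measurableI => //; apply: measurable_cnt_eq; exact: bborelI.
by case: asboolP => // _; exact: measurableC.
Qed.

Lemma measurable_coord (j : 'I_k) :
  measurable_fun setT ((fun x => x ord0 j) : @borelX R k -> R).
Proof.
apply: (measurability (@RGenOpens.G R)); first exact: RGenOpens.measurableE.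
move=> Y [W [a [b ->]] <-]; rewrite setTI; apply: open_borel.
apply: open_comp; last exact: interval_open.
by move=> x _; exact: coord_continuous.
Qed.

Lemma measurable_coord_le (j : 'I_k) (a : R) :
  measurable ([set x | x ord0 j <= a] : set (@borelX R k)).
Proof.
have := measurable_coord j measurableT _ (measurable_itv `]-oo, a]).
by rewrite setTI; congr measurable; apply/seteqP; split=> x /=; rewrite in_itv.
Qed.

Lemma measurable_coord_ge (j : 'I_k) (a : R) :
  measurable ([set x | a <= x ord0 j] : set (@borelX R k)).
Proof.
have := measurable_coord j measurableT _ (measurable_itv `[a, +oo[).
by rewrite setTI; congr measurable; apply/seteqP; split=> x /=; rewrite in_itv/= andbT.
Qed.

Lemma measurable_pt_coord U (j : 'I_k) : bborel U ->
  measurable_fun setT (fun eta : config R k => pt U eta ord0 j).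
Proof.
by move=> bU; apply: (measurableT_comp (measurable_coord j)); exact: measurable_pt.
Qed.

(** A countable base of boxes with rational centre and radius [1/(m+1)]. An index that codes nothing
    gives the empty set, which isolates no point. *)
Definition ubox (n : nat) : set X :=
  if (unpickle n : option ('rV[rat]_k * nat)) is Some cn
  then box (map_mx ratr cn.1) (cn.2.+1%:R^-1) else set0.

Lemma box_bounded (c : X) r : 0 < r -> bounded_pt (box c r).
Proof.
move=> r0; exists (`|c| + r) => x; rewrite boxE//= => /ltW h.
by rewrite -[x](subrK c) addrC (le_trans (ler_normD _ _))// lerD2l.
Qed.

Lemma bborel_box (c : X) r : 0 < r -> bborel (box c r).
Proof. by move=> r0; split; [apply: open_borel; exact: box_open|exact: box_bounded]. Qed.

Lemma bborel_ubox n : bborel (ubox n).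
Proof.
rewrite /ubox; case: unpickle => [cn|]; first by apply: bborel_box; rewrite invr_gt0.
by split; [exact: measurable0|exists 0].
Qed.

Lemma locfin_bounded_fin eta (r : R) : locfin eta ->
  finite_set [set x : X | `|x| <= r /\ eta x <> 0%N].
Proof. by move=> lf; apply: cnt_fin; apply: lf; exists r. Qed.

Lemma finite_dist (x : X) (F : set X) : finite_set F ->
  exists2 d : R, 0 < d & forall y, F y -> y <> x -> d <= `|y - x|.
Proof.
move=> /finite_seqP[s ->]; elim: s => [|z s [d d0 IH]]; first by exists 1.
have [->|zx] := eqVneq z x.
  by exists d => // y; rewrite /= inE => /orP[/eqP->//|]; exact: IH.
exists (Num.min d `|z - x|).
  by rewrite lt_min d0 normr_gt0 subr_eq0.
move=> y; rewrite /= inE ge_min => /orP[/eqP->|ys yx]; first by rewrite lexx orbT.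
by rewrite IH.
Qed.

Lemma ubox_nbhs (x : X) (e : R) : 0 < e ->
  exists2 n, ubox n x & forall y, ubox n y -> `|y - x| < e.
Proof.
move=> e0.
(* The diameter [2/(N+1)] of the box is to be less than [e]. *)
pose N := Num.trunc (2 / e).
have N0 : (0 : R) < N.+1%:R by rewrite ltr0n.
have N2 : 2 / N.+1%:R < e :> R.
  by rewrite ltr_pdivrMr// mulrC -ltr_pdivrMr// truncnS_gt.
have hq : forall j : 'I_k, exists q : rat, `|x ord0 j - ratr q| < (N.+1%:R : R)^-1.
  move=> j; have [|q] := @rat_in_itvoo R (x ord0 j - N.+1%:R^-1) (x ord0 j + N.+1%:R^-1).
    by rewrite ltrD2l gtrN// invr_gt0.
  set e' := N.+1%:R^-1; rewrite in_itv/= => /andP[q1 q2]; exists q; rewrite ltr_norml; apply/andP; split; lra.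
pose c j := projT1 (cid (hq j)).
have cP j : `|x ord0 j - ratr (c j)| < (N.+1%:R : R)^-1 by rewrite /c; case: cid.
exists (pickle ((\row_j c j, N) : 'rV[rat]_k * nat)).
  by rewrite /ubox pickleK => j /=; rewrite !mxE.
move=> y; rewrite /ubox pickleK /= => yP.
apply: le_lt_trans N2.
rewrite le_rV_norm; last by rewrite divr_ge0// ltW.
apply/forallP => j; rewrite !mxE.
have := yP j; have := cP j; rewrite !mxE => h1 h2.
have -> : y ord0 j - x ord0 j = (y ord0 j - ratr (c j)) - (x ord0 j - ratr (c j)) by ring.
apply: le_trans (ler_normB _ _) _.
by rewrite mulrDl !mul1r lerD// ltW.
Qed.

Lemma isolate eta x : locfin eta -> eta x = 1%N ->
  exists2 n, ubox n x & cnt eta (ubox n) = 1%E.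
Proof.
move=> lf ex.
have [d d0 dP] := finite_dist x _ (locfin_bounded_fin eta (`|x| + 1) lf).
(* The bound 1 keeps the box within norm [|x| + 1], where [eta] has finitely many points; the bound
   [d] then excludes all of them but [x]. *)
have [|n nx nP] := ubox_nbhs x (Num.min d 1); first by rewrite lt_min d0 ltr01.
exists n => //; apply/cnt_eq1; exists x; split=> // y /nP.
rewrite lt_min => /andP[yd y1] yx; apply: contrapT => ey.
suff : d <= `|y - x| by rewrite leNgt yd.
apply: dP => //=; split=> //; rewrite -[y](subrK x) addrC (le_trans (ler_normD _ _))// lerD2l.
exact: ltW.
Qed.

(* [ubox n] isolates a point that no earlier isolating box has picked. *)
Definition isol (n : nat) eta : Prop :=
  cnt eta (ubox n) = 1%E /\
  forall m, (m < n)%N -> cnt eta (ubox m) = 1%E ->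
    cnt eta (ubox m `&` ubox n) = 0%E.

Definition ipt n eta := pt (ubox n) eta.

Lemma iptP n eta : isol n eta -> eta (ipt n eta) = 1%N.
Proof. by move=> [/ptP[]]. Qed.

Lemma ipt_inj n m eta : isol n eta -> isol m eta -> ipt n eta = ipt m eta -> n = m.
Proof.
wlog : n m / (n < m)%N => [H|nm].
  have [nm|mn|//] := ltngtP n m; first exact: H.
  by move=> h1 h2 /esym h3; apply/esym; apply: H.
move=> [n1 _] [m1 mP] E.
have /cnt_eq0 := mP n nm n1 => /(_ (ipt n eta)).
have [Un en _] := ptP _ _ n1; have [Um _ _] := ptP _ _ m1.
move=> h; have : eta (ipt n eta) = 0%N by apply: h; split=> //; rewrite E.
by rewrite [LHS]en.
Qed.

Lemma isol_ex eta x : locfin eta -> eta x = 1%N ->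
  exists2 n, isol n eta & x = ipt n eta.
Proof.
move=> lf ex; have [n0 n0x n01] := isolate eta x lf ex.
(* Take the least index of a box that contains [x] alone. An earlier isolating box that shared a
   point of [eta] with it would share [x], against minimality. *)
pose P n := `[< ubox n x /\ cnt eta (ubox n) = 1%E >].
have exP : exists n, P n by exists n0; apply/asboolP.
have [n /asboolP[nx n1] nmin] := ex_minnP exP.
have xn : x = ipt n eta by apply: pt_uniq => //; rewrite ex.
exists n => //; split=> // m mn m1; apply/cnt_eq0 => y [my ny].
apply: contrapT => ey; have yx : y = x by rewrite xn; exact: pt_uniq.
have : P m by apply/asboolP; split=> //; rewrite -yx.
by move=> /nmin; rewrite leqNgt mn.
Qed.

Lemma measurable_isol n : measurable ([set eta | isol n eta] : set (config R k)).
Proof.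
have -> : [set eta | isol n eta] = [set eta : config R k | cnt eta (ubox n) = (1%:R)%:E] `&`
  \bigcap_(m in [set m | (m < n)%N])
     (~` [set eta : config R k | cnt eta (ubox m) = (1%:R)%:E] `|`
     [set eta : config R k | cnt eta (ubox m `&` ubox n) = (0%:R)%:E]).
  apply/seteqP; split=> eta /= [h1 h2]; split=> // m mn.
    by have [c1|c1] := pselect (cnt eta (ubox m) = 1%E); [right; exact: h2|left].
  by move=> c1; have [//|] := h2 m mn.
apply: measurableI; first by apply: measurable_cnt_eq; exact: bborel_ubox.
apply: bigcap_measurableType => m _.
apply: measurableU.
  by apply: measurableC; apply: measurable_cnt_eq; exact: bborel_ubox.
apply: measurable_cnt_eq; apply: bborelI; first exact: bborel_ubox.
by have [] := bborel_ubox n.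
Qed.

End Points.

(** * Compactness of plans *)

Section UltraLimit.
Variable G : set_system nat.
Hypothesis UG : UltraFilter G.
Hypothesis ooG : \oo `<=` G.

Lemma ultra_finI (T : choiceType) (A : set T) (f : T -> set nat) :
  finite_set A -> (forall x, A x -> G (f x)) -> G (\bigcap_(x in A) f x).
Proof.
move=> fA h; have := @filter_bigI nat T (fset_set A) f G _.
rewrite fset_setK//; apply => x; rewrite in_fset_set// inE; exact: h.
Qed.

Lemma ultra_I (A B : set nat) : G A -> G B -> G (A `&` B).
Proof. exact: filterI. Qed.

Lemma ultra_ex (A : set nat) : G A -> exists n, A n.
Proof. exact: filter_ex. Qed.

(** An ultrafilter contains one of finitely many sets whose union it contains, so a partner that
    ranges over a finite set is constant along [G]. This constant is the partner in the limit
    plan. *)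
Lemma ultra_pick (T : choiceType) (Q : nat -> T -> Prop) (Y : set T) :
  finite_set Y -> (forall n y, Q n y -> Y y) ->
  (forall n y y', Q n y -> Q n y' -> y = y') ->
  (\forall n \near \oo, exists y, Q n y) ->
  exists y, G [set n | Q n y] /\ forall y', y' <> y -> ~ G [set n | Q n y'].
Proof.
move=> fY QY Quniq Qex.
have [y yG] : exists y, G [set n | Q n y].
  apply: contrapT => /forallNP h.
  have h' y : Y y -> G (~` [set n | Q n y]).
    by move=> _; have [/h//|] := in_ultra_setVsetC [set n | Q n y] UG.
  have GI := ultra_I _ _ (ultra_finI _ _ _ fY h') (ooG _ Qex).
  have [n [nY [y Qy]]] := ultra_ex _ GI.
  exact: nY (QY _ _ Qy) Qy.
exists y; split=> // y' yy' y'G; apply: yy'.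
have [n [h1 h2]] := ultra_ex _ (ultra_I _ _ yG y'G).
exact: Quniq h2 h1.
Qed.

End UltraLimit.

Section Plans.
Context {R : realType} {k : nat}.
Let X := Xpt R k.
Implicit Types (eta omega : config R k) (F : set (X * X)) (beta : pconfig R k).

Definition good eta := locfin eta /\ forall x, (eta x <= 1)%N.

Lemma good_val eta x : good eta -> eta x <> 0%N -> eta x = 1%N.
Proof. by move=> [_ /(_ x)]; case: (eta x) => [|[|]]. Qed.

Lemma halfsqd_ge0 (x y : X) : 0 <= halfsqd x y.
Proof. by rewrite divr_ge0// sumr_ge0// => i _; exact: sqr_ge0. Qed.

Lemma halfsqdC (x y : X) : halfsqd x y = halfsqd y x.
Proof. by rewrite /halfsqd; congr (_ / _); apply: eq_bigr => i _; rewrite -sqrrN opprB. Qed.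

(** A cheap pair is a close pair: a coordinate gap [a > 2 * r + 1] would satisfy [a^2 >= a > 2 * r].
    With local finiteness, a point has finitely many possible partners at bounded cost. *)
Lemma halfsqd_norm (x y : X) r : halfsqd x y <= r -> `|y| <= `|x| + (2 * r + 1) :> R.
Proof.
move=> h; have r0 : 0 <= r := le_trans (halfsqd_ge0 x y) h.
rewrite -[y](subrK x) addrC; apply: le_trans (ler_normD _ _) _; rewrite lerD2l.
rewrite le_rV_norm; last by lra.
apply/forallP => j; rewrite !mxE.
have : (x ord0 j - y ord0 j) ^+ 2 <= 2 * r.
  rewrite mulrC -ler_pdivrMr//; apply: le_trans h; rewrite ler_pM2r//.
  rewrite (bigD1 j)//= lerDl; apply: sumr_ge0 => i _; exact: sqr_ge0.
rewrite -real_normK ?num_real// distrC => {}h.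
set a := `|_| in h *; have a0 : 0 <= a by exact: normr_ge0.
rewrite leNgt; apply/negP => ha.
have : 2 * r + 1 < a ^+ 2.
  have a1 : 1 <= a by lra.
  by apply: lt_le_trans ha _; rewrite expr2 ler_peMl.
by lra.
Qed.

(** The mass of [beta] above [B1] is the count of [eta] in [B1], so a plan inherits local finiteness
    from its first marginal. *)
Lemma rows_locfin2 eta beta : locfin eta ->
  (forall x, ((eta x)%:R : R)%:E = \esum_(y in setT) ((beta (x, y))%:R : R)%:E)%E ->
  locfin2 beta.
Proof.
move=> lf rows B [r hr].
pose B1 := [set x : X | `|x| <= r].
apply: (@le_lt_trans _ _ (cnt eta B1)); last by apply: lf; exists r.
rewrite /cnt (eq_esum (fun x _ => rows x)).
rewrite esum_esum; last by move=> i j _ _; rewrite lee_fin.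
apply: (@le_trans _ _ (\esum_(p in B1 `*`` (fun=> setT)) ((beta p)%:R : R)%:E)%E); last first.
  by apply: le_esum => -[x y] _ /=.
rewrite [leRHS](esumID B); last by move=> ? _; rewrite lee_fin.
have -> : (B1 `*`` (fun=> setT)) `&` B = B.
  by apply/seteqP; split=> [p []//|p Bp]; split=> //; split=> //=; have [] := hr p Bp.
by rewrite leeDl// esum_ge0// => ? _; rewrite lee_fin.
Qed.

Lemma plan_row eta omega beta x : plans eta omega beta ->
  eta x = 1%N -> exists y, beta (x, y) = 1%N /\ forall y', y' <> y -> beta (x, y') = 0%N.
Proof.
move=> [_ rows _] ex; have := rows x; rewrite ex => /esym/nsum_eq1[y [_ h1 h2]].
by exists y; split=> // y' yy'; exact: h2.
Qed.

Lemma plan_col eta omega beta y : plans eta omega beta ->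
  omega y = 1%N -> exists x, beta (x, y) = 1%N /\ forall x', x' <> x -> beta (x', y) = 0%N.
Proof.
move=> [_ _ cols] ey; have := cols y; rewrite ey => /esym/(@nsum_eq1 R _ _ (fun x => beta (x, y)))[x [_ h1 h2]].
by exists x; split=> // x' xx'; exact: h2.
Qed.

(** Simple marginals force multiplicities 0 and 1; together with [plan_inj_r] and [plan_inj_l], a
    plan is then the graph of a bijection. *)
Lemma plan_supp eta omega beta x y : good eta -> good omega -> plans eta omega beta ->
  beta (x, y) <> 0%N -> [/\ eta x = 1%N, omega y = 1%N & beta (x, y) = 1%N].
Proof.
move=> ge go bp b0.
have ex : eta x = 1%N.
  apply: good_val => // ex; apply: b0; have [_ rows _] := bp.
  by have := rows x; rewrite ex => /esym/(nsum_eq0 _ (fun y => beta (x, y))); apply.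
have oy : omega y = 1%N.
  apply: good_val => // oy; apply: b0; have [_ _ cols] := bp.
  by have := cols y; rewrite oy => /esym/(nsum_eq0 _ (fun x => beta (x, y))); apply.
split=> //; have [y' [h1 h2]] := plan_row _ _ _ _ bp ex.
by have [->//|/eqP/h2] := eqVneq y y'.
Qed.

Lemma plan_inj_r eta omega beta x y y' : good eta -> good omega -> plans eta omega beta ->
  beta (x, y) <> 0%N -> beta (x, y') <> 0%N -> y = y'.
Proof.
move=> ge go bp b1 b2; have [ex _ _] := plan_supp _ _ _ _ _ ge go bp b1.
have [z [_ h]] := plan_row _ _ _ _ bp ex.
have -> : y = z by apply: contrapT => n; exact: b1 (h y n).
by apply: contrapT => n; apply: b2 (h y' _) => e; exact: n (esym e).
Qed.

Lemma plan_inj_l eta omega beta x x' y : good eta -> good omega -> plans eta omega beta ->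
  beta (x, y) <> 0%N -> beta (x', y) <> 0%N -> x = x'.
Proof.
move=> ge go bp b1 b2; have [_ ey _] := plan_supp _ _ _ _ _ ge go bp b1.
have [z [_ h]] := plan_col _ _ _ _ bp ey.
have -> : x = z by apply: contrapT => n; exact: b1 (h x n).
by apply: contrapT => n; apply: b2 (h x' _) => e; exact: n (esym e).
Qed.

Lemma tcost_term_ge0 beta p : (0 <= ((beta p)%:R : R)%:E * (halfsqd p.1 p.2)%:E)%E.
Proof. by rewrite -EFinM lee_fin mulr_ge0// halfsqd_ge0. Qed.

Lemma tcost_ge0 beta : (0 <= tcost beta)%E.
Proof. by apply: esum_ge0 => p _; exact: tcost_term_ge0. Qed.

Lemma tcost_sub beta (A : set (X * X)) : finite_set A ->
  (forall p, A p -> beta p = 1%N) ->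
  (\sum_(p \in A) (halfsqd p.1 p.2)%:E <= tcost beta)%E.
Proof.
move=> fA A1; rewrite (eq_fsbigr (fun p => ((beta p)%:R : R)%:E * (halfsqd p.1 p.2)%:E)%E).
  by apply: ereal_sup_ubound; exists A.
by move=> p; rewrite inE => /A1 ->; rewrite mul1e.
Qed.

(* The [S n] are finite or infinite partial matchings; the plan is their pointwise limit
   along an ultrafilter. *)
Lemma ultra_plan eta omega F (S : nat -> X * X -> Prop) (r : R) :
  good eta -> good omega -> 0 <= r ->
  (forall n x y, S n (x, y) -> [/\ eta x = 1%N, omega y = 1%N & F (x, y)]) ->
  (forall n x y y', S n (x, y) -> S n (x, y') -> y = y') ->
  (forall n x x' y, S n (x, y) -> S n (x', y) -> x = x') ->
  (forall x, eta x = 1%N -> \forall n \near \oo, exists y, S n (x, y)) ->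
  (forall y, omega y = 1%N -> \forall n \near \oo, exists x, S n (x, y)) ->
  (forall n A, finite_set A -> A `<=` S n ->
     (\sum_(p \in A) (halfsqd p.1 p.2)%:E <= (r + n.+1%:R^-1)%:E)%E) ->
  exists beta, [/\ plans eta omega beta, (forall p, beta p <> 0%N -> F p) &
    (tcost beta <= r%:E)%E].
Proof.
move=> ge go r0 SP Sr Sl Sex Sey Sc.
have [G [UG ooG]] := @ultraFilterLemma nat \oo _.
pose beta : pconfig R k := fun p => if `[< G [set n | S n p] >] then 1%N else 0%N.
have b1 p : beta p <> 0%N -> G [set n | S n p].
  by rewrite /beta; case: asboolP.
have b0 p : ~ G [set n | S n p] -> beta p = 0%N.
  by rewrite /beta; case: asboolP.
have bT p : G [set n | S n p] -> beta p = 1%N.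
  by rewrite /beta; case: asboolP.
have S1 n x y : S n (x, y) -> halfsqd x y <= r + 1.
  move=> Sn; have := Sc n [set (x, y)] (finite_set1 _).
  rewrite fsbig_set1/= lee_fin => /(_ _)/le_trans; apply; first by move=> _ ->.
  by rewrite lerD2l invf_le1// ler1n.
have rows x : (((eta x)%:R : R)%:E = \esum_(y in setT) ((beta (x, y))%:R : R)%:E)%E.
  have [ex|/eqP ex] := eqVneq (eta x) 0%N.
    rewrite ex; apply/esym/(nsum_eq0 _ (fun y => beta (x, y))) => y _; apply: b0.
    move=> /(ultra_ex _ UG)[n /SP[]]; rewrite ex; discriminate.
  have {}ex := good_val _ _ ge ex.
  rewrite ex; apply/esym/(nsum_eq1 _ (fun y => beta (x, y))).
  (* The partners of [x] in all the [S n] cost at most [r + 1], hence lie in one bounded region,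
     where [omega] has finitely many points. *)
  have [||//||y [y1 y2]] := ultra_pick _ UG ooG _ (fun n y => S n (x, y))
     [set y : X | `|y| <= (`|x| + (2 * (r + 1) + 1)) /\ omega y <> 0%N].
  - exact: locfin_bounded_fin (proj1 go).
  - move=> n y Sn; split; first exact: halfsqd_norm (S1 _ _ _ Sn).
    by have [_ -> _] := SP _ _ _ Sn.
  - by move=> n y y'; exact: Sr.
  - exact: Sex.
  by exists y; split=> //; [exact: bT|move=> y' _ /y2; exact: b0].
have cols y : (((omega y)%:R : R)%:E = \esum_(x in setT) ((beta (x, y))%:R : R)%:E)%E.
  have [ey|/eqP ey] := eqVneq (omega y) 0%N.
    rewrite ey; apply/esym/(nsum_eq0 _ (fun x => beta (x, y))) => x _; apply: b0.
    move=> /(ultra_ex _ UG)[n /SP[_]]; rewrite ey; discriminate.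
  have {}ey := good_val _ _ go ey.
  rewrite ey; apply/esym/(nsum_eq1 _ (fun x => beta (x, y))).
  have [||//||x [x1 x2]] := ultra_pick _ UG ooG _ (fun n x => S n (x, y))
     [set x : X | `|x| <= (`|y| + (2 * (r + 1) + 1)) /\ eta x <> 0%N].
  - exact: locfin_bounded_fin (proj1 ge).
  - move=> n x Sn; split; last by have [-> _ _] := SP _ _ _ Sn.
    by apply: halfsqd_norm; rewrite halfsqdC; exact: S1 Sn.
  - by move=> n x x'; exact: Sl.
  - exact: Sey.
  by exists x; split=> //; [exact: bT|move=> x' _ /x2; exact: b0].
exists beta; split.
- by split=> //; exact: rows_locfin2 (proj1 ge) rows.
- by move=> [x y] /b1/(ultra_ex _ UG)[n /SP[]].
- apply: ge_ereal_sup => _ [A [fA _] <-].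
  apply/lee_addgt0Pr => e e0.
  pose A' := A `&` [set p | beta p = 1%N].
  have fA' : finite_set A' by apply: sub_finite_set fA => p [].
  (* Lower semicontinuity: finitely many pairs of the limit lie together in [S n] for [G]-many [n],
     in particular for one with [1/(n+1) <= e], whose cost bound they inherit. *)
  have : G (\bigcap_(p in A') [set n | S n p]).
    by apply: ultra_finI => // p [_ /= bp]; apply: b1; rewrite bp.
  have /ooG eG : \forall n \near \oo, n.+1%:R^-1 <= e.
    have := near_infty_natSinv_lt (PosNum e0).
    by apply: filterS => n /= /ltW.
  move=> SG; have [n [/= ne Sn]] := ultra_ex _ UG _ (ultra_I _ UG _ _ eG SG).
  apply: (@le_trans _ _ (\sum_(p \in A') (halfsqd p.1 p.2)%:E)%E).
    pose g (p : X * X) : \bar R := (((beta p)%:R : R)%:E * (halfsqd p.1 p.2)%:E)%E.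
    have E1 : (\sum_(p \in A') g p = \sum_(p \in A) g p)%E.
      apply: fsbig_widen; first by move=> p [].
      move=> p [Ap nA'] /=; rewrite /g b0 ?mul0e// => Gp; apply: nA'; split=> //.
      exact: bT.
    rewrite -[leLHS]E1 (eq_fsbigr (fun p => (halfsqd p.1 p.2)%:E))//.
    by move=> p; rewrite inE /g => -[_ /= ->]; rewrite mul1e.
  apply: le_trans (Sc n A' fA' Sn) _.
  by rewrite -EFinD lee_fin lerD2l.
Qed.

End Plans.

Lemma uniq_map_inj (T1 T2 : eqType) (f : T1 -> T2) (s : seq T1) :
  uniq [seq f i | i <- s] -> {in s &, injective f}.
Proof.
elim: s => [|x s IH] //= /andP[fx us] y z; rewrite !inE.
move=> /orP[/eqP->|ys] /orP[/eqP->|zs] // E.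
- by move: fx; rewrite E map_f.
- by move: fx; rewrite -E map_f.
- exact: IH.
Qed.

(** * Measurability of the cost *)

Section ConstrainedCost.
Context {R : realType} {k : nat}.
Let X := Xpt R k.
Let C := config R k.
Implicit Types (eta omega : C) (U V : set X) (beta : pconfig R k).

(** This replaces a measurable choice of plans: comparing it with [cost] detects where optimal plans
    can send the points of [U]. *)
Definition ccost (U V : set X) eta omega : \bar R :=
  ereal_inf [set tcost beta | beta in
    [set beta | plans eta omega beta /\ forall p, beta p <> 0%N -> U p.1 -> V p.2]].

Lemma ccostT eta omega : ccost setT setT eta omega = cost eta omega.
Proof.
rewrite /ccost /cost; congr ereal_inf; apply/seteqP; split=> x [b].
  by move=> [bp _] <-; exists b.
by move=> bp <-; exists b.
Qed.

Lemma ccost_ge0 U V eta omega : (0 <= ccost U V eta omega)%E.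
Proof. by apply: le_ereal_inf_tmp => x [b _ <-]; exact: tcost_ge0. Qed.

Lemma cost_ge0 eta omega : (0 <= cost eta omega)%E.
Proof. by rewrite -ccostT ccost_ge0. Qed.

Lemma cost_le_ccost U V eta omega : (cost eta omega <= ccost U V eta omega)%E.
Proof. by apply: ereal_inf_le_tmp => x [b [bp _] <-]; exists b. Qed.

(* A finite matching of points, each named by the index of the box isolating it, that covers
   the points of index below [n].  As [s] ranges over a countable set, this makes
   [ccost U V] measurable. *)
Definition partial_match U V (r : R) (n : nat) (s : seq (nat * nat)) eta omega : Prop :=
  [/\ forall ij, ij \in s -> [/\ isol ij.1 eta, isol ij.2 omega &
        U (ipt ij.1 eta) -> V (ipt ij.2 omega)],
      forall i, (i < n)%N -> isol i eta -> i \in unzip1 s,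
      forall j, (j < n)%N -> isol j omega -> j \in unzip2 s &
      \sum_(ij <- s) halfsqd (ipt ij.1 eta) (ipt ij.2 omega) <= r].

Lemma plan_ipt_row eta omega beta i : good eta -> good omega -> plans eta omega beta ->
  isol i eta -> exists j, isol j omega /\ beta (ipt i eta, ipt j omega) <> 0%N.
Proof.
move=> ge go bp ie; have [y [b1 _]] := plan_row _ _ _ _ bp (iptP i eta ie).
have [|_ oy _] := plan_supp _ _ _ (ipt i eta) y ge go bp; first by rewrite b1.
have [j jo yj] := isol_ex omega y (proj1 go) oy.
by exists j; split=> //; rewrite -yj b1.
Qed.

Lemma plan_ipt_col eta omega beta j : good eta -> good omega -> plans eta omega beta ->
  isol j omega -> exists i, isol i eta /\ beta (ipt i eta, ipt j omega) <> 0%N.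
Proof.
move=> ge go bp jo; have [x [b1 _]] := plan_col _ _ _ _ bp (iptP j omega jo).
have [|ex _ _] := plan_supp _ _ _ x (ipt j omega) ge go bp; first by rewrite b1.
have [i ie xi] := isol_ex eta x (proj1 ge) ex.
by exists i; split=> //; rewrite -xi b1.
Qed.

Lemma plan_partial_match U V r n eta omega beta : good eta -> good omega ->
  plans eta omega beta -> (forall p, beta p <> 0%N -> U p.1 -> V p.2) ->
  (tcost beta <= r%:E)%E ->
  exists s, [/\ uniq (unzip1 s), uniq (unzip2 s) & partial_match U V r n s eta omega].
Proof.
move=> ge go bp bUV br.
pose f i := if pselect (isol i eta) is left h
  then projT1 (cid (plan_ipt_row _ _ _ i ge go bp h)) else 0%N.
pose g j := if pselect (isol j omega) is left h
  then projT1 (cid (plan_ipt_col _ _ _ j ge go bp h)) else 0%N.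
have fP i : isol i eta -> isol (f i) omega /\ beta (ipt i eta, ipt (f i) omega) <> 0%N.
  by move=> h; rewrite /f; case: pselect => // h'; case: cid.
have gP j : isol j omega -> isol (g j) eta /\ beta (ipt (g j) eta, ipt j omega) <> 0%N.
  by move=> h; rewrite /g; case: pselect => // h'; case: cid.
(* The pairs through a source of index below [n] and those through a target of index below [n]; a
   pair may occur for both reasons. The default value 0 of [f] and [g] is filtered out. *)
pose s := undup ([seq (i, f i) | i <- iota 0 n & `[< isol i eta >]] ++
                 [seq (g j, j) | j <- iota 0 n & `[< isol j omega >]]).
have sP ij : ij \in s -> [/\ isol ij.1 eta, isol ij.2 omega &
    beta (ipt ij.1 eta, ipt ij.2 omega) <> 0%N].
  rewrite mem_undup mem_cat => /orP[] /mapP[i] /[!mem_filter] /andP[/asboolP ii _] -> /=.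
    by have [] := fP i ii.
  by have [] := gP i ii.
have u1 : uniq (unzip1 s).
  rewrite map_inj_in_uniq ?undup_uniq// => -[i j] [i' j'] /sP[/= i1 j1 b1] /sP[/= i2 j2 b2] E.
  rewrite -E in b2 *; congr pair; apply: (ipt_inj _ _ _ j1 j2).
  exact: plan_inj_r ge go bp b1 b2.
have u2 : uniq (unzip2 s).
  rewrite map_inj_in_uniq ?undup_uniq// => -[i j] [i' j'] /sP[/= i1 j1 b1] /sP[/= i2 j2 b2] E.
  rewrite -E in b2 *; congr pair; apply: (ipt_inj _ _ _ i1 i2).
  exact: plan_inj_l ge go bp b1 b2.
exists s; split=> //; split.
- by move=> ij /sP[h1 h2 h3]; split=> //; exact: (bUV _ h3).
- move=> i ni ii; apply/mapP; exists (i, f i) => //.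
  rewrite mem_undup mem_cat; apply/orP; left; apply/mapP; exists i => //.
  by rewrite mem_filter mem_iota add0n ni !andbT; apply/asboolP.
- move=> j nj jj; apply/mapP; exists (g j, j) => //.
  rewrite mem_undup mem_cat; apply/orP; right; apply/mapP; exists j => //.
  by rewrite mem_filter mem_iota add0n nj !andbT; apply/asboolP.
pose phi (ij : nat * nat) := (ipt ij.1 eta, ipt ij.2 omega).
rewrite -lee_fin; apply: le_trans br.
have us : uniq [seq phi ij | ij <- s].
  rewrite map_inj_in_uniq ?undup_uniq// => -[i j] [i' j'] /sP[/= i1 j1 _] /sP[/= i2 j2 _] [E1 E2].
  by rewrite (ipt_inj _ _ _ i1 i2 E1) (ipt_inj _ _ _ j1 j2 E2).
have := @tcost_sub R k beta [set` [seq phi ij | ij <- s]].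
rewrite -(fsbig_seq _ (fun p => (halfsqd p.1 p.2)%:E) us) big_map sumEFin; apply.
  by apply/finite_seqP; exists [seq phi ij | ij <- s].
move=> p /= /mapP[ij /sP[_ _ b0] ->].
by have [] := plan_supp _ _ _ _ _ ge go bp b0.
Qed.

Lemma partial_match_plan U V (r : R) (s : nat -> seq (nat * nat)) eta omega :
  good eta -> good omega -> 0 <= r ->
  (forall n, uniq (unzip1 (s n))) -> (forall n, uniq (unzip2 (s n))) ->
  (forall n, partial_match U V (r + n.+1%:R^-1) n (s n) eta omega) ->
  exists beta, [/\ plans eta omega beta, (forall p, beta p <> 0%N -> U p.1 -> V p.2) &
    (tcost beta <= r%:E)%E].
Proof.
move=> ge go r0 u1 u2 sM.
pose S n (p : X * X) := exists2 ij, ij \in s n & p = (ipt ij.1 eta, ipt ij.2 omega).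
apply: (ultra_plan eta omega [set p | U p.1 -> V p.2] S r) => //.
- move=> n x y [ij ijs [-> ->]]; have [h _ _ _] := sM n; have [i1 j1 UV] := h _ ijs.
  by split=> //; exact: iptP.
- move=> n x y y' [[i j] s1 [-> ->]] [[i' j'] s2 [E ->]].
  have [h _ _ _] := sM n; have [/= i1 j1 _] := h _ s1; have [/= i2 j2 _] := h _ s2.
  have ii := ipt_inj _ _ _ i1 i2 E.
  by have [_ ->] := uniq_map_inj _ _ _ _ (u1 n) _ _ s1 s2 ii.
- move=> n x x' y [[i j] s1 [-> ->]] [[i' j'] s2 [-> E]].
  have [h _ _ _] := sM n; have [/= _ j1 _] := h _ s1; have [/= _ j2 _] := h _ s2.
  have jj := ipt_inj _ _ _ j1 j2 E.
  by have [-> _] := uniq_map_inj _ _ _ _ (u2 n) _ _ s1 s2 jj.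
- move=> x ex; have [i ii ->] := isol_ex eta x (proj1 ge) ex.
  exists i.+1 => // n /= ni; have [_ h _ _] := sM n.
  have /mapP[[i' j] ijs /= E] := h i ni ii.
  by exists (ipt j omega), (i', j) => //=; rewrite E.
- move=> y ey; have [j jj ->] := isol_ex omega y (proj1 go) ey.
  exists j.+1 => // n /= nj; have [_ _ h _] := sM n.
  have /mapP[[i j'] ijs /= E] := h j nj jj.
  by exists (ipt i eta), (i, j') => //=; rewrite E.
- move=> n A fA AS; have [h _ _ c] := sM n.
  pose phi (ij : nat * nat) := (ipt ij.1 eta, ipt ij.2 omega).
  apply: le_trans (_ : ((\sum_(ij <- s n) halfsqd (phi ij).1 (phi ij).2)%:E <= _)%E) => //.
  have us : uniq (s n) := map_uniq (u1 n).
  have inj : {in s n &, injective phi}.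
    move=> [i j] [i' j'] s1 s2 [/= E1 _].
    have [/= i1 _ _] := h _ s1; have [/= i2 _ _] := h _ s2.
    have ii := ipt_inj _ _ _ i1 i2 E1.
    exact: uniq_map_inj _ _ _ _ (u1 n) _ _ s1 s2 ii.
  have us' : uniq [seq phi ij | ij <- s n] by rewrite map_inj_in_uniq.
  rewrite -sumEFin -(big_map phi predT (fun p => (halfsqd p.1 p.2)%:E)) (fsbig_seq _ _ us').
  apply: lee_fsum_nneg_subset => //.
  + by move=> p; rewrite inE => /AS[ij ijs ->] /=; apply/mem_set/mapP; exists ij.
  + by move=> p _; rewrite lee_fin halfsqd_ge0.
Qed.

(** The slack [1/(n+1)] lets a nearly minimal plan supply the matchings, as the infimum is not yet
    known to be attained. Conversely, the matchings have a limit plan of cost at most [r]. *)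
Lemma ccost_leP U V (r : R) eta omega : good eta -> good omega ->
  (ccost U V eta omega <= r%:E)%E <->
  forall n, exists s, [/\ uniq (unzip1 s), uniq (unzip2 s) &
    partial_match U V (r + n.+1%:R^-1) n s eta omega].
Proof.
move=> ge go; split=> [cr n|h].
  have rn : (r%:E < (r + n.+1%:R^-1)%:E)%E by rewrite lte_fin ltrDl invr_gt0.
  have [_ [b [bp bUV] <-] /ltW br] := ereal_inf_lt (le_lt_trans cr rn).
  exact: plan_partial_match ge go bp bUV br.
have [s sP] := @boolp.choice nat _ _ h.
have [r0|r0] := leP 0 r.
  have [n|n|n|b [bp bUV br]] := partial_match_plan U V r s eta omega ge go r0;
    try by have [] := sP n.
  by apply: le_trans br; apply: ereal_inf_lbound; exists b.
(* For negative [r] this [n] makes [r + 1/(n+1)] negative, below any sum of costs. *)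
exfalso; pose n := Num.trunc (- r)^-1.
have [_ _ [_ _ _]] := sP n; apply/negP; rewrite -ltNge.
apply: (@lt_le_trans _ _ 0); last by apply: sumr_ge0 => ij _; exact: halfsqd_ge0.
rewrite -ltrBrDl sub0r invf_plt ?posrE ?oppr_gt0// truncnS_gt//.
Qed.

Lemma ccost_attained U V eta omega : good eta -> good omega ->
  (ccost U V eta omega < +oo)%E ->
  exists beta, [/\ plans eta omega beta, (forall p, beta p <> 0%N -> U p.1 -> V p.2) &
    tcost beta = ccost U V eta omega].
Proof.
move=> ge go; have := ccost_ge0 U V eta omega.
case E : (ccost U V eta omega) => [r| |] // r0 _; rewrite lee_fin in r0.
have := lexx r%:E; rewrite -{1}E => /(ccost_leP U V r eta omega ge go) h.
have [s sP] := @boolp.choice nat _ _ h.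
have [n|n|n|b [bp bUV br]] := partial_match_plan U V r s eta omega ge go r0;
  try by have [] := sP n.
exists b; split=> //; apply/eqP; rewrite eq_le br -E.
by apply: ereal_inf_lbound; exists b.
Qed.

Lemma measurable_partial_match U V (r : R) n (s : seq (nat * nat)) :
  measurable (U : set borelX) -> measurable (V : set borelX) ->
  measurable [set p : C * C | partial_match U V r n s p.1 p.2].
Proof.
move=> mU mV.
have mI1 i : measurable [set p : C * C | isol i p.1].
  rewrite -[X in measurable X]setTI.
  exact: (measurable_fst measurableT _ (measurable_isol i)).
have mI2 j : measurable [set p : C * C | isol j p.2].
  rewrite -[X in measurable X]setTI.
  exact: (measurable_snd measurableT _ (measurable_isol j)).
have mU1 i : measurable [set p : C * C | U (ipt i p.1)].
  rewrite -[X in measurable X]setTI.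
  have mf : measurable_fun setT ((fun p => ipt i p.1) : C * C -> @borelX R k).
    by apply: (measurableT_comp (measurable_pt (ubox i) (bborel_ubox i))).
  exact: (mf measurableT _ mU).
have mV2 j : measurable [set p : C * C | V (ipt j p.2)].
  rewrite -[X in measurable X]setTI.
  have mf : measurable_fun setT ((fun p => ipt j p.2) : C * C -> @borelX R k).
    by apply: (measurableT_comp (measurable_pt (ubox j) (bborel_ubox j))).
  exact: (mf measurableT _ mV).
pose A1 := \bigcap_(ij in [set` s]) ([set p : C * C | isol ij.1 p.1] `&`
    ([set p : C * C | isol ij.2 p.2] `&` (~` [set p : C * C | U (ipt ij.1 p.1)] `|`
      [set p : C * C | V (ipt ij.2 p.2)]))).
pose A2 := \bigcap_(i in [set i | (i < n)%N /\ i \notin unzip1 s]) (~` [set p : C * C | isol i p.1]).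
pose A3 := \bigcap_(j in [set j | (j < n)%N /\ j \notin unzip2 s]) (~` [set p : C * C | isol j p.2]).
pose h (p : C * C) : R := \sum_(ij <- s) halfsqd (ipt ij.1 p.1) (ipt ij.2 p.2).
have mh : measurable_fun setT h.
  apply: measurable_sum => ij; apply: measurable_funM; last exact: measurable_cst.
  apply: measurable_sum => j; apply: measurable_funX; apply: measurable_funB.
    apply: (measurableT_comp (measurable_pt_coord (ubox ij.1) j (bborel_ubox _))).
    exact: measurable_fst.
  apply: (measurableT_comp (measurable_pt_coord (ubox ij.2) j (bborel_ubox _))).
  exact: measurable_snd.
have -> : [set p : C * C | partial_match U V r n s p.1 p.2] =
    A1 `&` (A2 `&` (A3 `&` [set p | h p <= r])).
  apply/seteqP; split=> p /=.
    move=> [h1 h2 h3 h4]; split.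
      move=> ij /= /h1[i1 j1 UV]; split=> //; split=> //.
      by have [u|u] := pselect (U (ipt ij.1 p.1)); [right; exact: UV|left].
    split; first by move=> i /= [ni /negP ns] ii; apply: ns; exact: h2.
    by split=> // j /= [nj /negP ns] jj; apply: ns; exact: h3.
  move=> [h1 [h2 [h3 h4]]]; split=> //.
  - by move=> ij /h1[i1 [j1 UV]]; split=> // u; case: UV.
  - by move=> i ni ii; apply/negPn/negP => ns; exact: (h2 i (conj ni ns)).
  - by move=> j nj jj; apply/negPn/negP => ns; exact: (h3 j (conj nj ns)).
apply: measurableI.
  apply: fin_bigcap_measurable => //.
  move=> ij _; apply: measurableI => //; apply: measurableI => //.
  by apply: measurableU => //; exact: measurableC.
apply: measurableI; first by apply: bigcap_measurableType => i _; exact: measurableC.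
apply: measurableI; first by apply: bigcap_measurableType => i _; exact: measurableC.
rewrite -[X in measurable X]setTI.
have -> : [set p | h p <= r] = h @^-1` `]-oo, r] by apply/seteqP; split=> p /=; rewrite in_itv.
exact: mh.
Qed.

(** [ccost_leP] applies to good configurations only; [D1] and [D2] are measurable sets of these,
    standing in for the set [good] itself. *)
Lemma measurable_ccost_le U V (r : R) (D1 D2 : set C) :
  measurable (U : set borelX) -> measurable (V : set borelX) ->
  measurable D1 -> measurable D2 ->
  D1 `<=` good -> D2 `<=` good ->
  measurable ((D1 `*` D2) `&` [set p : C * C | (ccost U V p.1 p.2 <= r%:E)%E]).
Proof.
move=> mU mV mD1 mD2 g1 g2.
pose M n s : set (C * C) := if uniq (unzip1 s) && uniq (unzip2 s) then
  [set p : C * C | partial_match U V (r + n.+1%:R^-1) n s p.1 p.2] else set0.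
have mM n s : measurable (M n s).
  by rewrite /M; case: ifP => // _; exact: measurable_partial_match.
have -> : (D1 `*` D2) `&` [set p : C * C | (ccost U V p.1 p.2 <= r%:E)%E] =
    (D1 `*` D2) `&` \bigcap_n \bigcup_s M n s.
  apply/seteqP; split=> p [[d1 d2]] /=.
    move=> /(ccost_leP _ _ _ _ _ (g1 _ d1) (g2 _ d2)) h; split=> // n _.
    by have [s [u1 u2 sM]] := h n; exists s => //; rewrite /M u1 u2.
  move=> h; split=> //; apply/(ccost_leP _ _ _ _ _ (g1 _ d1) (g2 _ d2)) => n.
  by have [s _] := h n I; rewrite /M; case: ifP => // /andP[u1 u2] sM; exists s.
apply: measurableI; first exact: measurableX.
apply: bigcapT_measurable => n; apply: countable_bigcupT_measurable; [exact: countableP|exact: mM].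
Qed.

Lemma measurable_ccost U V (D1 D2 : set C) :
  measurable (U : set borelX) -> measurable (V : set borelX) ->
  measurable D1 -> measurable D2 ->
  D1 `<=` good -> D2 `<=` good ->
  measurable_fun (D1 `*` D2) (fun p : C * C => ccost U V p.1 p.2).
Proof.
move=> mU mV mD1 mD2 g1 g2 mD.
apply: (measurability _ (ErealGenOInfty.measurableE R)) => // Y [W [r ->] <-].
have -> : (D1 `*` D2) `&` (fun p : C * C => ccost U V p.1 p.2) @^-1` `]r%:E, +oo[ =
  (D1 `*` D2) `\` ((D1 `*` D2) `&` [set p : C * C | (ccost U V p.1 p.2 <= r%:E)%E]).
  apply/seteqP; split=> p /=; rewrite in_itv/= andbT.
    by move=> [d cr]; split=> // -[_]; rewrite leNgt cr.
  by move=> [d cr]; split=> //; rewrite ltNge; apply/negP => h; exact: cr.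
by apply: measurableD => //; exact: measurable_ccost_le.
Qed.

End ConstrainedCost.

(** * Cost of moving one point *)

Section Transport.
Context {R : realType} {k : nat}.
Let X := Xpt R k.
Let C := config R k.
Implicit Types (eta omega : C) (U V B : set X).

Lemma halfsqd_move (x x' y : X) (i : 'I_k) : (forall j, j != i -> x' ord0 j = x ord0 j) ->
  halfsqd x' y = halfsqd x y +
    (x' ord0 i - x ord0 i) * (x' ord0 i + x ord0 i - 2 * y ord0 i) / 2.
Proof.
move=> h; rewrite /halfsqd (bigD1 i)//= [in RHS](bigD1 i)//=.
under eq_bigr => j ji do rewrite h//.
by field.
Qed.

Section Img.
Variables f g : X -> X.
Hypotheses (fK : cancel f g) (gK : cancel g f).

Lemma imgE eta x : img f eta x = eta (g x).
Proof.
rewrite /img; case: pselect => [h|]; last by case; exists (g x).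
by case: cid => z /= <-; rewrite fK.
Qed.

Lemma cnt_img eta B : cnt (img f eta) B = cnt eta (f @^-1` B) :> \bar R.
Proof.
rewrite /cnt (reindex_esum (f @^-1` B) B f).
  by apply: eq_esum => x _; rewrite imgE fK.
split=> //; first by move=> x y _ _ /(can_inj fK).
by move=> y By; exists (g y); rewrite /= gK.
Qed.

Lemma img_measurable : measurable_fun setT (f : @borelX R k -> @borelX R k) ->
  (forall B, bounded_pt B -> bounded_pt (f @^-1` B)) ->
  measurable_fun setT (img f : C -> C).
Proof.
move=> mf bf; apply: (@measurability _ _ C C setT (img f) (@config_gen R k)) => // Y [W [B [n [mB bB ->]]] <-].
rewrite setTI.
have -> : (img f : C -> C) @^-1` [set eta | cnt eta B = (n%:R)%:E] =
   [set eta | cnt eta (f @^-1` B) = (n%:R)%:E].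
  by apply/seteqP; split=> eta /=; rewrite cnt_img.
apply: measurable_cnt_eq; split; last exact: bf.
by have := mf measurableT B mB; rewrite setTI.
Qed.

Variables (U : set X).
Hypotheses (fU : forall x, U (f x) <-> U x) (fout : forall x, ~ U x -> f x = x).

Lemma img_bounded : bounded_pt U -> forall B, bounded_pt B -> bounded_pt (f @^-1` B).
Proof.
move=> [r rU] B [s sB]; exists (Num.max r s) => x /= Bfx; rewrite le_max.
have [/rU ->//|nU] := pselect (U x).
by apply/orP; right; rewrite -(fout x nU) sB.
Qed.

Lemma preimage_inv : f @^-1` U = U.
Proof. by apply/seteqP; split=> x /fU. Qed.

Lemma pt_img eta : cnt eta U = 1%E -> pt U (img f eta) = f (pt U eta).
Proof.
move=> c1; apply/esym/pt_uniq.
- by rewrite cnt_img preimage_inv.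
- by apply/fU; have [] := ptP _ _ c1.
- by rewrite imgE fK; have [_ -> _] := ptP _ _ c1.
Qed.

(** In an optimal plan that obeys the constraint, moving the sources by [f] alters the cost of one
    pair, by a difference of squares. The sign condition [fV] allows [q] to replace the target
    coordinate, so that the bound depends on [eta] alone and can be averaged over first
    marginals. *)
Lemma transport_cost (V : set X) (i : 'I_k) (q : R) eta omega :
  bounded_pt U -> good eta -> good omega -> cnt eta U = 1%E ->
  (forall j, j != i -> f (pt U eta) ord0 j = pt U eta ord0 j) ->
  (forall y, V y -> 0 <= (f (pt U eta) ord0 i - pt U eta ord0 i) * (y ord0 i - q)) ->
  (cost eta omega < +oo)%E -> (ccost U V eta omega <= cost eta omega)%E ->
  (cost (img f eta) omega <= cost eta omega +
   ((f (pt U eta) ord0 i - pt U eta ord0 i) *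
    (f (pt U eta) ord0 i + pt U eta ord0 i - 2 * q) / 2)%:E)%E.
Proof.
move=> bU ge go c1 fj fV cfin cc.
have [b [bp bUV bc]] := ccost_attained U V eta omega ge go (le_lt_trans cc cfin).
have {}bc : tcost b = cost eta omega.
  by apply/eqP; rewrite bc eq_le cc cost_le_ccost.
set x := pt U eta in fj fV *; set x' := f x in fj fV *.
have [Ux ex xP] := ptP _ _ c1; rewrite -/x in Ux ex xP.
have [y [bxy yP]] := plan_row _ _ _ _ bp ex.
pose b' : pconfig R k := fun p => b (g p.1, p.2).
have lf : locfin (img f eta).
  by move=> B bB; rewrite cnt_img; apply: (proj1 ge); exact: img_bounded.
have bp' : plans (img f eta) omega b'.
  have [_ rows cols] := bp.
  have rows' a : (((img f eta a)%:R : R)%:E = \esum_(y in setT) ((b' (a, y))%:R : R)%:E)%E.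
    by rewrite imgE rows.
  split=> //; first exact: rows_locfin2 lf rows'.
  move=> z; rewrite cols (reindex_esum setT setT f (fun a => ((b' (a, z))%:R : R)%:E)).
    by apply: eq_esum => a _; rewrite /b' /= fK.
  split=> //; first by move=> u v _ _ /(can_inj fK).
  by move=> u _; exists (g u); rewrite // gK.
have cb' : tcost b' = (\esum_(p in setT) ((b p)%:R : R)%:E * (halfsqd (f p.1) p.2)%:E)%E.
  rewrite /tcost (reindex_esum setT setT (fun p : X * X => (f p.1, p.2)))//.
    by apply: eq_esum => p _; rewrite /b' /= fK -surjective_pairing.
  split=> //; first by move=> [u1 u2] [v1 v2] _ _ /= [/(can_inj fK) -> ->].
  by move=> [u1 u2] _; exists (g u1, u2); rewrite //= gK.
apply: (@le_trans _ _ (tcost b')); first by apply: ereal_inf_lbound; exists b'.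
have nn (h : X -> X) (p : X * X) : (0 <= ((b p)%:R : R)%:E * (halfsqd (h p.1) p.2)%:E)%E.
  by rewrite -EFinM lee_fin mulr_ge0// halfsqd_ge0.
rewrite cb' -bc /tcost (esumID [set (x, y)]); last by move=> p _; exact: (nn f).
rewrite [in leRHS](esumID [set (x, y)]); last by move=> p _; exact: (nn id).
rewrite !setTI !esum_set1; [|exact: (nn id (x, y))|exact: (nn f (x, y))].
(* Every pair of the plan other than [(x, y)] has its source outside [U], where [f] is the
   identity. *)
rewrite (_ : \esum_(p in ~` [set (x, y)]) (((b p)%:R : R)%:E * (halfsqd (f p.1) p.2)%:E) =
  \esum_(p in ~` [set (x, y)]) (((b p)%:R : R)%:E * (halfsqd p.1 p.2)%:E))%E; last first.
  apply: eq_esum => -[u v] /= uv.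
  have [->|/eqP b0] := eqVneq (b (u, v)) 0%N; first by rewrite !mul0e.
  have [eu _ _] := plan_supp _ _ _ _ _ ge go bp b0.
  have ux : u <> x.
    move=> ux; apply: uv; rewrite ux; congr pair.
    by apply: contrapT => vy; apply: b0; rewrite ux; exact: yP.
  by rewrite fout// => Uu; have := xP u Uu ux; rewrite eu.
rewrite /= bxy !mul1e -/x' (halfsqd_move x x' y i fj) addeAC leeD2r// -EFinD lee_fin lerD2l.
rewrite ler_pM2r// -subr_ge0 -mulrBr.
have := fV y; have := bUV (x, y); rewrite bxy /= => h1 h2.
have := h2 (h1 _ Ux); rewrite -/x' => h3.
have -> : x' ord0 i + x ord0 i - 2 * q - (x' ord0 i + x ord0 i - 2 * y ord0 i) =
  2 * (y ord0 i - q) by ring.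
by rewrite mulrCA mulr_ge0// h3.
Qed.

End Img.
End Transport.

(** * Measurability of the box flow *)

Section FlowMeasurable.
Context {R : realType} {k : nat}.
Variables (c : 'rV[R]_k) (r : R) (i : 'I_k).
Hypothesis r0 : 0 < r.
Let X := Xpt R k.

Lemma box_flow_continuous_in t (x : X) : box c r x ->
  {for x, continuous (box_flow c r i t : X -> X)}.
Proof.
move=> bx.
pose h (y : X) : R := r * (unchart (chart (relc c r i y) + - (t * bellprod c r i y)) - relc c r i y).
pose F (y : X) : X := y + h y *: delta_mx ord0 i.
have E : {near x, F =1 box_flow c r i t}.
  have ob : nbhs x (box c r) by apply: open_nbhs_nbhs; split=> //; exact: box_open.
  apply: filterS ob => y /(@boxP R k c r r0)/forallP/(_ i) yi.
  by rewrite /F /h /box_flow /flow1 yi.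
have cF : {for x, continuous F}.
  have cr : relc c r i z @[z --> x] --> relc c r i x by exact: relc_continuous.
  have cb : bellprod c r i z @[z --> x] --> bellprod c r i x.
    have := @Cn_prod R X 0 'I_k (index_enum 'I_k) (fun j => j != i) (fun j x => bell (relc c r j x)).
    move=> H; apply: (Cn_cont _ _ _ (H _)) => j; exact: Cn_bell_relc.
  have cc : chart (relc c r i z) @[z --> x] --> chart (relc c r i x).
    apply: (@continuous_comp _ _ _ (relc c r i) chart); first exact: relc_continuous.
    apply: differentiable_continuous; apply/derivable1_diffP.
    have /(@boxP R k c r r0)/forallP/(_ i) xi := bx.
    exact: (@ex_derive _ _ _ _ _ _ _ (is_derive_chart (relc c r i x) xi)).
  have cu : unchart (chart (relc c r i z) + - (t * bellprod c r i z)) @[z --> x] -->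
     unchart (chart (relc c r i x) + - (t * bellprod c r i x)).
    apply: (@continuous_comp _ _ _ (fun z => chart (relc c r i z) + - (t * bellprod c r i z)) unchart).
      apply: (cvgD cc); apply: cvgN.
      exact: (@cvgM _ _ (nbhs x) _ (fun _ : X => t) _ t _ (cvg_cst t) cb).
    exact: unchart_continuous.
  have ch : h z @[z --> x] --> h x.
    apply: (@cvgM _ _ (nbhs x) _ (fun _ : X => r) _ r _ (cvg_cst r)).
    exact: (cvgB cu cr).
  have FX : Filter (nbhs x) by exact: nbhs_filter.
  have chZ := @cvgZr_tmp _ _ _ (nbhs x) FX h (h x) (delta_mx ord0 i : X) ch.
  exact: (@cvgD _ _ _ (nbhs x) FX (fun y : X => y) _ _ _ cvg_id chZ).
rewrite /prop_for /continuous_at -(nbhs_singleton E).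
apply: cvg_trans cF; exact: (@near_eq_cvg _ _ (nbhs x) (nbhs_filter x) _ _ E).
Qed.

(** The map is continuous on the open box and the identity on its complement, so the preimage of an
    open set is an open set joined to a Borel set. *)
Lemma measurable_box_flow t :
  measurable_fun setT (box_flow c r i t : @borelX R k -> @borelX R k).
Proof.
apply: (@measurability _ _ (@borelX R k) (@borelX R k) setT (box_flow c r i t) [set U : set X | open U]) => // Y [W oW <-]; rewrite setTI.
have -> : box_flow c r i t @^-1` W =
  (box c r `&` box_flow c r i t @^-1` W) `|` (W `&` ~` box c r).
  apply/seteqP; split=> x /=.
    move=> Wx; have [bx|bx] := pselect (box c r x); [by left|right].
    by rewrite (box_flow_out c r i r0) in Wx.
  by move=> [[]//|[Wx bx]]; rewrite (box_flow_out c r i r0).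
have mb : measurable (box c r : set (@borelX R k)) by apply: open_borel; exact: box_open.
apply: measurableU; last by apply: measurableI; [exact: open_borel|exact: measurableC].
apply: open_borel; rewrite openE => x [bx Wx]; apply: filterI.
  by apply: open_nbhs_nbhs; split=> //; exact: box_open.
apply: (box_flow_continuous_in t x bx).
exact: open_nbhs_nbhs.
Qed.

End FlowMeasurable.

(** * Exchange of mass between two events *)

Section Density.
Context {d : measure_display} {T : measurableType d} {R : realType}.
Local Open Scope ereal_scope.

Section Pack.
Variables (m : {measure set T -> \bar R}) (mT : m setT < +oo).

(** The finiteness proof is a phantom argument, so that the finite-measure structure required by
    Radon-Nikodym can be attached to any measure. *)
Definition fin_measure of m setT < +oo : set T -> \bar R := m.
HB.instance Definition _ := Measure.on (fin_measure mT).

Let fin_measure_fin : fin_num_fun (fin_measure mT).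
Proof.
move=> A mA; rewrite ge0_fin_numE ?measure_ge0//.
by apply: le_lt_trans mT; apply: le_measure; rewrite ?inE.
Qed.
HB.instance Definition _ := Measure_isFinite.Build d T R (fin_measure mT) fin_measure_fin.

End Pack.

Lemma bounded_integrable (m : {measure set T -> \bar R}) (h : T -> R) (K : R) :
  m setT < +oo -> measurable_fun setT h -> (forall x, (`|h x| <= K)%R) ->
  m.-integrable setT (EFin \o h).
Proof.
move=> mT mh hK; apply/integrableP; split; first exact/measurable_EFinP.
apply: (@le_lt_trans _ _ (\int[m]_(x in setT) (cst K%:E) x)).
  apply: ge0_le_integral => //.
  - by apply: measurableT_comp => //; exact/measurable_EFinP.
  - by move=> x _; rewrite lee_fin (le_trans _ (hK x)).
rewrite integral_cst//.
have [K0|K0] := leP 0%R K; first by rewrite lte_mul_pinfty// lee_fin.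
by rewrite (le_lt_trans _ (ltry 0%R))// mule_le0_ge0// lee_fin ltW.
Qed.

(** As [m <= m + n], the density of [m] with respect to [m + n] is at most 1 almost everywhere: on
    the set where it exceeds 1, its excess has nonpositive integral. Truncation makes the bound hold
    everywhere. *)
Lemma fractional_density (m n : {measure set T -> \bar R}) :
  m setT < +oo -> n setT < +oo ->
  exists u : T -> R, [/\ measurable_fun setT u, (forall x, (0 <= u x <= 1)%R) &
    forall h : T -> R, measurable_fun setT h -> (forall x, (0 <= h x)%R) ->
      \int[measure_add m n]_x (h x * u x)%:E = \int[m]_x (h x)%:E].
Proof.
move=> mT nT; pose l : {measure set T -> \bar R} := measure_add m n.
have lE A : l A = m A + n A by exact: measure_addE.
have lT : l setT < +oo by rewrite lE lte_add_pinfty.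
pose m' : {finite_measure set T -> \bar R} := fin_measure m mT.
pose l' : {finite_measure set T -> \bar R} := fin_measure l lT.
have ml A : m A <= l A by rewrite lE leeDl.
have ac : m' `<< l'.
  apply/null_content_dominatesP => A mA /= lA.
  by apply/eqP; rewrite eq_le measure_ge0 andbT -[leRHS]lA; exact: ml.
pose f := Radon_Nikodym_SigmaFinite.f m' l'.
have f0 x : 0 <= f x by exact: Radon_Nikodym_SigmaFinite.f_ge0.
have ff x : f x \is a fin_num by exact: Radon_Nikodym_SigmaFinite.f_fin_num.
have intf : l.-integrable setT f := Radon_Nikodym_SigmaFinite.f_integrable ac.
have mf : measurable_fun setT f := measurable_int _ intf.
pose B := [set x | 1%R%:E < f x].
have mB : measurable B.
  by rewrite -[B]setTI; exact: emeasurable_fun_o_infty.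
pose v x := fine (f x).
have mv : measurable_fun setT v by apply: (measurableT_comp _ mf); exact: fine_measurable.
pose u x := Num.min (v x) 1%R.
have mu : measurable_fun setT u by exact: measurable_minr.
have lB : l B = 0.
  have h1 : \int[l]_(x in B) f x = m B.
    exact/esym/(Radon_Nikodym_SigmaFinite.f_integral ac mB).
  have h2 : \int[l]_(x in B) f x <= \int[l]_(x in B) cst 1 x.
    by rewrite h1 integral_cst// mul1e; exact: ml.
  have intB : l.-integrable B f by exact: integrableS intf.
  have int1 : l.-integrable B (cst 1).
    apply: (integrableS measurableT) => //.
    by apply: (bounded_integrable l (cst 1%R) 1%R lT) => // x; rewrite normr1.
  have h3 : \int[l]_(x in B) (f x - 1) <= 0.
    rewrite integralB// leeBlDr ?add0e//.
    by apply: integrable_fin_num.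
  have pos x : B x -> 0 <= (f x - 1).
    by move=> Bx; rewrite suber_ge0//; exact: ltW Bx.
  have h4 : \int[l]_(x in B) `|(f x - 1)| = 0.
    apply/eqP; rewrite eq_le integral_ge0 ?andbT//.
    rewrite (eq_integral (fun x => f x - 1))// => x; rewrite inE => Bx.
    by rewrite gee0_abs// pos.
  have mD : measurable_fun B (fun x => f x - 1).
    by apply: emeasurable_funB => //; exact: measurable_funTS.
  have /(ae_eq_integral_abs l mB mD) [N [mN lN subN]] := h4.
  apply/eqP; rewrite eq_le measure_ge0 andbT -lN le_measure ?inE//.
  move=> x Bx; apply: subN => h; have E : f x - 1 = 0 := h Bx.
  have f1 : f x = 1 by rewrite -(@subeK _ (f x) 1)// E add0e.
  by have := Bx; rewrite /B/= f1 ltxx.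
exists u; split=> //.
  by move=> x; rewrite ge_min lexx orbT le_min ler01 fine_ge0.
move=> h mh h0.
have <- := Radon_Nikodym_SigmaFinite.change_of_variables ac (f := EFin \o h) (E := setT).
apply: ge0_ae_eq_integral => //.
- by apply/measurable_EFinP; exact: measurable_funM.
- by apply: emeasurable_funM => //; exact/measurable_EFinP.
- move=> x _; rewrite lee_fin mulr_ge0// le_min ler01 fine_ge0//.
- by move=> x _; rewrite mule_ge0 ?lee_fin.
- exists B; split=> // x /=; apply: contra_notP => /negP.
  rewrite -leNgt => fx _; rewrite EFinM; congr (_ * _).
  rewrite /u min_l /v ?fineK//.
  by rewrite -lee_fin fineK.
- by move=> x; rewrite lee_fin.
- exact: measurableT.
- exact/measurable_EFinP.
Qed.

(* With [u = dm / d(m + n)], both [(1 - u) m] and [u n] equal the common part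
   [u (1 - u) (m + n)]. *)
Lemma fractional_swap (m n : {measure set T -> \bar R}) :
  m setT < +oo -> n setT < +oo ->
  exists u : T -> R, [/\ measurable_fun setT u, (forall x, (0 <= u x <= 1)%R) &
    forall (h : T -> R) (K : R), measurable_fun setT h -> (forall x, (`|h x| <= K)%R) ->
      \int[m]_x (h x * (1 - u x))%:E = \int[n]_x (h x * u x)%:E].
Proof.
move=> mT nT; have [u [mu u01 uP]] := fractional_density m n mT nT.
exists u; split=> // h K mh hK.
(* Nonnegative functions come first, to avoid undefined differences; a bounded [h] is then [h + K]
   minus the constant [K]. *)
have pos (h' : T -> R) : measurable_fun setT h' -> (forall x, (0 <= h' x)%R) ->
   (forall x, (h' x <= K + K)%R) ->
   \int[m]_x (h' x * (1 - u x))%:E = \int[n]_x (h' x * u x)%:E.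
  move=> mh' h0 hK'.
  have bd x : (`|h' x * u x| <= K + K)%R.
    have /andP[u0 u1] := u01 x.
    rewrite ger0_norm ?mulr_ge0//; apply: le_trans (hK' x).
    by rewrite ler_piMr.
  have mhu : measurable_fun setT (fun x => h' x * u x)%R by exact: measurable_funM.
  have mhu' : measurable_fun setT (fun x => h' x * (1 - u x))%R.
    by apply: measurable_funM => //; exact: measurable_funB.
  have E := uP h' mh' h0.
  rewrite ge0_integral_measure_add// in E; last first.
  - exact/measurable_EFinP.
  - by move=> x _; rewrite lee_fin mulr_ge0//; have /andP[] := u01 x.
  have F : \int[m]_x (h' x)%:E = \int[m]_x (h' x * u x)%:E + \int[m]_x (h' x * (1 - u x))%:E.
    rewrite -ge0_integralD//.
    + by apply: eq_integral => x _; rewrite -EFinD; congr EFin; ring.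
    + by move=> x _; rewrite lee_fin mulr_ge0//; have /andP[] := u01 x.
    + exact/measurable_EFinP.
    + by move=> x _; rewrite lee_fin mulr_ge0// subr_ge0; have /andP[] := u01 x.
    + exact/measurable_EFinP.
  rewrite F in E.
  have fin : \int[m]_x (h' x * u x)%:E \is a fin_num.
    exact: (integrable_fin_num measurableT (bounded_integrable m _ _ mT mhu bd)).
  by rewrite -[LHS](addeK _ fin) [X in X - _]addeC -E [X in X - _]addeC addeK.
have hlo x : (0 <= h x + K)%R by have := hK x; rewrite ler_norml => /andP[? _]; lra.
have hhi x : (h x + K <= K + K)%R by have := hK x; rewrite ler_norml => /andP[_ ?]; lra.
have K0 (x : T) : (0 <= K)%R by exact: le_trans (normr_ge0 _) (hK x).
have mhK : measurable_fun setT (fun x => h x + K)%R by exact: measurable_funD.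
have E1 := pos _ mhK hlo hhi.
have E2 : \int[m]_x (K * (1 - u x))%:E = \int[n]_x (K * u x)%:E.
  by apply: (pos (cst K)) => // x /=; rewrite ?lerDr; exact: K0.
have bdu x (w : R) : (0 <= w <= 1)%R -> (`|h x * w| <= K)%R.
  move=> /andP[w0 w1]; rewrite normrM (ger0_norm w0); apply: le_trans (hK x).
  by rewrite ler_piMr.
have bKu (x : T) (w : R) : (0 <= w <= 1)%R -> (`|K * w| <= K)%R.
  move=> /andP[w0 w1]; have Kx := K0 x.
  by rewrite ger0_norm; [exact: ler_piMr|exact: mulr_ge0].
have u01' x : (0 <= 1 - u x <= 1)%R by have /andP[u0 u1] := u01 x; rewrite subr_ge0 u1 lerBlDr lerDl u0.
have mu' : measurable_fun setT (fun x => 1 - u x)%R by exact: measurable_funB.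
have split_int (p : {measure set T -> \bar R}) (w : T -> R) : p setT < +oo ->
    measurable_fun setT w -> (forall x, (0 <= w x <= 1)%R) ->
    \int[p]_x ((h x + K) * w x)%:E = \int[p]_x (h x * w x)%:E + \int[p]_x (K * w x)%:E
    /\ \int[p]_x (K * w x)%:E \is a fin_num.
  move=> pT mw w01.
  have i1 : p.-integrable setT (EFin \o (fun x => h x * w x)%R).
    apply: (bounded_integrable p _ K) => //; first exact: measurable_funM.
    by move=> x; exact: bdu.
  have i2 : p.-integrable setT (EFin \o (fun x => K * w x)%R).
    apply: (bounded_integrable p _ K) => //; first exact: measurable_funM.
    by move=> x; exact: bKu.
  split; last exact: integrable_fin_num.
  rewrite -integralD//; apply: eq_integral => x _.
  by rewrite /= -EFinD mulrDl.
have [F1 f1] := split_int m _ mT mu' u01'.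
have [F2 f2] := split_int n _ nT mu u01.
rewrite F1 F2 E2 in E1.
by rewrite -[LHS](addeK _ f2) E1 addeK.
Qed.

End Density.

(** * Randomised displacement of a probability *)

Section Mixture.
Context {d : measure_display} {T : measurableType d} {R : realType}.
Variables (F1 F2 : T -> T) (h0 h1 h2 : T -> R).
Hypotheses (mF1 : measurable_fun setT F1) (mF2 : measurable_fun setT F2)
  (mh0 : measurable_fun setT h0) (mh1 : measurable_fun setT h1)
  (mh2 : measurable_fun setT h2)
  (h0_ge0 : forall p, 0 <= h0 p) (h1_ge0 : forall p, 0 <= h1 p)
  (h2_ge0 : forall p, 0 <= h2 p) (hsum : forall p, h0 p + h1 p + h2 p = 1).
Local Open Scope ereal_scope.

(** A transition kernel: stay at [p] with probability [h0 p], jump to [F1 p] with [h1 p] and to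
    [F2 p] with [h2 p]. *)
Definition mix_measure (p : T) : {measure set T -> \bar R} :=
  measure_add (measure_add (mscale (NngNum (h0_ge0 p)) \d_p)
    (mscale (NngNum (h1_ge0 p)) \d_(F1 p))) (mscale (NngNum (h2_ge0 p)) \d_(F2 p)).

Lemma mix_measureE p A : mix_measure p A =
  (h0 p)%:E * \d_p A + (h1 p)%:E * \d_(F1 p) A + (h2 p)%:E * \d_(F2 p) A.
Proof.
have -> : mix_measure p A = measure_add (mscale (NngNum (h0_ge0 p)) \d_p)
    (mscale (NngNum (h1_ge0 p)) \d_(F1 p)) A + mscale (NngNum (h2_ge0 p)) \d_(F2 p) A.
  exact: measure_addE.
by rewrite measure_addE.
Qed.

Definition mix (p : T) : set T -> \bar R := mix_measure p.
HB.instance Definition _ p := Measure.on (mix p).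
Let mix_le1 p : mix p setT <= 1.
Proof.
by rewrite /mix mix_measureE !diracT !mule1 -!EFinD hsum.
Qed.
HB.instance Definition _ p := Measure_isSubProbability.Build d T R (mix p) (mix_le1 p).

Definition gmix (p : T) : giry T R := mix p.

Lemma integral_mix p (c : T -> \bar R) : measurable_fun setT c -> (forall x, 0 <= c x) ->
  \int[gmix p]_x c x = (h0 p)%:E * c p + (h1 p)%:E * c (F1 p) + (h2 p)%:E * c (F2 p).
Proof.
move=> mc c0; rewrite /gmix/= /mix /mix_measure.
by rewrite !ge0_integral_measure_add// !ge0_integral_mscale// !integral_dirac// !diracT !mul1e.
Qed.

Lemma measurable_gmix : measurable_fun setT gmix.
Proof.
apply: measurable_giry_codensity => // B mB.
have -> : gmix ^~ B = (fun p => (h0 p)%:E * \d_p B + (h1 p)%:E * \d_(F1 p) B +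
   (h2 p)%:E * \d_(F2 p) B).
  by apply/funext => p; exact: mix_measureE.
have md : measurable_fun setT (fun p : T => \d_p B : \bar R) by exact: measurable_fun_dirac.
apply: emeasurable_funD; first apply: emeasurable_funD.
- by apply: emeasurable_funM => //; exact/measurable_EFinP.
- apply: emeasurable_funM; first exact/measurable_EFinP.
  exact: (measurableT_comp md mF1).
- apply: emeasurable_funM; first exact/measurable_EFinP.
  exact: (measurableT_comp md mF2).
Qed.

Variable P : probability T R.
Definition mixture : set T -> \bar R := giry_bind (P : giry T R) measurable_gmix.
HB.instance Definition _ := Measure.on mixture.

Lemma integral_mixture (c : T -> \bar R) : measurable_fun setT c -> (forall x, 0 <= c x) ->
  \int[mixture]_x c x =
  \int[P]_p ((h0 p)%:E * c p + (h1 p)%:E * c (F1 p) + (h2 p)%:E * c (F2 p)).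
Proof.
move=> mc c0; have := giry_int_bind (P : giry T R) measurable_gmix mc c0.
rewrite /giry_int => E; apply: etrans E _.
by apply: eq_integral => p _; exact: integral_mix.
Qed.

Let mixture1 : mixture setT = 1.
Proof.
have := @integral_mixture (cst 1) (measurable_cst _) (fun=> lee01).
rewrite integral_cst// mul1e => ->.
rewrite (eq_integral (cst 1)); last by move=> p _; rewrite !mule1 -!EFinD hsum.
by rewrite integral_cst// mul1e; exact: probability_setT.
Qed.
HB.instance Definition _ := Measure_isProbability.Build d T R mixture mixture1.

Lemma mixture_exists : exists Q : probability T R,
  forall c : T -> \bar R, measurable_fun setT c -> (forall x, 0 <= c x) ->
  \int[Q]_x c x =
  \int[P]_p ((h0 p)%:E * c p + (h1 p)%:E * c (F1 p) + (h2 p)%:E * c (F2 p)).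
Proof. by exists mixture; exact: integral_mixture. Qed.

End Mixture.

Section PushRestrict.
Local Open Scope ereal_scope.

Lemma integral_mrestr d (T : measurableType d) (R : realType)
  (mu : {measure set T -> \bar R}) (D : set T) (mD : measurable D) (f : T -> \bar R) :
  measurable_fun setT f -> \int[mrestr mu mD]_x f x = \int[mu]_(x in D) f x.
Proof.
move=> mf.
have ge0 (g : T -> \bar R) : measurable_fun setT g -> (forall x, 0 <= g x) ->
    \int[mrestr mu mD]_x g x = \int[mu]_(x in D) g x.
  move=> mg g0.
  rewrite (@ge0_negligible_integral _ _ _ (mrestr mu mD) setT (~` D))//; last 2 first.
  - exact: measurableC.
  - by rewrite /= /mrestr setICl measure0.
  rewrite setDE setCK setTI; apply: eq_measure_integral => A mA AD.
  by rewrite /= /mrestr setIidl.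
rewrite [LHS]integralE [RHS]integralE; congr (_ - _).
- by apply: ge0 => //; exact: measurable_funepos.
- by apply: ge0 => //; exact: measurable_funeneg.
Qed.

Definition push_restr d1 d2 (T1 : measurableType d1) (T2 : measurableType d2)
  (R : realType) (mu : {measure set T1 -> \bar R}) (D : set T1) (mD : measurable D)
  (phi : T1 -> T2) (mphi : measurable_fun setT phi) : {measure set T2 -> \bar R} :=
  measure_function_pushforward__canonical__measure_function_Measure (mrestr mu mD) mphi.

Lemma push_restrE d1 d2 (T1 : measurableType d1) (T2 : measurableType d2)
  (R : realType) (mu : {measure set T1 -> \bar R}) (D : set T1) (mD : measurable D)
  (phi : T1 -> T2) (mphi : measurable_fun setT phi) A :
  push_restr _ _ _ _ _ mu _ mD _ mphi A = mu (phi @^-1` A `&` D).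
Proof. by []. Qed.

Lemma integral_push_restr d1 d2 (T1 : measurableType d1) (T2 : measurableType d2)
  (R : realType) (mu : {measure set T1 -> \bar R}) (D : set T1) (mD : measurable D)
  (phi : T1 -> T2) (mphi : measurable_fun setT phi) (f : T2 -> \bar R) :
  measurable_fun setT f ->
  \int[push_restr _ _ _ _ _ mu _ mD _ mphi]_x f x = \int[mu]_(x in D) f (phi x).
Proof.
move=> mf; have mfp : measurable_fun setT (f \o phi) by exact: measurableT_comp.
rewrite -(integral_mrestr _ _ _ mu D mD (f \o phi))//.
have ge0 (g : T2 -> \bar R) : measurable_fun setT g -> (forall x, 0 <= g x) ->
    \int[push_restr _ _ _ _ _ mu _ mD _ mphi]_x g x = \int[mrestr mu mD]_x g (phi x).
  move=> mg g0; rewrite (ge0_integral_pushforward mphi (mrestr mu mD))//.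
rewrite [LHS]integralE [RHS]integralE; congr (_ - _).
- by apply: etrans (ge0 f^\+ (measurable_funepos mf) (funepos_ge0 f)) _;
    apply: eq_integral => x _; rewrite funepos.unlock.
- by apply: etrans (ge0 f^\- (measurable_funeneg mf) (funeneg_ge0 f)) _;
    apply: eq_integral => x _; rewrite funeneg.unlock.
Qed.

End PushRestrict.

(** * The exchange, and singularity of the two laws by optimality *)

Section Swap.
Context {d1 d2 : measure_display} {T1 : measurableType d1} {T2 : measurableType d2}
  {R : realType}.
Variable P : probability (T1 * T2)%type R.
Variables (f g : T1 -> T1) (E E' : set (T1 * T2)).
Hypotheses (mf : measurable_fun setT f) (mg : measurable_fun setT g)
  (fK : cancel f g) (gK : cancel g f) (mE : measurable E) (mE' : measurable E').

(** [fractional_swap] is applied to the law of the source on [E] and the law of its image by [g] on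
    [E']. *)
Lemma exchange_density : exists u : T1 -> R,
  [/\ measurable_fun setT u, (forall x, 0 <= u x <= 1) &
   forall (h : T1 -> R) (K : R), measurable_fun setT h -> (forall x, `|h x| <= K) ->
   (\int[P]_(p in E) (h p.1 * (1 - u p.1))%:E =
    \int[P]_(p in E') (h (g p.1) * u (g p.1))%:E)%E].
Proof.
have mgf : measurable_fun setT (fun p : T1 * T2 => g p.1).
  by apply: (measurableT_comp mg); exact: measurable_fst.
pose m := push_restr _ _ _ _ _ P _ mE _ (@measurable_fst _ _ T1 T2).
pose n := push_restr _ _ _ _ _ P _ mE' _ mgf.
have mfin : (m setT < +oo)%E.
  apply: (@le_lt_trans _ _ (P setT)); last by rewrite probability_setT ltry.
  by rewrite push_restrE le_measure ?inE//= setTI.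
have nfin : (n setT < +oo)%E.
  apply: (@le_lt_trans _ _ (P setT)); last by rewrite probability_setT ltry.
  by rewrite push_restrE le_measure ?inE//= setTI.
have [u [mu u01 uP]] := fractional_swap m n mfin nfin.
exists u; split=> // h K mh hK.
have := uP h K mh hK; rewrite !integral_push_restr//.
  by apply/measurable_EFinP; exact: measurable_funM.
by apply/measurable_EFinP; apply: measurable_funM => //; exact: measurable_funB.
Qed.

Lemma integral_indicM (D : set (T1 * T2)) (phi : T1 * T2 -> R) :
  (\int[P]_p (\1_D p * phi p)%:E = \int[P]_(p in D) (phi p)%:E)%E.
Proof.
rewrite [RHS]integral_mkcond; apply: eq_integral => p _.
rewrite patchE indicE; case: ifPn => pD; first by rewrite mul1r.
by rewrite mul0r.
Qed.

(** The mass taken from [E] by [f] refills what [g] takes from [E'], and conversely, because the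
    fraction [1 - u] of the one law equals the fraction [u] of the other. The factor 1/2 keeps
    [h1 + h2 <= 1] where [E] and [E'] overlap. *)
Lemma exchange_weights : exists (u : T1 -> R) (h1 h2 : T1 * T2 -> R),
  [/\ measurable_fun setT u, (forall x, 0 <= u x <= 1),
      (forall p, h1 p = 2^-1 * (\1_E p * (1 - u p.1))),
      (forall p, h2 p = 2^-1 * (\1_E' p * u (g p.1))) &
      (forall (k1 k2 : T1 -> R) (K : R), measurable_fun setT k1 -> measurable_fun setT k2 ->
         (forall x, `|k1 x| <= K) -> (forall x, `|k2 x| <= K) ->
         (\int[P]_p (h1 p * k1 p.1 + h2 p * k2 p.1)%:E =
         2^-1%:E * \int[P]_(p in E) ((k1 p.1 + k2 (f p.1)) * (1 - u p.1))%:E)%E)] /\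
  (P (E' `&` [set p | u (g p.1) = 1%R]) = 0)%E.
Proof.
have [u [mu u01 uP]] := exchange_density.
have m1 : measurable_fun setT (fun p : T1 * T2 => p.1) by exact: measurable_fst.
have mu1 : measurable_fun setT (fun p : T1 * T2 => 1 - u p.1).
  by apply: measurable_funB => //; exact: measurableT_comp.
have mgp : measurable_fun setT (fun p : T1 * T2 => g p.1) by exact: measurableT_comp.
have mfp : measurable_fun setT (fun p : T1 * T2 => f p.1) by exact: measurableT_comp.
have mu2 : measurable_fun setT (fun p : T1 * T2 => u (g p.1)) by exact: measurableT_comp.
have u01' x : 0 <= 1 - u x <= 1.
  by have /andP[u0 u1] := u01 x; rewrite subr_ge0 u1 lerBlDr lerDl u0.
have mI : measurable_fun setT (\1_E : T1 * T2 -> R) by exact: measurable_indic.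
have mI' : measurable_fun setT (\1_E' : T1 * T2 -> R) by exact: measurable_indic.
have PT : (P setT < +oo)%E by rewrite probability_setT ltry.
exists u, (fun p => 2^-1 * (\1_E p * (1 - u p.1))), (fun p => 2^-1 * (\1_E' p * u (g p.1))).
split.
- split=> // k1 k2 K mk1 mk2 k1K k2K.
  have mk1p : measurable_fun setT (fun p : T1 * T2 => k1 p.1) by exact: measurableT_comp.
  have mk2p : measurable_fun setT (fun p : T1 * T2 => k2 p.1) by exact: measurableT_comp.
  have mk2f : measurable_fun setT (fun x => k2 (f x)) by exact: measurableT_comp.
  have mk2fp : measurable_fun setT (fun p : T1 * T2 => k2 (f p.1)) by exact: measurableT_comp.
  have bnd (a : T1 * T2 -> R) (w : T1 * T2 -> R) : (forall p, `|a p| <= K) ->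
     (forall p, 0 <= w p <= 1) -> forall p, `|a p * w p| <= K.
    move=> aK w01 p; have /andP[w0 w1] := w01 p.
    by rewrite normrM (ger0_norm w0); apply: le_trans (aK p); rewrite ler_piMr.
  have bndI (D : set (T1 * T2)) (a : T1 * T2 -> R) : (forall p, `|a p| <= K) -> forall p, `|\1_D p * a p| <= K.
    move=> aK p; rewrite normrM indicE; case: (p \in D); rewrite ?normr1 ?mul1r//.
    by rewrite normr0 mul0r (le_trans _ (aK p)).
  have i1 : P.-integrable setT (EFin \o (fun p => \1_E p * (k1 p.1 * (1 - u p.1)))%R).
    apply: (bounded_integrable P _ K) => //.
      by apply: measurable_funM => //; exact: measurable_funM.
    by apply: bndI; apply: bnd => p; [exact: k1K|exact: u01'].
  have i2 : P.-integrable setT (EFin \o (fun p => \1_E' p * (k2 p.1 * u (g p.1)))%R).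
    apply: (bounded_integrable P _ K) => //.
      by apply: measurable_funM => //; exact: measurable_funM.
    by apply: bndI; apply: bnd => p; [exact: k2K|exact: u01].
  have i3 : P.-integrable setT (EFin \o (fun p => \1_E p * (k2 (f p.1) * (1 - u p.1)))%R).
    apply: (bounded_integrable P _ K) => //.
      by apply: measurable_funM => //; exact: measurable_funM.
    by apply: bndI; apply: bnd => p; [exact: k2K|exact: u01'].
  have key : (\int[P]_p (\1_E' p * (k2 p.1 * u (g p.1)))%:E =
              \int[P]_p (\1_E p * (k2 (f p.1) * (1 - u p.1)))%:E)%E.
    rewrite !integral_indicM (uP (fun x => k2 (f x)) K mk2f (fun x => k2K (f x))).
    by apply: eq_integral => p _; rewrite gK.
  rewrite -(integral_indicM E).
  rewrite [RHS](_ : _ = 2^-1%:E * (\int[P]_p ((\1_E p * (k1 p.1 * (1 - u p.1)))%:E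
       + (\1_E p * (k2 (f p.1) * (1 - u p.1)))%:E)))%E; last first.
    by congr (_ * _)%E; apply: eq_integral => p _; rewrite -EFinD -mulrDr -mulrDl.
  have i12 := integrableD measurableT i1 i2.
  rewrite integralD// -key -integralD// -(integralZl measurableT i12).
  by apply: eq_integral => p _; rewrite -EFinD -EFinM; congr EFin; ring.
(* Tested on the indicator of [u = 1], the left side of the exchange identity vanishes, so [E']
   gives no mass to [u (g p.1) = 1]. *)
- pose B := [set x | u x = 1].
  have mB : measurable B.
    by rewrite -[B]setTI; exact: (mu measurableT [set 1%R]).
  have mIB : measurable_fun setT (\1_B : T1 -> R) by exact: measurable_indic.
  have IB x : `|\1_B x| <= 1 :> R.
    by rewrite indicE; case: (x \in B); rewrite ?normr1 ?normr0 ?ler01.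
  have := uP _ 1 mIB IB.
  rewrite (_ : \int[P]_(p in E) _ = 0)%E; last first.
    apply: integral0_eq => p _; rewrite indicE; case: (boolP (p.1 \in B)) => pB.
      by move: pB; rewrite inE /B/= => ->; rewrite subrr mulr0.
    by rewrite mul0r.
  rewrite -(integral_indicM E') => E0.
  have mE'B : measurable [set p : T1 * T2 | u (g p.1) = 1].
    by rewrite -[X in measurable X]setTI; exact: (mu2 measurableT [set 1%R]).
  have mEB := measurableI _ _ mE' mE'B.
  rewrite -[X in P X]setIT -integral_indic//.
  apply: etrans (esym E0); apply: eq_integral => p _; congr EFin.
  rewrite !indicE in_setI; case: (p \in E') => /=; last by rewrite mul0r.
  have -> : (p \in [set p : T1 * T2 | u (g p.1) = 1]) = (g p.1 \in B).
    by apply/idP/idP; rewrite !inE.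
  rewrite mul1r; case: (boolP (g p.1 \in B)) => [|_]; last by rewrite mul0r.
  by rewrite inE /B/= => ->; rewrite mulr1.
Qed.

Variable c : T1 * T2 -> \bar R.
Hypotheses (mc : measurable_fun setT c) (c0 : forall p, (0 <= c p)%E)
  (cfin : (\int[P]_p c p < +oo)%E).
Variables (D1 D2 : T1 -> R) (K : R).
Hypotheses (mD1 : measurable_fun setT D1) (mD2 : measurable_fun setT D2)
  (D1K : forall x, `|D1 x| <= K) (D2K : forall x, `|D2 x| <= K).
Hypotheses
  (gainE : forall p, E p -> (c (f p.1, p.2) <= c p + (D1 p.1)%:E)%E)
  (gainE' : forall p, E' p -> (c (g p.1, p.2) <= c p + (D2 p.1)%:E)%E)
  (gain : forall p, E p -> D1 p.1 + D2 (f p.1) < 0)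
  (Pmin : forall Q : probability (T1 * T2)%type R,
    (forall A, measurable A -> Q (fst @^-1` A) = P (fst @^-1` A)) ->
    (forall B, measurable B -> Q (snd @^-1` B) = P (snd @^-1` B)) ->
    (\int[P]_p c p <= \int[Q]_p c p)%E).

(* [D1] and [D2] bound the cost increments of moving the source by [f] on [E] and by [g] on
   [E']; the mixture moving [E] with weight [h1] and [E'] with weight [h2] keeps both
   marginals, and [gain] makes it strictly cheaper unless the laws are singular. *)
Lemma swap_singular : exists Z : set T1, [/\ measurable Z,
  P (E `&` [set p | Z p.1]) = 0%E & P (E' `&` [set p | ~ Z (g p.1)]) = 0%E].
Proof.
have [u [h1 [h2 [[mu u01 h1E h2E hP] PE']]]] := exchange_weights.
have m1 : measurable_fun setT (fun p : T1 * T2 => p.1) by exact: measurable_fst.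
have m2 : measurable_fun setT (fun p : T1 * T2 => p.2) by exact: measurable_snd.
have mgp : measurable_fun setT (fun p : T1 * T2 => g p.1) by exact: measurableT_comp.
have mfp : measurable_fun setT (fun p : T1 * T2 => f p.1) by exact: measurableT_comp.
have PT : (P setT < +oo)%E by rewrite probability_setT ltry.
have half1 : 2^-1 + 2^-1 = 1 :> R by field.
have half0 : 0 <= 2^-1 :> R by [].
have I01 (D : set (T1 * T2)) p : 0 <= (\1_D p : R) <= 1.
  by rewrite indicE; case: (p \in D); rewrite ?lexx ler01.
have u01' x : 0 <= 1 - u x <= 1.
  by have /andP[u0 u1] := u01 x; rewrite subr_ge0 u1 lerBlDr lerDl u0.
have prod01 (a b : R) : 0 <= a <= 1 -> 0 <= b <= 1 -> 0 <= 2^-1 * (a * b) <= 2^-1.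
  move=> /andP[a0 a1] /andP[b0 b1].
  by rewrite mulr_ge0 ?mulr_ge0//= ler_piMr// mulr_ile1.
have h1b p : 0 <= h1 p <= 2^-1 by rewrite h1E; exact: prod01.
have h2b p : 0 <= h2 p <= 2^-1 by rewrite h2E; exact: prod01.
have mh1 : measurable_fun setT h1.
  rewrite (_ : h1 = fun p => 2^-1 * (\1_E p * (1 - u p.1))); last exact/funext.
  apply: measurable_funM => //; apply: measurable_funM; first exact: measurable_indic.
  by apply: measurable_funB => //; exact: measurableT_comp.
have mh2 : measurable_fun setT h2.
  rewrite (_ : h2 = fun p => 2^-1 * (\1_E' p * u (g p.1))); last exact/funext.
  apply: measurable_funM => //; apply: measurable_funM; first exact: measurable_indic.
  exact: measurableT_comp.
pose h0 p := 1 - h1 p - h2 p.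
have h0_ge0 p : 0 <= h0 p.
  have /andP[_ a] := h1b p; have /andP[_ b] := h2b p.
  by rewrite /h0 -addrA -opprD subr_ge0 -half1 lerD.
have h1_ge0 p : 0 <= h1 p by have /andP[] := h1b p.
have h2_ge0 p : 0 <= h2 p by have /andP[] := h2b p.
have hsum p : h0 p + h1 p + h2 p = 1 by rewrite /h0; ring.
have mh0 : measurable_fun setT h0.
  by apply: measurable_funB => //; exact: measurable_funB.
pose F1 (p : T1 * T2) := (f p.1, p.2).
pose F2 (p : T1 * T2) := (g p.1, p.2).
have mF1 : measurable_fun setT F1 by exact: measurable_fun_pair.
have mF2 : measurable_fun setT F2 by exact: measurable_fun_pair.
have [Q QP] := mixture_exists F1 F2 h0 h1 h2 mF1 mF2 mh0 mh1 mh2 h0_ge0 h1_ge0 h2_ge0 hsum P.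
have hb1 p : `|h1 p| <= 1.
  by have /andP[a b] := h1b p; rewrite ger0_norm// (le_trans b)// invf_le1// ler1n.
have hb2 p : `|h2 p| <= 1.
  by have /andP[a b] := h2b p; rewrite ger0_norm// (le_trans b)// invf_le1// ler1n.
have Wint (k1 k2 : T1 -> R) (L : R) : measurable_fun setT k1 -> measurable_fun setT k2 ->
    (forall x, `|k1 x| <= L) -> (forall x, `|k2 x| <= L) ->
    P.-integrable setT (EFin \o (fun p => h1 p * k1 p.1 + h2 p * k2 p.1)).
  move=> mk1 mk2 k1L k2L; apply: (bounded_integrable P _ (L + L)) => //.
    by apply: measurable_funD; apply: measurable_funM => //; exact: measurableT_comp.
  move=> p; apply: le_trans (ler_normD _ _) _; rewrite !normrM.
  apply: lerD; [apply: le_trans (k1L p.1)|apply: le_trans (k2L p.1)].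
    by rewrite ler_piMl.
  by rewrite ler_piMl.
have Q1 A : measurable A -> Q (fst @^-1` A) = P (fst @^-1` A).
  move=> mA.
  have mA' : measurable (fst @^-1` A : set (T1 * T2)).
    by rewrite -[X in measurable X]setTI; exact: (measurable_fst measurableT).
  rewrite -[X in Q X]setIT -[X in P X]setIT -!integral_indic//.
  rewrite (QP (fun p => (\1_(fst @^-1` A) p)%:E)); last 2 first.
  - by apply/measurable_EFinP; exact: measurable_indic.
  - by move=> p; rewrite lee_fin; have /andP[] := I01 (fst @^-1` A) p.
  (* The changes of the indicator of [A] under the two moves; they cancel since
     [k1 x + k2 (f x) = 0]. *)
  pose k1 x : R := \1_A (f x) - \1_A x.
  pose k2 x : R := \1_A (g x) - \1_A x.
  have mIA : measurable_fun setT (\1_A : T1 -> R) by exact: measurable_indic.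
  have mk1 : measurable_fun setT k1 by apply: measurable_funB => //; exact: measurableT_comp.
  have mk2 : measurable_fun setT k2 by apply: measurable_funB => //; exact: measurableT_comp.
  have kb x y : `|\1_A x - \1_A y| <= 1 :> R.
    rewrite !indicE; case: (x \in A); case: (y \in A);
    by rewrite ?subrr ?normr0 ?subr0 ?sub0r ?normrN ?normr1 ?ler01.
  have := hP k1 k2 1 mk1 mk2 (fun x => kb _ _) (fun x => kb _ _).
  rewrite [X in _ = (_ * X)%E](_ : _ = 0)%E ?mule0; last first.
    apply: integral0_eq => p _; congr EFin.
    by rewrite /k1 /k2 fK subrKA subrr mul0r.
  move=> W0; rewrite -[RHS]adde0 -W0 -integralD//; last 2 first.
  - apply: (bounded_integrable P (\1_(fst @^-1` A)) 1) => //.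
    by move=> p; have /andP[a b] := I01 (fst @^-1` A) p; rewrite ger0_norm.
  - exact: (Wint k1 k2 1 mk1 mk2 (fun x => kb _ _) (fun x => kb _ _)).
  apply: eq_integral => p _; rewrite -!EFinM -!EFinD; congr EFin.
  have pre (q : T1 * T2) : (q \in fst @^-1` A) = (q.1 \in A) by apply/idP/idP; rewrite !inE.
  rewrite /k1 /k2 /F1 /F2 /h0 !indicE !pre/=; ring.
have Q2 B : measurable B -> Q (snd @^-1` B) = P (snd @^-1` B).
  move=> mB.
  have mB' : measurable (snd @^-1` B : set (T1 * T2)).
    by rewrite -[X in measurable X]setTI; exact: (measurable_snd measurableT).
  rewrite -[X in Q X]setIT -[X in P X]setIT -!integral_indic//.
  rewrite (QP (fun p => (\1_(snd @^-1` B) p)%:E)); last 2 first.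
  - by apply/measurable_EFinP; exact: measurable_indic.
  - by move=> p; rewrite lee_fin; have /andP[] := I01 (snd @^-1` B) p.
  apply: eq_integral => p _; rewrite -!EFinM -!EFinD; congr EFin.
  have pre (q : T1 * T2) : (q \in snd @^-1` B) = (q.2 \in B) by apply/idP/idP; rewrite !inE.
  rewrite /F1 /F2 /h0 !indicE !pre/=; ring.
pose w p := h1 p * D1 p.1 + h2 p * D2 p.1.
have iw : P.-integrable setT (EFin \o w) by exact: (Wint D1 D2 K mD1 mD2 D1K D2K).
have ic : P.-integrable setT c.
  apply/integrableP; split=> //.
  by rewrite (eq_integral c)// => p _; rewrite gee0_abs.
have step p : ((h0 p)%:E * c p + (h1 p)%:E * c (F1 p) + (h2 p)%:E * c (F2 p)
     <= c p + (w p)%:E)%E.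
  have := c0 p; case E0 : (c p) => [r| |] // r0; last by rewrite addye// leey.
  have s1 : ((h1 p)%:E * c (F1 p) <= (h1 p * (r + D1 p.1))%:E)%E.
    have [Ep|Ep] := pselect (E p).
      by rewrite EFinM lee_wpmul2l ?lee_fin// (le_trans (gainE p Ep))// E0.
    by rewrite h1E indicE memNset//= mul0r mulr0 mul0e mul0r.
  have s2 : ((h2 p)%:E * c (F2 p) <= (h2 p * (r + D2 p.1))%:E)%E.
    have [Ep|Ep] := pselect (E' p).
      by rewrite EFinM lee_wpmul2l ?lee_fin// (le_trans (gainE' p Ep))// E0.
    by rewrite h2E indicE memNset//= mul0r mulr0 mul0e mul0r.
  apply: (@le_trans _ _ ((h0 p * r)%:E + (h1 p * (r + D1 p.1))%:E + (h2 p * (r + D2 p.1))%:E)%E).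
    by apply: leeD => //; apply: leeD.
  by rewrite -!EFinD lee_fin /w /h0 le_eqVlt; apply/orP; left; apply/eqP; ring.
(* Optimality makes the mean gain nonnegative, whereas the exchange identity writes it as half the
   integral over [E] of a nonpositive function, which is therefore null almost everywhere on [E]. *)
have W0 : (0 <= \int[P]_p (w p)%:E)%E.
  have := Pmin Q Q1 Q2; rewrite (QP c mc c0) => le1.
  have le2 : (\int[P]_p ((h0 p)%:E * c p + (h1 p)%:E * c (F1 p) + (h2 p)%:E * c (F2 p))
    <= \int[P]_p (c p + (w p)%:E))%E.
    apply: ge0_le_integral => //.
    - move=> p _; apply: adde_ge0; first apply: adde_ge0;
      by apply: mule_ge0; rewrite ?lee_fin.
    - apply: emeasurable_funD; first apply: emeasurable_funD.
      + by apply: emeasurable_funM => //; exact/measurable_EFinP.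
      + by apply: emeasurable_funM; [exact/measurable_EFinP|exact: measurableT_comp].
      + by apply: emeasurable_funM; [exact/measurable_EFinP|exact: measurableT_comp].
    - by apply: emeasurable_funD => //; exact: (measurable_int P).
  have := le_trans le1 le2; rewrite integralD//.
  have cf : (\int[P]_p c p)%E \is a fin_num by exact: integrable_fin_num.
  by rewrite -[X in (X <= _)%E]adde0 leeD2lE.
have Dfp : measurable_fun setT (fun p : T1 * T2 => (D1 p.1 + D2 (f p.1)) * (1 - u p.1)).
  apply: measurable_funM; last by apply: measurable_funB => //; exact: measurableT_comp.
  by apply: measurable_funD; exact: measurableT_comp.
pose s (p : T1 * T2) := (D1 p.1 + D2 (f p.1)) * (1 - u p.1).
have s0 p : E p -> s p <= 0.
  move=> Ep; apply: mulr_le0_ge0; first exact: ltW (gain p Ep).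
  by have /andP[] := u01' p.1.
have sE : (\int[P]_(p in E) `|(s p)%:E| = 0)%E.
  apply/eqP; rewrite eq_le integral_ge0 ?andbT//.
  rewrite (eq_integral (fun p => - (s p)%:E)%E); last first.
    by move=> p; rewrite inE => Ep; rewrite lee0_abs// lee_fin s0.
  have is' : P.-integrable E (EFin \o s).
    apply: (integrableS measurableT) => //.
    apply: (bounded_integrable P s (K + K)) => // p.
    rewrite /s normrM; have /andP[a b] := u01' p.1; rewrite (ger0_norm a).
    apply: (@le_trans _ _ `|D1 p.1 + D2 (f p.1)|); first by rewrite ler_piMr.
    by apply: le_trans (ler_normD _ _) _; apply: lerD.
  rewrite integralN; last first.
    by apply: fin_num_adde_defr; exact: (integrable_fin_num _ (integrable_funepos _ is')).
  rewrite leeNl oppe0.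
  have := W0; rewrite /w (hP D1 D2 K)//.
  by rewrite pmule_rge0// lte_fin.
have /(ae_eq_integral_abs P mE _)[|N [mN PN subN]] := sE.
  by apply/measurable_EFinP; apply: measurable_funTS.
(* Almost everywhere on [E] the product [s] is 0, and its first factor is negative by [gain], so
   [u = 1] there. On [E'] the event [u (g p.1) = 1] is null by [PE']. *)
exists [set x | u x < 1]; split.
- rewrite -[X in measurable X]setTI.
  rewrite (_ : [set x | u x < 1] = u @^-1` `]-oo, 1[); first exact: mu.
  by apply/seteqP; split=> x /=; rewrite in_itv.
- have mZ : measurable [set p : T1 * T2 | u p.1 < 1].
    rewrite -[X in measurable X]setTI.
    rewrite (_ : [set p : T1 * T2 | u p.1 < 1] = (fun p => u p.1) @^-1` `]-oo, 1[).
      by apply: measurableT_comp.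
    by apply/seteqP; split=> x /=; rewrite in_itv.
  apply/eqP; rewrite eq_le measure_ge0 andbT -PN; apply: le_measure; rewrite ?inE//.
    exact: measurableI.
  move=> p [Ep /= up]; apply: subN => /= /(_ Ep)[] /eqP.
  rewrite mulf_eq0 subr_eq0 => /orP[/eqP h|/eqP h].
    by have := gain p Ep; rewrite h ltxx.
  by move: up; rewrite -h ltxx.
- rewrite (_ : _ `&` _ = E' `&` [set p | u (g p.1) = 1])//.
  apply/seteqP; split=> p [Ep /= h]; split=> //=; last by rewrite h ltxx.
  move/negP: h; rewrite -leNgt => h; apply/eqP; rewrite eq_le h andbT.
  by have /andP[] := u01 (g p.1).
Qed.

End Swap.

(** * From translated laws to singularity *)

Section FlowSingular.
Context {d : measure_display} {T : measurableType d} {R : realType}.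
Local Open Scope ereal_scope.

Lemma real_uncountable : ~ countable [set: R].
Proof.
move=> /countable_lebesgue_measure0 h0.
have : lebesgue_measure `[0%R, 1%R]%classic <= lebesgue_measure [set: R].
  by apply: le_measure; rewrite ?inE.
by rewrite h0 lebesgue_measure_itv/= lte_fin ltr01 oppr0 adde0 lee_fin leNgt ltr01.
Qed.

Lemma measure_ae_disjoint (m : {measure set T -> \bar R}) (I : eqType) (A : I -> set T)
    (s : seq I) :
  m setT < +oo -> uniq s -> (forall i, measurable (A i)) ->
  (forall i j, i != j -> m (A i `&` A j) = 0) ->
  \sum_(i <- s) m (A i) <= m setT.
Proof.
move=> mT us mA dis.
have mB (r : seq I) : measurable (\big[setU/set0]_(i <- r) A i) by exact: bigsetU_measurable.
suff -> : \sum_(i <- s) m (A i) = m (\big[setU/set0]_(i <- s) A i).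
  by apply: le_measure; rewrite ?inE.
elim: s us => [|i s IH] /=; first by rewrite !big_nil measure0.
move=> /andP[si us]; rewrite !big_cons IH//.
have I0 : m (A i `&` \big[setU/set0]_(i <- s) A i) = 0.
  rewrite big_distrr/=; apply/eqP; rewrite eq_le measure_ge0 andbT.
  elim: s si {us IH} => [|j s IH]; first by rewrite big_nil measure0.
  rewrite inE negb_or => /andP[ij si]; rewrite big_cons.
  have mC : measurable (\big[setU/set0]_(j <- s) (A i `&` A j)).
    by apply: bigsetU_measurable => l _; exact: measurableI.
  by rewrite setUC measureU0 ?IH//; [exact: measurableI|exact: dis].
rewrite measureUfinr//; first by rewrite I0 sube0.
by apply: le_lt_trans mT; apply: le_measure; rewrite ?inE.
Qed.

(* Otherwise some threshold [1 / n] is exceeded by infinitely many almost disjoint sets. *)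
Lemma uncountable_overlap (m : {measure set T -> \bar R}) (A : R -> set T) :
  m setT < +oo -> (forall t, measurable (A t)) -> (forall t, 0 < m (A t)) ->
  exists s t, (s < t)%R /\ 0 < m (A s `&` A t).
Proof.
move=> mT mA A0; apply: contrapT => H.
have dis s t : s != t -> m (A s `&` A t) = 0.
  move=> st; apply/eqP; rewrite eq_le measure_ge0 andbT leNgt; apply/negP => h.
  apply: H; have [lt|lt|E] := ltgtP s t; last by rewrite E eqxx in st.
    by exists s, t.
  by exists t, s; rewrite setIC.
apply: real_uncountable.
pose D n := [set t | (n.+1%:R^-1)%:E <= m (A t)].
have -> : [set: R] = \bigcup_n D n.
  apply/esym/seteqP; split=> // t _.
  have := A0 t; have fin : m (A t) \is a fin_num.
    rewrite ge0_fin_numE//; apply: le_lt_trans mT.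
    by apply: le_measure; rewrite ?inE.
  rewrite -(fineK fin) lte_fin => ft.
  exists (Num.trunc (fine (m (A t)))^-1) => //=.
  rewrite /D/= -[leRHS](fineK fin) lee_fin -[leRHS]invrK lef_pV2 ?posrE ?invr_gt0//.
  by rewrite ltW// truncnS_gt.
apply: bigcup_countable => // n _; apply: finite_set_countable.
apply: contrapT => inf.
have fT : m setT \is a fin_num by rewrite ge0_fin_numE.
(* More than [(n+1)] times the total mass of almost disjoint sets, each of measure at least
   [1/(n+1)], cannot fit. *)
have [B BD Bsz] := infinite_set_fset (Num.trunc (fine (m setT) * n.+1%:R)).+1 inf.
have := measure_ae_disjoint m R A (finmap.enum_fset B) mT (finmap.fset_uniq B) mA dis.
rewrite leNgt => /negP; apply.
apply: (@lt_le_trans _ _ (\sum_(i <- finmap.enum_fset B) (n.+1%:R^-1)%:E)); last first.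
  rewrite big_seq [leRHS]big_seq; apply: lee_sum => t tB; exact: (BD t).
rewrite sumEFin -(fineK fT) lte_fin big_const_seq count_predT iter_addr addr0.
rewrite -[ltRHS]mulr_natr mulrC ltr_pdivlMr//.
apply: lt_le_trans (truncnS_gt _) _; rewrite ler_nat//.
Qed.

(** [S] is the set where the density of [m] with respect to [p] is positive. A part of [S] that is
    null for [m] carries a positive function of zero integral, hence is null for [p]. *)
Lemma ac_support (m p : {measure set T -> \bar R}) : m setT < +oo -> p setT < +oo ->
  (forall A, measurable A -> m A <= p A) ->
  exists S, [/\ measurable S, m (~` S) = 0 &
    forall B, measurable B -> B `<=` S -> m B = 0 -> p B = 0].
Proof.
move=> mT pT mp.
pose m' : {finite_measure set T -> \bar R} := fin_measure m mT.
pose p' : {finite_measure set T -> \bar R} := fin_measure p pT.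
have ac : m' `<< p'.
  apply/null_content_dominatesP => A mA /= pA.
  by apply/eqP; rewrite eq_le measure_ge0 andbT -[leRHS]pA; exact: mp.
pose f := Radon_Nikodym_SigmaFinite.f m' p'.
have f0 x : 0 <= f x by exact: Radon_Nikodym_SigmaFinite.f_ge0.
have intf : p.-integrable setT f := Radon_Nikodym_SigmaFinite.f_integrable ac.
have mf : measurable_fun setT f := measurable_int _ intf.
pose S := [set x | 0 < f x].
have mS : measurable S by rewrite -[S]setTI; exact: emeasurable_fun_o_infty.
have fE A : measurable A -> m A = \int[p]_(x in A) f x.
  by move=> mA; exact: (Radon_Nikodym_SigmaFinite.f_integral ac mA).
exists S; split=> //.
  rewrite fE; last exact: measurableC.
  apply: integral0_eq => x /negP; rewrite -leNgt => h.
  by apply/eqP; rewrite eq_le h f0.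
move=> B mB BS mB0.
have : \int[p]_(x in B) `|f x| = 0.
  by rewrite -mB0 fE//; apply: eq_integral => x _; rewrite gee0_abs.
move=> /(ae_eq_integral_abs p mB (measurable_funTS mf))[N [mN pN sub]].
apply/eqP; rewrite eq_le measure_ge0 andbT -pN; apply: le_measure; rewrite ?inE//.
by move=> x Bx; apply: sub => /= /(_ Bx) fx; have := BS x Bx; rewrite /S/= fx ltxx.
Qed.

Lemma flow_singular (mu m n : {measure set T -> \bar R}) (Phi : R -> T -> T) :
  mu setT < +oo -> (forall t, measurable_fun setT (Phi t)) ->
  (forall s t x, Phi s (Phi t x) = Phi (s + t)%R x) -> (forall x, Phi 0%R x = x) ->
  (forall t A, measurable A -> mu A = 0 <-> mu (Phi t @^-1` A) = 0) ->
  (forall A, measurable A -> m A <= mu A) -> (forall A, measurable A -> n A <= mu A) ->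
  (forall s, (0 < s)%R -> exists Z, [/\ measurable Z, m Z = 0 & n (Phi (- s)%R @^-1` (~` Z)) = 0]) ->
  exists Z, [/\ measurable Z, m Z = 0 & n (~` Z) = 0].
Proof.
move=> muT mPhi PhiD Phi0 qi mmu nmu H.
have mT : m setT < +oo by apply: le_lt_trans muT; exact: mmu.
have nT : n setT < +oo by apply: le_lt_trans muT; exact: nmu.
have [S [mS mS0 SP]] := ac_support m mu mT muT mmu.
have [S' [mS' nS0 SP']] := ac_support n mu nT muT nmu.
pose A := S `&` S'.
have mA : measurable A by exact: measurableI.
have mpre t B : measurable B -> measurable (Phi t @^-1` B).
  by move=> mB; rewrite -[X in measurable X]setTI; exact: mPhi.
have null (p : {measure set T -> \bar R}) B C : measurable B -> measurable C ->
    B `<=` C -> p C = 0 -> p B = 0.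
  move=> mB mC BC pC; apply/eqP; rewrite eq_le measure_ge0 andbT -[leRHS]pC.
  by apply: le_measure; rewrite ?inE.
have muA : mu A = 0.
  apply/eqP; apply: contrapT => /negP A0.
  have Apos t : 0 < mu (Phi t @^-1` A).
    rewrite lt0e measure_ge0 andbT; apply/eqP => h.
    by move/eqP: A0; apply; apply/(qi t A mA).
  have [s [t [st Bpos]]] := uncountable_overlap mu (fun t => Phi t @^-1` A) muT (fun t => mpre t A mA) Apos.
  pose r := (t - s)%R.
  have r0 : (0 < r)%R by rewrite subr_gt0.
  have [Z [mZ mZ0 nZ0]] := H r r0.
  (* Both [A] and its translate charge [B]. The part of [B] in [Z] is null for [m], hence for [mu]
     on [S]. The part outside [Z], pulled back by [Phi (- r)], lies in [S'] and is null for [n],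
     hence for [mu]; quasi-invariance brings this back to [B]. *)
  pose B := A `&` Phi r @^-1` A.
  have mB : measurable B by apply: measurableI => //; exact: mpre.
  have : mu B <> 0.
    move=> /(qi s B mB) h; move: Bpos; rewrite (_ : _ `&` _ = Phi s @^-1` B) ?h ?ltxx//.
    apply/seteqP; split=> x [h1 h2]; split=> //; move: h2; by rewrite /= PhiD /r subrK.
  apply.
  have B1 : mu (B `&` Z) = 0.
    apply: SP; first exact: measurableI.
      by move=> x [[[]]].
    by apply: null mZ0 => //; exact: measurableI.
  have B2 : mu (B `&` ~` Z) = 0.
    have mBZ : measurable (B `&` ~` Z) by apply: measurableI => //; exact: measurableC.
    apply/(qi (- r)%R _ mBZ); apply: SP'; first exact: mpre.
      by move=> x [[_ h] _]; move: h; rewrite /= PhiD subrr Phi0 => -[].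
    apply: null nZ0; [exact: mpre|by apply: mpre; exact: measurableC|].
    by move=> x [].
  have -> : mu B = mu (B `&` ~` Z) + mu (B `&` Z) by rewrite -setDE; exact: measureDI.
  by rewrite B1 B2 adde0.
exists (~` S); split=> //; first exact: measurableC.
rewrite setCK.
have -> : n S = n (S `\` S') + n (S `&` S') by exact: measureDI.
rewrite (null n (S `\` S') (~` S'))//.
- by rewrite add0e; apply/eqP; rewrite eq_le measure_ge0 andbT -[leRHS]muA nmu.
- exact: measurableD.
- exact: measurableC.
Qed.

End FlowSingular.

Section LowerIntegral.
Local Open Scope ereal_scope.
Import HBNNSimple.

(* [f] need not be measurable: the integral is then the lower integral. *)
Lemma ge0_integral_full_restrict d (T : measurableType d) (R : realType)
    (m : {measure set T -> \bar R}) (D : set T) (f : T -> \bar R) :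
  measurable D -> m (~` D) = 0 -> (forall x, 0 <= f x) ->
  measurable_fun setT (f \_ D) -> \int[m]_x f x = \int[m]_x (f \_ D) x.
Proof.
move=> mD mD0 f0 mf.
have fD0 x : 0 <= (f \_ D) x by rewrite patchE; case: ifP.
apply/eqP; rewrite eq_le; apply/andP; split; last first.
  rewrite !ge0_integralTE//; apply: ereal_sup_le => _ [h hf <-]; exists h => //= x.
  by apply: le_trans (hf x) _; rewrite patchE; case: ifP.
rewrite ge0_integralTE//; apply: ge_ereal_sup => _ [h hf <-].
have -> : sintegral m h = \int[m]_x (h x)%:E by rewrite integral_nnsfun// patch_setT.
have mh : measurable_fun setT (fun x => (h x)%:E) by exact/measurable_EFinP.
apply: ae_ge0_le_integral => //.
  by move=> x _; rewrite lee_fin.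
exists (~` D); split=> //; first exact: measurableC.
move=> x /= xn xD; apply: xn => _; rewrite patchE mem_set//; exact: hf.
Qed.

End LowerIntegral.

(** * Singularity of the source laws of separated targets *)

Section BoxSingular.
Context {R : realType} {k : nat}.
Let X := Xpt R k.
Let C := config R k.

Lemma ae_full (m : probability C R) (Q : C -> Prop) : {ae m, forall x, Q x} ->
  exists G : set C, [/\ measurable G, G `<=` Q & m (~` G) = 0%E].
Proof.
move=> [N [mN N0 sub]]; exists (~` N); split; rewrite ?setCK//; first exact: measurableC.
by move=> x Nx; apply: contrapT => Qx; apply: Nx; exact: sub.
Qed.

Lemma HypH_good (m : probability C R) : HypH m ->
  exists G : set C, [/\ measurable G, G `<=` good & m (~` G) = 0%E].
Proof.
move=> [h1 h2 _ _ _].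
have [G1 [mG1 s1 e1]] := ae_full _ _ h1; have [G2 [mG2 s2 e2]] := ae_full _ _ h2.
exists (G1 `&` G2); split; first exact: measurableI.
  by move=> x [/s1 ? /s2 ?]; split.
rewrite setCI; apply/eqP; rewrite eq_le measure_ge0 andbT.
apply: (@le_trans _ _ (m (~` G1) + m (~` G2))%E); last by rewrite e1 e2 adde0.
by apply: measureU2; exact: measurableC.
Qed.

Section Optimal.
Variables mu nu : probability C R.
Hypotheses (HmuH : HypH mu) (Hfin : (ereal_inf [set mk_cost g | g in couplings mu nu] < +oo)%E).
Variable gamma : probability (C * C)%type R.
Hypothesis Hopt : optimal mu nu gamma.
Variables G1 G2 : set C.
Hypotheses (mG1 : measurable G1) (mG2 : measurable G2) (gG1 : G1 `<=` good)
  (gG2 : G2 `<=` good) (muG1 : mu (~` G1) = 0%E) (nuG2 : nu (~` G2) = 0%E).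

(** The cost cut to 0 off a product of full sets: measurable everywhere, with the same integral as
    [cost] under every coupling of [mu] and [nu]. *)
Definition gcost : C * C -> \bar R := (fun p => cost p.1 p.2) \_ (G1 `*` G2).

Lemma measurable_costG : measurable_fun (G1 `*` G2) (fun p : C * C => cost p.1 p.2).
Proof.
rewrite (_ : (fun p : C * C => cost p.1 p.2) = (fun p : C * C => ccost setT setT p.1 p.2)).
  by apply: measurable_ccost => //; exact: measurableT.
by apply/funext => p; rewrite ccostT.
Qed.

Lemma measurable_gcost : measurable_fun setT gcost.
Proof.
apply/(measurable_restrictT _ (measurableX mG1 mG2)); exact: measurable_costG.
Qed.

Lemma gcost_ge0 p : (0 <= gcost p)%E.
Proof. by rewrite /gcost patchE; case: ifP => // _; exact: cost_ge0. Qed.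

(** Displaced configurations may leave [G1], where [gcost] is 0; an upper bound on [cost] still
    bounds [gcost] there. *)
Lemma gcost_le p : (gcost p <= cost p.1 p.2)%E.
Proof. by rewrite /gcost patchE; case: ifP => // _; exact: cost_ge0. Qed.

Lemma gcostE p : G1 p.1 -> G2 p.2 -> gcost p = cost p.1 p.2.
Proof. by move=> g1 g2; rewrite /gcost patchE mem_set. Qed.

Lemma coupling_null g : couplings mu nu g -> g (~` (G1 `*` G2)) = 0%E.
Proof.
move=> cg.
have [e1 _] := cg _ (measurableC mG1); have [_ e2] := cg _ (measurableC mG2).
have m1 : measurable (fst @^-1` (~` G1) : set (C * C)).
  by rewrite -[X in measurable X]setTI; apply: measurable_fst => //; exact: measurableC.
have m2 : measurable (snd @^-1` (~` G2) : set (C * C)).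
  by rewrite -[X in measurable X]setTI; apply: measurable_snd => //; exact: measurableC.
apply/eqP; rewrite eq_le measure_ge0 andbT.
apply: (@le_trans _ _ (g ((fst @^-1` (~` G1)) `|` (snd @^-1` (~` G2))))).
  apply: le_measure; rewrite ?inE.
  - by apply: measurableC; exact: measurableX.
  - exact: measurableU.
  - by move=> p np; apply: contrapT => /not_orP[/= /contrapT p1 /contrapT p2]; apply: np.
apply: (@le_trans _ _ (g (fst @^-1` (~` G1)) + g (snd @^-1` (~` G2)))%E).
  exact: measureU2.
by rewrite e1 e2 muG1 nuG2 adde0.
Qed.

Lemma mk_costE g : couplings mu nu g -> mk_cost g = (\int[g]_p gcost p)%E.
Proof.
move=> cg; apply: ge0_integral_full_restrict.
- exact: measurableX.
- exact: coupling_null.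
- by move=> p; exact: cost_ge0.
- exact: measurable_gcost.
Qed.

Lemma gcost_fin : (\int[gamma]_p gcost p < +oo)%E.
Proof.
have [cg opt] := Hopt; rewrite -mk_costE//.
have [_ [g cg' <-] h] := ereal_inf_lt Hfin.
by apply: le_lt_trans h; exact: opt.
Qed.

(* By [ccost_attained], the last condition says that some optimal plan sends [U] into [V]. *)
Definition sent (U V : set X) : set (C * C) :=
  (G1 `*` G2) `&` [set p | [/\ cnt p.1 U = 1%E, (cost p.1 p.2 < +oo)%E &
     (ccost U V p.1 p.2 <= cost p.1 p.2)%E]].

Lemma measurable_sent U V : bborel U -> measurable (V : set (@borelX R k)) -> measurable (sent U V).
Proof.
move=> bU mV; have [mU _] := bU.
have mG := measurableX mG1 mG2.
have -> : sent U V = ((G1 `*` G2) `&` [set p | (cost p.1 p.2 < +oo)%E]) `&`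
   (((G1 `*` G2) `&` [set p | (ccost U V p.1 p.2 <= cost p.1 p.2)%E]) `&`
    (fst @^-1` [set eta : C | cnt eta U = (1%:R)%:E])).
  apply/seteqP; split=> p /=; first by move=> [? [? ? ?]].
  by move=> [[? ?] [[_ ?] ?]]; split.
apply: measurableI.
  by apply: emeasurable_fun_infty_o => //; exact: measurable_costG.
apply: measurableI.
  by apply: measurable_lee => //; [exact: measurable_ccost|exact: measurable_costG].
rewrite -[X in measurable X]setTI; apply: measurable_fst => //.
exact: measurable_cnt_eq.
Qed.

(** The thresholds stand in for the unknown targets: going down is charged as if the target had
    height [q], going up as if it had height [q']. The gap [q < q'] makes the exchange strictly
    profitable. *)
Lemma sent_singular (c : X) (r : R) (i : 'I_k) (q q' : R) : 0 < r -> q < q' ->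
  exists Z : set C, [/\ measurable Z,
    gamma (sent (box c r) [set y | y ord0 i <= q] `&` (fst @^-1` Z)) = 0%E &
    gamma (sent (box c r) [set y | q' <= y ord0 i] `&` (fst @^-1` (~` Z))) = 0%E].
Proof.
move=> r0 qq'.
set U := box c r; have bU : bborel U := bborel_box c r r0.
pose V : set X := [set y | y ord0 i <= q]; pose V' : set X := [set y | q' <= y ord0 i].
have mV : measurable (V : set (@borelX R k)) by exact: measurable_coord_le.
have mV' : measurable (V' : set (@borelX R k)) by exact: measurable_coord_ge.
have mE := measurable_sent U V bU mV; have mE' := measurable_sent U V' bU mV'.
pose phi t : X -> X := box_flow c r i t.
have phiD s t x : phi s (phi t x) = phi (s + t) x by exact: box_flow_add.
have phi0 x : phi 0 x = x by exact: box_flow0.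
have phiK t : cancel (phi t) (phi (- t)) by move=> x; rewrite phiD addNr phi0.
have phiK' t : cancel (phi (- t)) (phi t) by move=> x; rewrite phiD addrN phi0.
have phiU t x : U (phi t x) <-> U x by exact: box_flow_box.
have phiout t x : ~ U x -> phi t x = x by exact: box_flow_out.
have bndU : bounded_pt U by have [] := bU.
have mPhi t : measurable_fun setT (img (phi t) : C -> C).
  apply: (img_measurable (phi t) (phi (- t)) (phiK t) (phiK' t)).
    exact: measurable_box_flow.
  exact: (img_bounded (phi t) U (phiout t) bndU).
have imgphi t eta x : img (phi t) eta x = eta (phi (- t) x).
  exact: (imgE (phi t) (phi (- t)) (phiK t)).
pose a (eta : C) : R := pt U eta ord0 i.
have ma : measurable_fun setT a by exact: measurable_pt_coord.
have [M aM] : exists M, forall eta, `|a eta| <= M.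
  have [M UM] := bndU; exists (Num.max M 0) => eta; rewrite le_max.
  have [c1|c1] := pselect (cnt eta U = 1%E).
    have [Up _ _] := ptP _ _ c1; apply/orP; left.
    exact: le_trans (coord_le_norm _ _) (UM _ Up).
  by rewrite /a (pt_out _ _ c1) mxE normr0 lexx orbT.
pose Df t q (eta : C) : R :=
  (a (img (phi t) eta) - a eta) * (a (img (phi t) eta) + a eta - 2 * q) / 2.
have mDf t q1 : measurable_fun setT (Df t q1).
  have maf : measurable_fun setT (fun eta => a (img (phi t) eta)) by exact: measurableT_comp.
  apply: measurable_funM => //; apply: measurable_funM; first exact: measurable_funB.
  by apply: measurable_funB => //; exact: measurable_funD.
(* One bound on [Df] for both thresholds: the difference of coordinates is at most [2M], the other
   factor at most [2M + 2(|q| + |q'|)], and the division by 2 is dropped. *)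
pose K := (M + M) * (M + M + 2 * (`|q| + `|q'|)).
have DfK t q1 eta : `|q1| <= `|q| + `|q'| -> `|Df t q1 eta| <= K.
  move=> q1K; rewrite /Df !normrM.
  have M0 : 0 <= M by apply: le_trans (aM eta).
  apply: (@le_trans _ _ (`|a (img (phi t) eta) - a eta| * `|a (img (phi t) eta) + a eta - 2 * q1|)).
    by rewrite ler_piMr ?mulr_ge0// gtr0_norm// invf_le1// ler1n.
  apply: ler_pM => //.
    by apply: le_trans (ler_normB _ _) _; apply: lerD.
  apply: le_trans (ler_normB _ _) _; apply: lerD.
    by apply: le_trans (ler_normD _ _) _; apply: lerD.
  by rewrite normrM ger0_norm// ler_pM2l.
have apt t eta : cnt eta U = 1%E -> a (img (phi t) eta) = phi t (pt U eta) ord0 i.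
  by move=> c1; rewrite /a (pt_img (phi t) (phi (- t)) (phiK t) (phiK' t) U (phiU t)).
have [cg opt] := Hopt.
have gain1 t q1 (W : set X) p : sent U W p ->
    (forall y, W y -> 0 <= (phi t (pt U p.1) ord0 i - pt U p.1 ord0 i) * (y ord0 i - q1)) ->
    (gcost (img (phi t) p.1, p.2) <= gcost p + (Df t q1 p.1)%:E)%E.
  move=> [[g1 g2] [c1 cf cc]] Wy.
  apply: le_trans (gcost_le _) _; rewrite (gcostE p)//= /Df (apt t)//.
  apply: (transport_cost (phi t) (phi (- t)) (phiK t) (phiK' t) U (phiout t) W i q1) => //.
  - exact: gG1.
  - exact: gG2.
  - by move=> j ji; exact: box_flow_coord.
have dec t x : 0 < t -> U x -> phi t x ord0 i < x ord0 i by exact: box_flow_lt.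
pose m := push_restr _ _ _ _ _ gamma _ mE _ (@measurable_fst _ _ C C).
pose n := push_restr _ _ _ _ _ gamma _ mE' _ (@measurable_fst _ _ C C).
have mfst A : measurable A -> measurable (fst @^-1` A : set (C * C)).
  by move=> mA; rewrite -[X in measurable X]setTI; exact: measurable_fst.
have [||||||||Z [mZ mZ0 nZ0]] := flow_singular mu m n (fun t => img (phi t)).
- by rewrite (le_lt_trans (probability_le1 _ _)) ?ltry.
- exact: mPhi.
- move=> s t eta; apply/funext => x; rewrite !imgphi; congr (eta _).
  by rewrite phiD opprD addrC.
- by move=> eta; apply/funext => x; rewrite imgphi oppr0 phi0.
- move=> t A mA; have [_ _ _ qi _] := HmuH.
  apply: (qi (flow_field c r i)) => //; last exact: is_flow_box_flow.
    exact: smooth_flow_field.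
  exact: compact_support_flow_field.
- move=> A mA; rewrite push_restrE; have [e1 _] := cg _ mA.
  apply: (@le_trans _ _ (gamma (fst @^-1` A))); last by rewrite e1.
  by apply: le_measure; rewrite ?inE//; [apply: measurableI => //; exact: mfst|exact: mfst].
- move=> A mA; rewrite push_restrE; have [e1 _] := cg _ mA.
  apply: (@le_trans _ _ (gamma (fst @^-1` A))); last by rewrite e1.
  by apply: le_measure; rewrite ?inE//; [apply: measurableI => //; exact: mfst|exact: mfst].
- move=> s s0.
  have fK : cancel (img (phi s) : C -> C) (img (phi (- s))).
    by move=> eta; apply/funext => x; rewrite !imgphi opprK phiK.
  have gK : cancel (img (phi (- s)) : C -> C) (img (phi s)).
    by move=> eta; apply/funext => x; rewrite !imgphi opprK phiK'.
  have [||||||||Z [mZ Z1 Z2]] := @swap_singular _ _ C C R gamma (img (phi s)) (img (phi (- s)))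
    (sent U V) (sent U V') (mPhi s) (mPhi (- s)) fK gK mE mE' gcost measurable_gcost gcost_ge0
    gcost_fin (Df s q) (Df (- s) q') K.
  + exact: mDf.
  + exact: mDf.
  + by move=> eta; apply: DfK; rewrite lerDl.
  + by move=> eta; apply: DfK; rewrite lerDr.
  + move=> p Ep; apply: (gain1 s q V) => // y Vy.
    have [_ [c1 _ _]] := Ep; have [Ux _ _] := ptP _ _ c1.
    by rewrite mulr_le0// subr_le0// ltW// dec.
  + move=> p Ep; apply: (gain1 (- s) q' V') => // y Vy.
    have [_ [c1 _ _]] := Ep; have [Ux _ _] := ptP _ _ c1.
    rewrite mulr_ge0 ?subr_ge0//.
    have := dec s (phi (- s) (pt U p.1)) s0; rewrite phiK' => h; apply: ltW; apply: h.
    by apply/phiU.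
  + move=> p [_ [c1 _ _]]; have [Ux _ _] := ptP _ _ c1.
    rewrite /Df fK; set b := a (img _ _); set b0 := a p.1.
    have bb : b < b0 by rewrite /b apt//; exact: dec.
    (* The squares cancel between the two moves; what is left has the sign of [b - b0], negative
       since the point goes down. *)
    have -> : (b - b0) * (b + b0 - 2 * q) / 2 + (b0 - b) * (b0 + b - 2 * q') / 2 =
      (b - b0) * (q' - q) by field.
    by rewrite nmulr_rlt0 ?subr_lt0// subr_gt0.
  + move=> Q Q1 Q2.
    have cQ : couplings mu nu Q.
      by move=> A mA; have [e1 e2] := cg A mA; rewrite Q1// Q2.
    by rewrite -!mk_costE//; exact: opt.
  exists Z; split=> //.
    by rewrite push_restrE setIC.
  by rewrite push_restrE setIC.
exists Z; split=> //; by rewrite setIC.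
Qed.

End Optimal.
End BoxSingular.

(** * The transport map *)

Section Target.
Context {R : realType} {k : nat}.
Let X := Xpt R k.
Let C := config R k.

(** An open set is the union of the boxes [ubox n] inside it, and the preimage of a box is a finite
    intersection of conditions on coordinates. *)
Lemma measurable_row (d : measure_display) (T : measurableType d) (f : T -> X) :
  (forall j, measurable_fun setT (fun x => f x ord0 j)) ->
  measurable_fun setT (f : T -> @borelX R k).
Proof.
move=> mf.
have mbox n : measurable (f @^-1` (ubox n)).
  rewrite /ubox; case: unpickle => [[c e]|]; last by rewrite preimage_set0.
  set r := _^-1; set c' := map_mx _ _.
  have -> : f @^-1` box c' r =
      \bigcap_(j in [set: 'I_k]) (fun x => f x ord0 j) @^-1` `]c' ord0 j - r, c' ord0 j + r[.
    apply/seteqP; split=> x h.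
      by move=> j _ /=; rewrite in_itv/= -ltr_distl; exact: h.
    by move=> j; have := h j I; rewrite /= in_itv/= -ltr_distl.
  apply: fin_bigcap_measurable => // j _.
  by rewrite -[X in measurable X]setTI; exact: mf.
apply: (@measurability _ _ T (@borelX R k) setT f [set U : set X | open U]) => // Y [W oW <-].
rewrite setTI.
have -> : f @^-1` W = \bigcup_(n in [set n | ubox n `<=` W]) f @^-1` (ubox n).
  apply/seteqP; split=> x /=; last by move=> [n nW fx]; exact: nW.
  move=> Wx; have : nbhs (f x) W by exact: open_nbhs_nbhs.
  move=> /nbhs_ballP[e e0 eW]; have [n nx nP] := @ubox_nbhs R k (f x) e e0.
  exists n => // y /nP h; apply: eW; rewrite -ball_normE /= distrC.
  exact: h.
by apply: bigcup_measurable => n _; exact: mbox.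
Qed.

(* Coordinate [i] of the image of the point isolated by [ubox n]: [W n i q] is the
   event that this coordinate is at most [q]. *)
Variable W : nat -> 'I_k -> rat -> set C.
Hypothesis mW : forall n i q, measurable (W n i q).

(** The coordinate is the infimum of the rationals [q] whose event holds; [+oo] drops the other
    indices from that infimum. *)
Definition tcoord_seq (n : nat) (i : 'I_k) (m : nat) (eta : C) : \bar R :=
  if (unpickle m : option rat) is Some q then
    (if eta \in W n i q then (ratr q : R)%:E else +oo%E) else +oo%E.

Definition tcoord n i eta : R := fine (ereal_inf (range (fun m => tcoord_seq n i m eta))).

Lemma measurable_tcoord n i : measurable_fun setT (tcoord n i).
Proof.
apply: (measurableT_comp (fine_measurable measurableT)).
have mt m : measurable_fun setT (tcoord_seq n i m).
  rewrite /tcoord_seq; case: unpickle => [q|]; last exact: measurable_cst.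
  apply: measurable_fun_ifT; [|exact: measurable_cst|exact: measurable_cst].
  apply: (measurable_fun_bool true); rewrite setTI preimage_mem_true; exact: mW.
apply: (measurability _ (ErealGenCInfty.measurableE R)) => // Y [V [r ->] <-].
rewrite setTI (_ : _ @^-1` _ = \bigcap_m (tcoord_seq n i m @^-1` `[r%:E, +oo[)).
  apply: bigcapT_measurable => m; rewrite -[X in measurable X]setTI.
  by apply: mt => //; exact: emeasurable_itv.
apply/seteqP; split=> eta /=; rewrite in_itv/= andbT.
  move=> h m _ /=; rewrite in_itv/= andbT; apply: le_trans h _.
  by apply: ereal_inf_lbound; exists m.
move=> h; apply: le_ereal_inf_tmp => x [m _ <-].
by have := h m I; rewrite /= in_itv/= andbT.
Qed.

Lemma tcoordE n i eta (y : R) : (forall q, W n i q eta <-> y <= ratr q) ->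
  tcoord n i eta = y.
Proof.
move=> h; rewrite /tcoord (_ : ereal_inf _ = y%:E)//.
apply/eqP; rewrite eq_le; apply/andP; split.
  apply/lee_addgt0Pr => e e0.
  have ye : y < y + e by rewrite ltrDl.
  have [q] := rat_in_itvoo ye; rewrite in_itv/= => /andP[q1 q2].
  apply: (@le_trans _ _ (ratr q)%:E); last by rewrite -EFinD lee_fin ltW.
  apply: ereal_inf_lbound; exists (pickle q) => //.
  rewrite /tcoord_seq pickleK mem_set//; apply/h; exact: ltW.
apply: le_ereal_inf_tmp => x [m _ <-]; rewrite /tcoord_seq.
case: unpickle => [q|]; last by rewrite leey.
by case: ifPn => [|_]; rewrite ?leey// inE => /h; rewrite lee_fin.
Qed.

Definition tpt n (eta : C) : X := \row_i tcoord n i eta.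

Lemma measurable_tpt n : measurable_fun setT (tpt n : C -> @borelX R k).
Proof.
apply: measurable_row => j.
rewrite (_ : (fun eta => tpt n eta ord0 j) = tcoord n j); first exact: measurable_tcoord.
by apply/funext => eta; rewrite mxE.
Qed.

Variable L : set X.
Hypothesis bL : bborel L.

(** The condition on the count makes the index set finite for every [eta], not just almost surely,
    so that [tconf] has finite multiplicities everywhere. *)
Definition source n (eta : C) : Prop :=
  [/\ isol n eta, L (ipt n eta) & (cnt eta L < +oo)%E].

Lemma measurable_source n : measurable [set eta : C | source n eta].
Proof.
have -> : [set eta : C | source n eta] = [set eta | isol n eta] `&`
    ((ipt n : C -> @borelX R k) @^-1` L `&` [set eta : C | (cnt eta L < +oo)%E]).
  by apply/seteqP; split=> eta /= [] // ? []; split.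
apply: measurableI; first exact: measurable_isol.
apply: measurableI.
  rewrite -[X in measurable X]setTI; apply: measurable_pt => //; first exact: bborel_ubox.
  by case: bL.
rewrite -[X in measurable X]setTI; apply: emeasurable_fun_infty_o => //.
exact: measurable_cnt.
Qed.

Lemma source_finite eta : finite_set [set n | source n eta].
Proof.
have [fin|inf] := pselect (cnt eta L < +oo)%E; last first.
  by rewrite (_ : [set n | _] = set0)//; apply/seteqP; split=> // n [].
have fin' := cnt_fin eta L fin.
pose g x := xget 0%N [set n | source n eta /\ ipt n eta = x].
apply: sub_finite_set (finite_image g fin') => n sn; have [si Ln _] := sn.
exists (ipt n eta); first by split=> //; rewrite (iptP n eta si).
rewrite /g; case: xgetP => [m _ [[im _ _] E]|/(_ n)[]//].
exact: ipt_inj im si E.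
Qed.

(* The configuration [sum_n delta_(tpt n eta)] over the points of [eta] in [L]. *)
Definition tconf (eta : C) : C := fun y =>
  size (finmap.enum_fset (fset_set [set n | source n eta /\ tpt n eta = y])).

Lemma tconfE eta y : ((tconf eta y)%:R : R)%:E =
  (\esum_(n in [set n | source n eta /\ tpt n eta = y]) 1)%E.
Proof.
have fS : finite_set [set n | source n eta /\ tpt n eta = y].
  by apply: sub_finite_set (source_finite eta) => n [].
rewrite esum_fset// fsbig_finite//= /tconf sumEFin big_const_seq count_predT.
by rewrite iter_addr addr0.
Qed.

Lemma cnt_tconf eta (B : set X) : cnt (tconf eta) B =
  (\esum_(n in [set n | source n eta /\ B (tpt n eta)]) 1)%E :> \bar R.
Proof.
rewrite /cnt (eq_esum (fun y _ => tconfE eta y)) esum_esum//.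
apply: reindex_esum (fun n => (tpt n eta, n)) _ _.
split.
- by move=> n /= [sn Bn].
- by move=> n m _ _ [].
- by move=> [y n] /= [By [sn E]]; exists n; rewrite /= ?E.
Qed.

Lemma measurable_tconf : measurable_fun setT (tconf : C -> C).
Proof.
apply: (@measurability _ _ C C setT tconf (@config_gen R k)) => // Y [V [B [n [mB bB ->]]] <-].
rewrite setTI.
pose h m (eta : C) : \bar R := (\1_([set eta : C | source m eta /\ B (tpt m eta)]) eta)%:E.
have mh : measurable_fun setT (fun eta => \sum_(0 <= m <oo) h m eta)%E.
  apply: (@ge0_emeasurable_sum _ _ _ _ _ predT) => [m eta _ _|m _].
    by rewrite lee_fin indicE.
  apply/measurable_EFinP; apply: measurable_indic.
  apply: measurableI; first exact: measurable_source.
  by rewrite -[X in measurable X]setTI; exact: measurable_tpt.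
have E eta : cnt (tconf eta) B = (\sum_(0 <= m <oo) h m eta)%E.
  rewrite cnt_tconf esum_mkcond nneseries_esumT; last by move=> m; rewrite lee_fin indicE.
  apply: eq_esum => m _; rewrite /h indicE.
  have -> : (eta \in [set eta : C | source m eta /\ B (tpt m eta)]) =
    (m \in [set m | source m eta /\ B (tpt m eta)]) by apply/idP/idP; rewrite !inE.
  by case: ifP.
rewrite (_ : _ @^-1` _ = (fun eta => \sum_(0 <= m <oo) h m eta)%E @^-1` [set (n%:R)%:E]).
  by rewrite -[X in measurable X]setTI; exact: mh.
by apply/seteqP; split=> eta /=; rewrite E.
Qed.

(** A left inverse of the splitting of [eta] into its restrictions to [L] and to the complement; it
    turns a map of [eta] into a map of the two restrictions. *)
Definition join_conf (p : C * C) : C := fun x => (p.1 x + p.2 x)%N.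

Lemma measurable_join_conf : measurable_fun setT (join_conf : C * C -> C).
Proof.
apply: (@measurability _ _ (C * C)%type C setT join_conf (@config_gen R k)) => // Y [V [B [n [mB bB ->]]] <-].
rewrite setTI.
have E p : cnt (join_conf p) B = (cnt p.1 B + cnt p.2 B)%E :> \bar R.
  rewrite /cnt -esumD; try by move=> ? _; rewrite lee_fin.
  by apply: eq_esum => x _; rewrite /join_conf natrD EFinD.
have mcB : bborel B by [].
rewrite (_ : _ @^-1` _ = (fun p : C * C => cnt p.1 B + cnt p.2 B)%E @^-1` [set (n%:R)%:E]).
  rewrite -[X in measurable X]setTI.
  suff : measurable_fun setT (fun p : C * C => cnt p.1 B + cnt p.2 B)%E by exact.
  apply: emeasurable_funD.
    by apply: (measurableT_comp (measurable_cnt B mcB)).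
  by apply: (measurableT_comp (measurable_cnt B mcB)).
by apply/seteqP; split=> p /=; rewrite E.
Qed.

Lemma join_piL eta : join_conf (piL L eta, piL (~` L) eta) = eta.
Proof.
apply/funext => x; rewrite /join_conf /piL /=.
by case: asboolP => Lx; case: asboolP => // nLx; rewrite ?addn0 ?add0n//; case: nLx.
Qed.

End Target.

Lemma compact_bborel {R : realType} {k : nat} (L : set (Xpt R k)) : compact L -> bborel L.
Proof.
move=> cL; split.
  by apply: closed_borel; apply: compact_closed => //; exact: norm_hausdorff.
have [M [_ ML]] := compact_bounded cL.
by exists (M + 1) => x Lx; apply: ML => //; rewrite ltrDl.
Qed.

(** * Almost sure identification of the targets *)

Section Conclusion.
Context {R : realType} {k : nat}.
Let X := Xpt R k.
Let C := config R k.

(** The indices counted by [tconf] at [y] correspond, through the isolated point, to the sources in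
    [L] that [beta] sends to [y], each of multiplicity 1. *)
Lemma tconf_plan (W : nat -> 'I_k -> rat -> set C) (L : set X) (eta omega : C)
    (beta : pconfig R k) (y : X) :
  good eta -> good omega -> plans eta omega beta -> bounded_pt L ->
  (forall n z, isol n eta -> beta (ipt n eta, z) <> 0%N -> tpt W n eta = z) ->
  ((tconf W L eta y)%:R : R)%:E = (\esum_(x in L) ((beta (x, y))%:R : R)%:E)%E.
Proof.
move=> ge go pb bL tW; rewrite tconfE.
transitivity (\esum_(x in L `&` [set x | beta (x, y) <> 0%N]) 1%E : \bar R)%E; last first.
  rewrite esum_mkcondr; apply: eq_esum => x _; case: ifPn => [|/negP].
    by rewrite inE => /(plan_supp eta omega beta x y ge go pb)[_ _ ->].
  by rewrite inE => /contrapT ->.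
apply/esym; apply: (reindex_esum _ _ (fun n => ipt n eta)); split.
- move=> n /= [[sn Ln _] E]; split=> //.
  have [z [bz _]] := plan_row eta omega beta (ipt n eta) pb (iptP n eta sn).
  have bz0 : beta (ipt n eta, z) <> 0%N by rewrite bz.
  by move: (tW n z sn bz0); rewrite E => ->.
- by move=> n m /set_mem[[sn _ _] _] /set_mem[[sm _ _] _]; exact: ipt_inj.
- move=> x /= [Lx bxy]; have [ex _ _] := plan_supp eta omega beta x y ge go pb bxy.
  have [n sn xE] := isol_ex eta x ge.1 ex.
  exists n => //; split; last by apply: tW => //; rewrite -xE.
  by split=> //; [rewrite -xE|exact: ge.1].
Qed.

Variables mu nu : probability C R.
Hypotheses (HmuH : HypH mu) (HnuH : HypH nu).
Hypothesis Hfin : (ereal_inf [set mk_cost g | g in couplings mu nu] < +oo)%E.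
Variable gamma : probability (C * C)%type R.
Hypothesis Hopt : optimal mu nu gamma.
Variables G1 G2 : set C.
Hypotheses (mG1 : measurable G1) (mG2 : measurable G2).
Hypotheses (gG1 : G1 `<=` good) (gG2 : G2 `<=` good).
Hypotheses (muG1 : mu (~` G1) = 0%E) (nuG2 : nu (~` G2) = 0%E).

Let low (i : 'I_k) (q : rat) : set X := [set y | y ord0 i <= ratr q].
Let high (i : 'I_k) (q : rat) : set X := [set y | ratr q <= y ord0 i].

(** The condition [q < q'] sits under the existential so that a measurable [Z] can be chosen for all
    indices at once. *)
Lemma ubox_singular (n : nat) (i : 'I_k) (q q' : rat) : exists Z : set C,
  measurable Z /\ (q < q' ->
    gamma (sent G1 G2 (ubox n) (low i q) `&` fst @^-1` Z) = 0%E /\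
    gamma (sent G1 G2 (ubox n) (high i q') `&` fst @^-1` (~` Z)) = 0%E).
Proof.
have [qq|] := boolP (q < q'); last by exists set0.
rewrite /ubox; case: unpickle => [cm|].
  have r0 : 0 < cm.2.+1%:R^-1 :> R by rewrite invr_gt0.
  have qq' : ratr q < ratr q' :> R by rewrite ltr_rat.
  have [Z [mZ Z1 Z2]] := sent_singular mu nu HmuH Hfin gamma Hopt G1 G2 mG1 mG2
    gG1 gG2 muG1 nuG2 (map_mx ratr cm.1) _ i _ _ r0 qq'.
  by exists Z; split.
have E V A : sent G1 G2 set0 V `&` A = set0.
  apply/seteqP; split=> // p [[_ /=[+ _ _]] _].
  by rewrite /cnt esum_set0 => /eqP; rewrite eq_sym onee_eq0.
by exists set0; rewrite !E !measure0; split.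
Qed.

Lemma singular_separators : exists Z : nat -> 'I_k -> rat -> rat -> set C,
  (forall n i q q', measurable (Z n i q q')) /\
  {ae gamma, forall p, forall n i q q', q < q' ->
    (sent G1 G2 (ubox n) (low i q) p -> ~ Z n i q q' p.1) /\
    (sent G1 G2 (ubox n) (high i q') p -> Z n i q q' p.1)}.
Proof.
pose Z n i q q' := projT1 (cid (ubox_singular n i q q')).
have ZP n i q q' := projT2 (cid (ubox_singular n i q q')).
exists Z; split=> [n i q q'|]; first by case: (ZP n i q q').
pose P (j : nat * 'I_k * rat * rat) (p : C * C) := let: (n, i, q, q') := j in q < q' ->
    (sent G1 G2 (ubox n) (low i q) p -> ~ Z n i q q' p.1) /\
    (sent G1 G2 (ubox n) (high i q') p -> Z n i q q' p.1).
suff aeP j : {ae gamma, forall p, P j p}.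
  have : {ae gamma, forall p, forall m, if unpickle m is Some j then P j p else True}.
    apply/ae_foralln => m; case: unpickle => [j|]; first exact: aeP.
    exact: aeW.
  apply: filterS => p h n i q q'.
  by have := h (pickle (n, i, q, q')); rewrite pickleK.
case: j => [[[n i] q] q'] /=; have [mZ +] := ZP n i q q'.
have [qq|nqq] := pselect (q < q'); last by move=> _; exact: aeW.
move=> /(_ qq)[z1 z2].
have mf A : measurable A -> measurable (fst @^-1` A : set (C * C)).
  by move=> mA; rewrite -[X in measurable X]setTI; exact: measurable_fst.
have bU : bborel (ubox n : set X) by exact: bborel_ubox.
have n1 : gamma.-negligible (sent G1 G2 (ubox n) (low i q) `&` fst @^-1` Z n i q q').
  apply/negligibleP => //; apply: measurableI; last exact: mf.
  by apply: measurable_sent => //; exact: measurable_coord_le.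
have n2 : gamma.-negligible (sent G1 G2 (ubox n) (high i q') `&` fst @^-1` (~` Z n i q q')).
  apply/negligibleP => //; apply: measurableI; last by apply: mf; exact: measurableC.
  by apply: measurable_sent => //; exact: measurable_coord_ge.
apply: negligibleS (negligibleU n1 n2) => p /= np.
apply: contrapT => /not_orP[h1 h2]; apply: np => _; split.
  by move=> s z; apply: h1.
by move=> s; apply: contrapT => z; apply: h2.
Qed.

Lemma ae_good_cost : {ae gamma, forall p,
  [/\ G1 p.1, G2 p.2 & (cost p.1 p.2 < +oo)%E]}.
Proof.
have mG := measurableX mG1 mG2.
have n1 : gamma.-negligible (~` (G1 `*` G2)).
  apply/negligibleP; first exact: measurableC.
  exact: coupling_null muG1 nuG2 _ Hopt.1.
have ig : gamma.-integrable setT (gcost G1 G2).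
  apply/integrableP; split; first exact: measurable_gcost.
  rewrite (eq_integral (gcost G1 G2)); last by move=> p _; rewrite gee0_abs// gcost_ge0.
  exact: gcost_fin mG1 mG2 gG1 gG2 muG1 nuG2.
have aefin := integrable_ae measurableT ig.
apply: filterS2 aefin (n1 : {ae gamma, forall p, (G1 `*` G2) p}) => p fp [/= g1 g2].
by split=> //; rewrite -(gcostE G1 G2)//; have := fp I; rewrite fin_numElt => /andP[].
Qed.

(** Any plan realising the cost is a competitor for the constrained cost, so what holds on the event
    [sent] holds for all optimal plans. *)
Lemma sent_of_plan (eta omega : C) (beta : pconfig R k) (n : nat) (z : X) (V : set X) :
  G1 eta -> G2 omega -> (cost eta omega < +oo)%E -> realizes beta eta omega ->
  isol n eta -> beta (ipt n eta, z) <> 0%N -> V z ->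
  sent G1 G2 (ubox n) V (eta, omega).
Proof.
move=> g1 g2 cfin [pb cb] sn bz Vz; split=> //; split=> //=; first by case: sn.
rewrite -cb; apply: ereal_inf_lbound; exists beta => //; split=> // -[x y] /= bxy Ux.
have [ex _ _] := plan_supp eta omega beta x y (gG1 _ g1) (gG2 _ g2) pb bxy.
have xE : x = ipt n eta by apply: pt_uniq => //; [case: sn|rewrite ex].
rewrite xE in bxy.
by rewrite (plan_inj_r eta omega beta _ y z (gG1 _ g1) (gG2 _ g2) pb bxy bz).
Qed.

Lemma optimal_target (L : set X) : bborel L ->
  exists T : C -> C, measurable_fun setT T /\
    {ae gamma, forall p : C * C, forall beta : pconfig R k, realizes beta p.1 p.2 ->
      forall y : X, ((T p.1 y)%:R : R)%:E = (\esum_(x in L) ((beta (x, y))%:R : R)%:E)%E}.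
Proof.
move=> bL; have [Z [mZ aeZ]] := singular_separators.
(* [Z n i q q'] excludes coordinates at most [q] and includes those at least [q'], with no
   information in between. Taking all rationals [q' > q] closes the gap, because a coordinate above
   [q] is above some such [q']. *)
pose W n i q := ~` \bigcup_q' (if q < q' then Z n i q q' else set0).
have mW n i q : measurable (W n i q).
  by apply/measurableC/bigcupT_measurable_rat => q'; case: ifP.
exists (tconf W L); split; first exact: measurable_tconf.
apply: filterS2 aeZ ae_good_cost => -[eta omega] /= hZ [g1 g2 cfin] beta rb y.
apply: (tconf_plan _ _ eta omega) => //; [exact: gG1|exact: gG2|by case: rb|by case: bL|].
move=> n z sn bz; apply/rowP => i; rewrite mxE; apply: tcoordE => q.
have S := sent_of_plan _ _ _ n z _ g1 g2 cfin rb sn bz.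
split=> [Wq|zq [q' _]]; last first.
  by case: ifP => // qq' Zq; have [h _] := hZ n i q q' qq'; apply: h Zq; exact: S.
rewrite leNgt; apply/negP => qz.
have [q'] := rat_in_itvoo qz; rewrite in_itv/= ltr_rat => /andP[qq' q'z].
have [_ h] := hZ n i q q' qq'.
by apply: Wq; exists q' => //; rewrite qq'; apply: h; apply: S; exact: ltW.
Qed.

End Conclusion.

Theorem theorem5p3 (R : realType) (k : nat)
  (mu nu : probability (config R k) R)
  (HmuH : HypH mu) (HnuH : HypH nu)
  (Hinf : mu [set eta | cnt eta setT = +oo%E] = 1%E)
  (Hreg : regular mu)
  (Hfin : (ereal_inf [set mk_cost g | g in couplings mu nu] < +oo)%E)
  (gamma : probability (config R k * config R k)%type R)
  (Hopt : optimal mu nu gamma)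
  (L : set (Xpt R k)) (HL : compact L) :
  exists T : (config R k * config R k)%type -> config R k,
    measurable_fun setT T /\
    {ae gamma, forall p : (config R k * config R k)%type,
      forall beta : pconfig R k, realizes beta p.1 p.2 ->
      forall y : Xpt R k,
        (((T (piL L p.1, piL (~` L) p.1) y)%:R : R)%:E =
         \esum_(x in L) ((beta (x, y))%:R : R)%:E)%E}.
Proof.
have [G1 [mG1 gG1 muG1]] := HypH_good _ HmuH.
have [G2 [mG2 gG2 nuG2]] := HypH_good _ HnuH.
have [T [mT aeT]] := optimal_target mu nu HmuH Hfin gamma Hopt G1 G2 mG1 mG2 gG1 gG2
  muG1 nuG2 L (compact_bborel L HL).
exists (T \o join_conf); split; first exact: measurableT_comp mT measurable_join_conf.
by apply: filterS aeT => p h beta rb y; rewrite /= join_piL; exact: h.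
Qed.
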